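(* Let $n\ge2$. There exist constants $C_1,C_2>0$ depending only on $n$ such that the following holds. Let $d\ge1$ and let $q:\mathcal{B}^d\to[-1,1]^n$ satisfy: (E1) $q(m)\ne\mathbf{1}$ and $q(m)\neq-\mathbf{1}$ for all $m\in\mathcal{B}^d$; (E2) there exists $0<\lambda_r\le1$ such that $\frac{1}{2^{d+1}}\sum_{m\in\mathcal{B}^d}r(m)\otimes r(m)\ge\lambda_r I$, where $r(m)=(q_1(m)-q_n(m),\dots,q_{n-1}(m)-q_n(m))\in\mathbb{R}^{n-1}$ and $I$ is the $(n-1)\times(n-1)$ identity matrix. Let $g:\mathbb{R}^n\to\mathbb{R}$ be Lipschitz continuous and assume: (G1) there exists $\theta_g>0$ such that $g(x+v)\ge g(x)+\theta_g\langle v,\mathbf{1}\rangle$ for all $x\in\mathbb{R}^n$, $v\in[0,\infty)^n$; (G2) $g(sx)=s\,g(x)$ for all $x\in\mathbb{R}^n$, $s>0$; (G3) $g(x+s\mathbf{1})=g(x)+s$ for all $x\in\mathbb{R}^n$, $s\in\mathbb{R}$. Let $u\in C(\mathbb{R}^n\times[0,1])$ be the unique viscosity solution of the final value problem (P) described in the context. Then for all $$N\ge\frac{C_1(d+1)^6}{d^2\lambda_r}$$ it holds that $$\|u_N^{\pm}-u\|_{L^\infty(\mathbb{R}^n\times[0,1])}\le C_2\,\mathrm{Lip}(g)\left(1+\frac{\mathrm{Lip}(g)^2}{\theta_g^2\vartheta_q^2}+\log\left(1+d^{-1/3}\lambda_r^{-1/6}N^{5/6}\right)\right)\lambda_r^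{-2/3}d^{2/3}N^{-1/6}.$$
   Context: Notation: $\mathcal{B}=\{-1,1\}$, $\mathbf{1}=(1,\dots,1)\in\mathbb{R}^n$. For symmetric matrices, $A\ge B$ means $A-B$ is positive semi-definite. $\mathrm{Lip}(g)=\sup_{x\ne y}|g(x)-g(y)|/|x-y|$. For $m=(m_1,\dots,m_d)\in\mathcal{B}^d$ and $b\in\mathcal{B}$, $m|b:=(m_2,\dots,m_d,b)\in\mathcal{B}^d$. $q=(q_1,\dots,q_n):\mathcal{B}^d\to[-1,1]^n$ is a fixed function (expert predictions). Value function: for $N\in\mathbb{N}$, $m\in\mathcal{B}^d$, $x\in\mathbb{R}^n$, $0\le\ell\le N$, set $V_N(x,N;m)=g(x)$ and, for $\ell\le N-1$, $$V_N(x,\ell;m)=\min_{|f_\ell|\le1}\max_{b_\ell=\pm1}\cdots\min_{|f_{N-1}|\le1}\max_{b_{N-1}=\pm1} g\Big(x+\sum_{i=\ell}^{N-1}b_i(q(m^i)-f_i\mathbf{1})\Big),$$ where $f_i\in\mathbb{R}$, $m^\ell=m$ and $m^{i+1}=m^i|b_i$. The rescaled value function is $u_N(x,t;m)=\frac{1}{\sqrt N}V_N(\sqrt N x,\lceil Nt\rceil;m)$ for $t\in[0,1]$, where $\lceil\cdot\rceil$ is the ceiling function, and $$u_N^+(x,t)=\max_{m\in\mathcal{B}^d}u_N(x,t;m),\qquad u_N^-(x,t)=\min_{m\in\mathcal{B}^d}u_N(x,t;m).$$ Constant: $\vartheta_q:=\min_{m\in\mathcal{B}^d}\min\{\sum_{i=1}^n(1-q_i(m)_+),\sum_{i=1}^n(1-q_i(m)_-)\}$,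 where $a_+=\max\{a,0\}$, $a_-=-\min\{a,0\}$. PDE: for $p\in\mathbb{R}^n$ with $\langle p,\mathbf{1}\rangle\ne0$ put $\xi(p,m)=q(m)-\frac{\langle p,q(m)\rangle}{\langle p,\mathbf{1}\rangle}\mathbf{1}$, and for a symmetric matrix $X$ put $F(X,p)=\frac1{2^{d+1}}\sum_{m\in\mathcal{B}^d}\langle X\xi(p,m),\xi(p,m)\rangle$ if $\langle p,\mathbf{1}\rangle\neq0$ and $F(X,p)=0$ if $\langle p,\mathbf{1}\rangle=0$. Problem (P) is $$u_t+F(\nabla^2u,\nabla u)=0\ \text{in }\mathbb{R}^n\times(0,1),\qquad u=g\ \text{on }\mathbb{R}^n\times\{t=1\}.$$ Viscosity solutions: an upper semicontinuous $u$ on $\mathbb{R}^n\times[0,1]$ is a viscosity subsolution if whenever $\varphi\in C^\infty(\mathbb{R}^n\times\mathbb{R})$ and $u-\varphi$ has a local maximum at $(x,t)\in\mathbb{R}^n\times(0,1)$, then $\varphi_t+F(\nabla^2\varphi,\nabla\varphi)\ge0$ at $(x,t)$; a lower semicontinuous $v$ is a viscosity supersolution if whenever $v-\varphi$ has a local minimum at $(x,t)\in\mathbb{R}^n\times(0,1)$, then $\varphi_t+F(\nabla^2\varphi,\nabla\varphi)\le0$ at $(x,t)$. A continuous function is a viscosity solution if it is both. ''The unique viscosity solution'' of (P) means the unique viscosity solution in $C(\mathbb{R}^n\times[0,1])$ with $u(\cdot,1)=g$ that has linear growth ($|u(x,t)|\le C(1+|x|)$ for some $C$) and is $\theta$-increasing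 for some $\theta>0$ ($u(x+s\mathbf{1},t)\ge u(x,t)+\theta s$ for all $(x,t)$ and $s\ge0$). *)

(* Defs.v *)
From HB Require Import structures.
From mathcomp Require Import all_boot all_order all_algebra.
From mathcomp Require Import all_classical all_reals all_analysis.

Set Implicit Arguments.
Unset Strict Implicit.
Unset Printing Implicit Defensive.

Import Order.TTheory GRing.Theory Num.Theory.
Import numFieldNormedType.Exports.

Local Open Scope classical_set_scope.
Local Open Scope ring_scope.

(* The library norm on 'rV[R]_n is the sup norm; |x| is Euclidean here. *)
Definition dot (R : realType) (n : nat) (x y : 'rV[R]_n) : R :=
  \sum_(i < n) x 0 i * y 0 i.

Definition enorm (R : realType) (n : nat) (x : 'rV[R]_n) : R :=
  Num.sqrt (dot x x).

Definition ones (R : realType) (n : nat) : 'rV[R]_n := const_mx 1.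

Definition is_lipschitz (R : realType) (n : nat) (g : 'rV[R]_n -> R) : Prop :=
  exists L : R, forall x y, `|g x - g y| <= L * enorm (x - y).

Definition Lip (R : realType) (n : nat) (g : 'rV[R]_n -> R) : R :=
  sup [set l | exists x y, x != y /\ l = `|g x - g y| / enorm (x - y)].

Definition psd (R : realType) (n : nat) (A : 'M[R]_n) : Prop :=
  A^T = A /\ forall v : 'rV[R]_n, 0 <= dot (v *m A) v.

(* Elements of {-1, 1}^d, with true standing for 1 and false for -1. *)
Definition history (d : nat) : finType := d.-tuple bool.

Definition pm1 (R : realType) (b : bool) : R := if b then 1 else -1.

(* m|b = (m_2, ..., m_d, b) *)
Definition append (d : nat) (m : history d) (b : bool) : history d :=
  [tuple of behead (rcons m b)].

(* The initial value of each fold is one of the values being compared. *)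
Definition max_hist (R : realType) (d : nat) (w : history d -> R) : R :=
  \big[Num.max/w [tuple of nseq d false]]_(m : history d) w m.

Definition min_hist (R : realType) (d : nat) (w : history d -> R) : R :=
  \big[Num.min/w [tuple of nseq d false]]_(m : history d) w m.

Section Game.
Context (R : realType) (n d : nat) (q : history d -> 'rV[R]_n).

Section Value.
Context (g : 'rV[R]_n -> R).

(* [minmax k x s m] is the nested min-max with [k] rounds left, where [s] is
   the sum of the increments b_i (q(m^i) - f_i 1) of the rounds already played
   and [m] the current history.  Each infimum is over a compact interval, and
   it is attained when [g] is continuous. *)
Fixpoint minmax (k : nat) (x s : 'rV[R]_n) (m : history d) : R :=
  if k is k'.+1 then
    let next f b :=
      minmax k' x (s + pm1 R b *: (q m - f *: ones R n)) (append m b) in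
    inf [set Num.max (next f true) (next f false) | f in [set f : R | `|f| <= 1]]
  else g (x + s).

Definition V (N : nat) (x : 'rV[R]_n) (l : nat) (m : history d) : R :=
  minmax (N - l) x 0 m.

Definition uN (N : nat) (x : 'rV[R]_n) (t : R) (m : history d) : R :=
  (Num.sqrt N%:R)^-1 *
    V N (Num.sqrt N%:R *: x) `|Num.ceil (N%:R * t)|%N m.

Definition uN_plus (N : nat) (p : 'rV[R]_n * R) : R :=
  max_hist (uN N p.1 p.2).

Definition uN_minus (N : nat) (p : 'rV[R]_n * R) : R :=
  min_hist (uN N p.1 p.2).

End Value.

Definition pos_part (a : R) : R := Num.max a 0.
Definition neg_part (a : R) : R := - Num.min a 0.

Definition vartheta : R :=
  min_hist (fun m => Num.min (\sum_(i < n) (1 - pos_part (q m 0 i)))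
                             (\sum_(i < n) (1 - neg_part (q m 0 i)))).

Definition xi (p : 'rV[R]_n) (m : history d) : 'rV[R]_n :=
  q m - (dot p (q m) / dot p (ones R n)) *: ones R n.

(* Vectors are rows, so that X v is written v *m X^T. *)
Definition F (X : 'M[R]_n) (p : 'rV[R]_n) : R :=
  if dot p (ones R n) == 0 then 0
  else (2 ^+ d.+1)^-1 * \sum_(m : history d) dot (xi p m *m X^T) (xi p m).

Definition last_ord (hn : (2 <= n)%N) : 'I_n :=
  Ordinal (etrans (ltn_predL n) (ltnW hn)).

Definition rvec (hn : (2 <= n)%N) (m : history d) : 'rV[R]_n.-1 :=
  \row_(i < n.-1) (q m 0 (widen_ord (leq_pred n) i) - q m 0 (last_ord hn)).

Definition r_nondegenerate (hn : (2 <= n)%N) (lam : R) : Prop :=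
  psd ((2 ^+ d.+1)^-1 *: (\sum_(m : history d) (rvec hn m)^T *m rvec hn m)
       - lam%:M).

End Game.

Section Calculus.
Context (R : realType) (n : nat).
Implicit Types (phi : 'rV[R]_n * R -> R) (p : 'rV[R]_n * R).

Definition dir (i : 'I_n) : 'rV[R]_n * R := (delta_mx 0 i, 0).
Definition dir_t : 'rV[R]_n * R := (0, 1).

(* phi is C^oo: all iterated directional derivatives exist and are continuous. *)
Definition smooth phi : Prop :=
  forall vs : seq ('rV[R]_n * R),
    let D := foldr (fun v f => 'D_v f) phi vs in
    continuous D /\ forall p v, derivable D p v.

Definition grad phi p : 'rV[R]_n := \row_(i < n) 'D_(dir i) phi p.

Definition hessian phi p : 'M[R]_n :=
  \matrix_(i < n, j < n) 'D_(dir i) ('D_(dir j) phi) p.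

Definition dt phi p : R := 'D_dir_t phi p.

(* R^n x [0, 1].  Functions on it are total functions on R^n x R, whose values
   outside of it are irrelevant. *)
Definition slab : set ('rV[R]_n * R) := [set p | 0 <= p.2 <= 1].

Definition usc_on (A : set ('rV[R]_n * R)) (u : 'rV[R]_n * R -> R) : Prop :=
  forall p, A p -> forall a, u p < a -> \forall p' \near within A (nbhs p), u p' < a.

Definition lsc_on (A : set ('rV[R]_n * R)) (u : 'rV[R]_n * R -> R) : Prop :=
  forall p, A p -> forall a, a < u p -> \forall p' \near within A (nbhs p), a < u p'.

(* The norm of L^oo(R^n x [0, 1]), as a supremum over all points. *)
Definition Linf (w : 'rV[R]_n * R -> R) : \bar R :=
  ereal_sup [set `|w p|%:E | p in slab].

End Calculus.

Section Viscosity.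
Context (R : realType) (n d : nat) (q : history d -> 'rV[R]_n).
Implicit Types u v : 'rV[R]_n * R -> R.

Definition subsolution u : Prop :=
  usc_on (@slab R n) u /\
  forall phi : 'rV[R]_n * R -> R, smooth phi -> forall p : 'rV[R]_n * R, 0 < p.2 < 1 ->
    (\forall p' \near p, u p' - phi p' <= u p - phi p) ->
    0 <= dt phi p + F q (hessian phi p) (grad phi p).

Definition supersolution v : Prop :=
  lsc_on (@slab R n) v /\
  forall phi : 'rV[R]_n * R -> R, smooth phi -> forall p : 'rV[R]_n * R, 0 < p.2 < 1 ->
    (\forall p' \near p, v p - phi p <= v p' - phi p') ->
    dt phi p + F q (hessian phi p) (grad phi p) <= 0.

Definition linear_growth u : Prop :=
  exists C : R, forall x t, 0 <= t <= 1 -> `|u (x, t)| <= C * (1 + enorm x).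

Definition increasing_along_ones (theta : R) u : Prop :=
  forall x t s, 0 <= t <= 1 -> 0 <= s ->
    u (x, t) + theta * s <= u (x + s *: ones R n, t).

(* u_t + F(D^2 u, D u) = 0 in R^n x (0, 1), u = g at t = 1, within the class of
   functions for which this final value problem has a unique solution. *)
Definition final_value_solution (g : 'rV[R]_n -> R) u : Prop :=
  [/\ {within @slab R n, continuous u},
      subsolution u /\ supersolution u,
      forall x, u (x, 1) = g x,
      linear_growth u &
      exists2 theta : R, 0 < theta & increasing_along_ones theta u].

End Viscosity.

(* Main.v *)
(* Since g commutes with translations along 1 = (1, ..., 1), the best unconstrained
   move f of the forecaster equalizes the two outcomes of a round.  Without the
   constraint |f| <= 1, the game value is therefore the expectation of g along a
   walk with steps +-q(m) / sqrt N driven by fair coin flips, and it is always a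
   lower bound.  Replace g by G, smoothed at scale
   delta = (1 + Lip(g)^2 / (theta_g vartheta_q)^2) kappa,
   kappa = d^(2/3) N^(-1/6).  Coupling two walks by their coins shows that the
   starting history changes the expectation of G by O(Lip(g) d^2 / (delta N)).
   The strict monotonicity of g leaves room theta_g vartheta_q in |f| <= 1, which
   absorbs this change, so the constraint costs nothing beyond the smoothing error.

   Averaged over histories, the walk satisfies the backward equation up to
   O(Lip(g) d^2 delta^(-2) N^(-1/2)) per unit of time: F is linear on Hessians that
   annihilate 1, and the first-order terms cancel to second order.  Interpolating
   linearly in time between grid points gives classical strict super- and
   subsolutions, and u is compared with them one time step at a time.  There the
   monotonicity of u along 1 keeps gradients away from the singular set of F.  With
   kappa^3 = d^2 N^(-1/2) both errors are of order kappa.  Nondegeneracy enters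
   only through lambda_r <= 1 and the lower bound on N. *)

Require Import Defs.
From mathcomp Require Import all_boot all_order all_algebra.
From mathcomp Require Import all_classical all_reals all_analysis.
From mathcomp Require Import ring lra.

Set Implicit Arguments.
Unset Strict Implicit.
Unset Printing Implicit Defensive.

Import Order.TTheory GRing.Theory Num.Theory.
Import numFieldNormedType.Exports.

Local Open Scope classical_set_scope.
Local Open Scope ring_scope.

(** The smoothing must produce bounded derivatives and also inherit every inequality
    [c <= g (z + y) - g z] valid for all [z]: the Lipschitz bound, translation along [ones] and the
    bound on an expert's move all have this form. Means of translates do both. Averaging over a
    segment of length delta in direction e_i turns the derivative along e_i into a difference
    quotient, so limits of dyadic means suffice. The coupled walks separate by a displacement of
    order d / sqrt N, which would be too large by itself. Its first-order effect cancels under fair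
    coins; what remains is its square times the Hessian bound Lip(g) / delta. The factor 1 +
    Lip(g)^2 / a^2, with a = theta_g vartheta_q, comes from AM-GM: admissible moves need delta >= 2
    (Lip(g) / a) kappa, and 2 Lip(g) / a <= 1 + Lip(g)^2 / a^2. The competitor of u has an explicit
    second-order expansion, so u is tested directly by quadratic polynomials, without doubling
    variables. Penalties for large x and for the early end of a time strip supply the maximum point.
    Both inequalities come from one argument, applied to u and to -u(-x, t). *)

Lemma le_of_geometric_error (R : realType) (a b C : R) :
  (forall k, a <= b + C / 2 ^+ k) -> a <= b.
Proof.
move=> h; rewrite leNgt; apply/negP => ba.
have hC : 0 < C by have := h 0%N; rewrite expr0 divr1 => ?; lra.
have := h (Num.bound (C / (a - b))); apply/negP; rewrite -ltNge.
rewrite -ltrBrDl ltr_pdivrMr ?exprn_gt0 // mulrC -ltr_pdivrMr ?subr_gt0 //.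
apply: lt_trans (archi_boundP _) _; first by rewrite divr_ge0 ?subr_ge0 ?ltW.
by rewrite -natrX ltr_nat ltn_expl.
Qed.

(** Limits are taken along dyadic scales, so estimates pass to the limit in this form or in that of
    [le_of_geometric_error]. *)
Lemma eq_of_geometric_error (R : realType) (a b C : R) :
  (forall k, `|a - b| <= C / 2 ^+ k) -> a = b.
Proof.
move=> h; apply/eqP; rewrite -subr_eq0 -normr_le0.
by apply: (@le_of_geometric_error _ _ _ C) => k; rewrite add0r.
Qed.

(** * Sup norm, dot product and Euclidean norm *)

Section Norms.
Context (R : realType) (n : nat).
Implicit Types x y : 'rV[R]_n.

Lemma norm_coord x i : `|x 0 i| <= `|x|.
Proof.
by rewrite [leRHS]/Num.norm /= mx_normrE; apply/bigmax_geP; right; exists (0, i).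
Qed.

Lemma norm_le_coord x c : 0 <= c -> (forall i, `|x 0 i| <= c) -> `|x| <= c.
Proof.
move=> c0 h; rewrite [leLHS]/Num.norm /= mx_normrE; apply: bigmax_le => //=.
by move=> [i j] _ /=; rewrite (ord1 i).
Qed.

Lemma norm_delta i : `|delta_mx 0 i : 'rV[R]_n| <= 1.
Proof.
apply: norm_le_coord => // j; rewrite mxE eqxx /=.
by case: (j == i); rewrite /= ?normr1 ?normr0.
Qed.

Lemma norm_sum_le (c : R) (F : 'I_n -> R) :
  (forall i, `|F i| <= c) -> `|\sum_i F i| <= n%:R * c.
Proof.
move=> h; apply: le_trans (ler_norm_sum _ _ _) _.
apply: le_trans (ler_sum _ (fun i _ => h i)) _.
by rewrite sumr_const card_ord mulr_natl.
Qed.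

Lemma dotD x y z : dot (x + y) z = dot x z + dot y z.
Proof.
by rewrite /dot -big_split /=; apply: eq_bigr => i _; rewrite mxE mulrDl.
Qed.

Lemma dotZ a x z : dot (a *: x) z = a * dot x z.
Proof. by rewrite /dot mulr_sumr; apply: eq_bigr => i _; rewrite mxE mulrA. Qed.

Lemma dotC x y : dot x y = dot y x.
Proof. by apply: eq_bigr => i _; rewrite mulrC. Qed.

Lemma dot_le x y : `|dot x y| <= n%:R * (`|x| * `|y|).
Proof.
by apply: norm_sum_le => i; rewrite normrM ler_pM // norm_coord.
Qed.

Lemma norm_ones : `|ones R n| <= 1.
Proof. by apply: norm_le_coord => // i; rewrite mxE normr1. Qed.

Lemma dot_ge0 x : 0 <= dot x x.
Proof. by apply: sumr_ge0 => i _; rewrite -expr2 sqr_ge0. Qed.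

Lemma norm_sqr_le_dot x : `|x| ^+ 2 <= dot x x.
Proof.
rewrite -(sqr_sqrtr (dot_ge0 x)) ler_sqr ?nnegrE ?sqrtr_ge0 //.
apply: norm_le_coord; rewrite ?sqrtr_ge0 // => i.
rewrite -sqrtr_sqr ler_wsqrtr // /dot (bigD1 i) //= -expr2 lerDl.
by apply: sumr_ge0 => j _; rewrite -expr2 sqr_ge0.
Qed.

(** Estimates are made in the sup norm; passing from the Euclidean Lipschitz constant to it costs
    this factor [n], which [C2] absorbs. *)
Lemma enorm_le x : enorm x <= n%:R * `|x|.
Proof.
rewrite -(ger0_norm (mulr_ge0 (ler0n R n) (normr_ge0 x))) -sqrtr_sqr ler_wsqrtr //.
apply: le_trans (ler_norm _) (le_trans (dot_le x x) _).
rewrite -expr2 exprMn ler_wpM2r ?sqr_ge0 // -natrX ler_nat.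
by case: (n) => // k; rewrite leq_pmulr.
Qed.

End Norms.

(** * Smoothing by iterated segment averages *)

Section Smoothing.
Context (R : realType) (n : nat).
Implicit Types (f h : 'rV[R]_n -> R) (w x y : 'rV[R]_n) (L : R).

Definition lipb L f := forall x y, `|f (x + y) - f x| <= L * `|y|.

(* [avg k w f x] is the mean of [f] over the points [x + (j / 2 ^ k) w] with
   [0 <= j < 2 ^ k]. *)
Fixpoint avg (k : nat) w f x : R :=
  if k is k'.+1 then (avg k' w f x + avg k' w f (x + (2 ^+ k)^-1 *: w)) / 2
  else f x.

Lemma avg_shift k w f x y : avg k w (fun z => f (z + y)) x = avg k w f (x + y).
Proof. by elim: k x => //= k ih x; rewrite !ih addrAC. Qed.

Lemma avg_lin k w f h a b x :
  avg k w (fun z => a * f z + b * h z) x = a * avg k w f x + b * avg k w h x.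
Proof. by elim: k x => //= k ih x; rewrite !ih; field. Qed.

Lemma avg_ge k w f c x : (forall z, c <= f z) -> c <= avg k w f x.
Proof.
move=> h; elim: k x => //= k ih x.
by have := ih x; have := ih (x + (2 ^+ k.+1)^-1 *: w); lra.
Qed.

Lemma avgB k w f h x :
  avg k w (fun z => f z - h z) x = avg k w f x - avg k w h x.
Proof.
have := avg_lin k w f h 1 (-1) x; rewrite mul1r mulN1r => <-.
by congr avg; apply/funext => z; rewrite mul1r mulN1r.
Qed.

Lemma avg_bound k w f c x : (forall z, `|f z| <= c) -> `|avg k w f x| <= c.
Proof.
move=> h; rewrite ler_norml; apply/andP; split.
  by apply: avg_ge => z; have := h z; rewrite ler_norml => /andP[].
rewrite -lerN2; have -> : - avg k w f x = avg k w (fun z => - f z) x.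
  by elim: k x => //= k ih x; rewrite -!ih; field.
by apply: avg_ge => z; have := h z; rewrite ler_norml lerN2 => /andP[].
Qed.

Lemma avg_diff_bound k w f h c x :
  (forall z, `|f z - h z| <= c) -> `|avg k w f x - avg k w h x| <= c.
Proof. by move=> H; rewrite -avgB; apply: avg_bound. Qed.

Lemma avg_lipb k w f L : lipb L f -> lipb L (avg k w f).
Proof. by move=> h x y; rewrite -avg_shift; apply: avg_diff_bound => z. Qed.

(** The two averages share all sample points except the first of one and the last of the other. *)
Lemma avg_telescope k w f x :
  avg k w f (x + (2 ^+ k)^-1 *: w) - avg k w f x = (f (x + w) - f x) / 2 ^+ k.
Proof.
elim: k x => [|k ih] x; first by rewrite /= expr0 invr1 scale1r mulr1.
rewrite /= -addrA -scalerDl.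
have -> : (2 ^+ k.+1)^-1 + (2 ^+ k.+1)^-1 = (2 ^+ k)^-1 :> R.
  by rewrite exprS; field; rewrite expf_neq0.
have := ih x; set a := avg _ _ _ _; set b := avg _ _ _ _; set c := avg _ _ _ _.
rewrite exprS invfM mulrA => H.
have -> : (c + a) / 2 - (b + c) / 2 = (a - b) / 2 by field.
by rewrite H; field; rewrite expf_neq0.
Qed.

Lemma avg_comm1 k w f y x :
  avg k w (fun z => (f z + f (z + y)) / 2) x
  = (avg k w f x + avg k w f (x + y)) / 2.
Proof.
rewrite -avg_shift.
have -> : (fun z => (f z + f (z + y)) / 2)
          = (fun z => 2^-1 * f z + 2^-1 * f (z + y)).
  by apply/funext => z; field.
by rewrite avg_lin; field.
Qed.

(** Both sides are means of the same translates of [f]. *)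
Lemma avg_comm k l v w f : avg k v (avg l w f) = avg l w (avg k v f).
Proof.
elim: l => [|l ih] //=; apply/funext => x.
by rewrite (avg_comm1 k v (avg l w f)) ih.
Qed.

(* The limit is the mean of [f] over the segment from [x] to [x + w]. *)
Definition smooth_along w f x : R := lim (avg k w f x @[k --> \oo]).

Lemma avg_step k w f L x : lipb L f ->
  `|avg k.+1 w f x - avg k w f x| <= L * `|w| / 2 ^+ k.+1.
Proof.
move=> h /=; set a := avg _ _ _ _; set b := avg _ _ _ _.
have hb : `|b - a| <= L * `|(2 ^+ k.+1)^-1 *: w| by apply: avg_lipb.
rewrite normrZ ger0_norm ?invr_ge0 ?exprn_ge0 // in hb.
have -> : (a + b) / 2 - a = (b - a) / 2 by field.
rewrite normrM (ger0_norm (_ : 0 <= 2^-1)) ?invr_ge0 //.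
have -> : L * `|w| / 2 ^+ k.+1 = L * ((2 ^+ k.+1)^-1 * `|w|).
  by rewrite -mulrA [`|w| * _]mulrC.
by have := normr_ge0 (b - a); lra.
Qed.

(** Subtracting the error [C / 2 ^ k] makes the sequence nondecreasing and adding it makes it
    nonincreasing. Monotone convergence gives the limit, and the two monotone sequences enclose
    it. *)
Lemma lim_geometric (a : nat -> R) (C : R) :
  (forall k, `|a k.+1 - a k| <= C / 2 ^+ k.+1) ->
  forall k, `|lim (a k @[k --> \oo]) - a k| <= C / 2 ^+ k.
Proof.
move=> h.
have hC : 0 <= C.
  have := le_trans (normr_ge0 _) (h 0%N).
  by rewrite expr1 pmulr_lge0 // invr_gt0.
pose e k : R := C / 2 ^+ k.
have eS k : e k = 2 * e k.+1.
  by rewrite /e exprS invfM; field; rewrite expf_neq0.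
have e0 k : 0 <= e k by rewrite divr_ge0 // exprn_ge0.
pose lo k := a k - e k.
have hS k : - e k.+1 <= a k.+1 - a k <= e k.+1 by rewrite -ler_norml.
have nd : nondecreasing_seq lo.
  apply/nondecreasing_seqP => k; rewrite /lo (eS k).
  by have /andP[] := hS k; lra.
have ni k : a k + e k <= a 0%N + e 0%N.
  elim: k => [|k ih] //; apply: le_trans ih; rewrite (eS k).
  by have /andP[] := hS k; lra.
have ni2 j k : (j <= k)%N -> a k + e k <= a j + e j.
  move=> /subnK <-; elim: (k - j)%N => [|i ih] //.
  apply: le_trans ih; rewrite addSn (eS (i + j)).
  by have /andP[] := hS (i + j)%N; lra.
have clo : cvgn lo.
  apply: nondecreasing_is_cvgn => //; exists (a 0%N + e 0%N) => _ [k _ <-].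
  by have := ni k; have := e0 k; rewrite /lo; lra.
have e_cvg : e k @[k --> \oo] --> (0 : R).
  have -> : 0 = C * 0 :> R by rewrite mulr0.
  apply: cvgM; first exact: cvg_cst.
  rewrite [X in X @ _](_ : _ = (fun k => (2^-1) ^+ k : R)).
    by apply: cvg_expr; rewrite ger0_norm ?invr_ge0 // invf_lt1 // ltr1n.
  by apply/funext => k; rewrite exprVn.
have la : a k @[k --> \oo] --> lim (lo k @[k --> \oo]).
  have -> : a = (fun k => lo k + e k) by apply/funext => k; rewrite /lo subrK.
  by rewrite -[X in _ --> X]addr0; apply: cvgD.
have -> : lim (a k @[k --> \oo]) = lim (lo k @[k --> \oo]).
  exact: cvg_lim la.
move=> k; have h1 := nondecreasing_cvgn_le nd clo k.
have h2 : lim (lo k @[k --> \oo]) <= a k + e k.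
  apply: limr_le => //; near=> j.
  have jk : (k <= j)%N by near: j; exact: nbhs_infty_ge.
  by have := ni2 _ _ jk; have := e0 j; rewrite /lo; lra.
by rewrite ler_norml -/(e k); move: h1 h2; rewrite /lo; lra.
Unshelve. all: by end_near. Qed.

Lemma smooth_close k w f L x : lipb L f ->
  `|smooth_along w f x - avg k w f x| <= L * `|w| / 2 ^+ k.
Proof. by move=> h; apply: lim_geometric => j; apply: avg_step. Qed.

(** A uniform lower bound on the increments by [y] survives averaging of translates and then the
    limit. Every structural property of [g] that the mollified function must keep is passed on this
    way. *)
Lemma smooth_shift_ge w f L y c x : lipb L f ->
  (forall z, c <= f (z + y) - f z) ->
  c <= smooth_along w f (x + y) - smooth_along w f x.
Proof.
move=> hL h; apply: (@le_of_geometric_error _ _ _ (2 * (L * `|w|))) => k.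
have := smooth_close k w x hL; have := smooth_close k w (x + y) hL.
have := avg_ge k w x h; rewrite avgB avg_shift !ler_norml -mulrA.
by move=> ? /andP[? ?] /andP[? ?]; lra.
Qed.

Lemma smooth_lipb w f L : lipb L f -> lipb L (smooth_along w f).
Proof.
move=> h x y; rewrite ler_norml; apply/andP; split.
  by apply: (smooth_shift_ge _ _ h) => z; have := h z y; rewrite ler_norml => /andP[].
rewrite -lerN2 opprB.
have := @smooth_shift_ge w f L (- y) (- (L * `|y|)) (x + y) h; rewrite addrK; apply.
by move=> z; have := h z (- y); rewrite ler_norml normrN => /andP[].
Qed.

Lemma smooth_near w f L x : lipb L f -> `|smooth_along w f x - f x| <= L * `|w|.
Proof. by move=> h; have := smooth_close 0 w x h; rewrite expr0 divr1. Qed.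

Lemma smooth_comm v w f L : lipb L f ->
  smooth_along v (smooth_along w f) = smooth_along w (smooth_along v f).
Proof.
move=> hL; apply/funext => x.
(* Both iterated limits are compared with the finite double average, where the order is irrelevant
   by [avg_comm]. *)
suff H k u u' : `|smooth_along u (smooth_along u' f) x - avg k u (avg k u' f) x|
    <= L * (`|u| + `|u'|) / 2 ^+ k.
  apply: (@eq_of_geometric_error _ _ _ (2 * (L * (`|v| + `|w|)))) => k.
  have := H k v w; have := H k w v; rewrite avg_comm [`|w| + _]addrC.
  rewrite !ler_norml -mulrA => /andP[? ?] /andP[? ?]; apply/andP; split; lra.
have h1 := smooth_close k u x (smooth_lipb u' hL).
have h2 : `|avg k u (smooth_along u' f) x - avg k u (avg k u' f) x|
    <= L * `|u'| / 2 ^+ k.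
  by apply: avg_diff_bound => z; apply: smooth_close.
rewrite mulrDr mulrDl; move: h1 h2; rewrite !ler_norml.
by move=> /andP[? ?] /andP[? ?]; apply/andP; split; lra.
Qed.

(** Stated for a general increment [y] and factor [a], it lets difference quotients pass through
    smoothings in the other directions. *)
Lemma smooth_diff_quotient w y a f L : lipb L f ->
  smooth_along w (fun z => a * (f (z + y) - f z))
  = (fun z => a * (smooth_along w f (z + y) - smooth_along w f z)).
Proof.
move=> hL; apply/funext => x.
have hL' : lipb (`|a| * (2 * L)) (fun z => a * (f (z + y) - f z)).
  move=> u v; rewrite -mulrBr normrM -!mulrA ler_wpM2l //.
  have := hL (u + y) v; have := hL u v; rewrite addrAC !ler_norml.
  by move=> /andP[? ?] /andP[? ?]; apply/andP; split; lra.
apply: (@eq_of_geometric_error _ _ _ (`|a| * (4 * (L * `|w|)))) => k.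
have h0 := smooth_close k w x hL'.
have -> : `|a| * (4 * (L * `|w|)) / 2 ^+ k
   = `|a| * (2 * L) * `|w| / 2 ^+ k + `|a| * (2 * (L * `|w| / 2 ^+ k)) by ring.
set t := _ - _.
have -> : t = (smooth_along w (fun z => a * (f (z + y) - f z)) x
          - avg k w (fun z => a * (f (z + y) - f z)) x)
  + a * (avg k w f (x + y) - smooth_along w f (x + y)
         - (avg k w f x - smooth_along w f x)).
  have -> : avg k w (fun z => a * (f (z + y) - f z)) x
            = a * (avg k w f (x + y) - avg k w f x).
    rewrite -(avg_shift k w f x y) mulrBr -mulNr -avg_lin.
    by congr avg; apply/funext => z; ring.
  by rewrite /t; ring.
apply: le_trans (ler_normD _ _) (lerD h0 _).
rewrite normrM ler_wpM2l //.
have := smooth_close k w x hL; have := smooth_close k w (x + y) hL.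
rewrite !ler_norml => /andP[? ?] /andP[? ?]; apply/andP; split; lra.
Qed.

End Smoothing.

(** * Derivatives of segment averages *)

Section CoordinateSmoothing.
Context (R : realType) (n : nat).
Implicit Types (f h : 'rV[R]_n -> R) (w x y : 'rV[R]_n).
Implicit Types (L s t d e B c : R) (i j : 'I_n).

Lemma avg_telescope_sum k w f x J :
  avg k w f (x + (J%:R / 2 ^+ k) *: w) - avg k w f x =
  \sum_(j < J) (f (x + (j%:R / 2 ^+ k) *: w + w)
                - f (x + (j%:R / 2 ^+ k) *: w)) / 2 ^+ k.
Proof.
elim: J => [|J ih]; first by rewrite big_ord0 mul0r scale0r addr0 subrr.
rewrite big_ord_recr /= -ih -avg_telescope -(addrA x) -scalerDl.
have -> : J.+1%:R / 2 ^+ k = J%:R / 2 ^+ k + (2 ^+ k)^-1 :> R.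
  by rewrite -addn1 natrD mulrDl mul1r.
ring.
Qed.

(** The segment average has derivative [f (x + w) - f x] along [w]. Telescoping over dyadic steps
    replaces integrating this derivative from 0 to [s]. *)
Lemma smooth_slope w f L x s d e : lipb L f -> 0 <= s ->
  (forall t, 0 <= t <= s -> `|f (x + t *: w + w) - f (x + t *: w) - d| <= e) ->
  `|smooth_along w f (x + s *: w) - smooth_along w f x - s * d| <= s * e.
Proof.
move=> hL s0 h.
have e0 : 0 <= e by apply: le_trans (h 0 _); rewrite ?lexx.
(* Three errors of size [L * |w|]: two from [smooth_close] and one from rounding [s] in the average
   ([hb]); [|d|] comes from rounding [s] in [s * d] ([hc]). *)
apply: (@le_of_geometric_error _ _ _ (3 * (L * `|w|) + `|d|)) => k.
have p0 : 0 < 2 ^+ k :> R by rewrite exprn_gt0.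
(* The number of whole dyadic steps in [s]; less than one step is left over. *)
pose J := Num.truncn (s * 2 ^+ k).
have /andP[hJ1 hJ2] : J%:R <= s * 2 ^+ k < J.+1%:R.
  by apply: truncn_itv; rewrite mulr_ge0 // ltW.
have r1 : J%:R / 2 ^+ k <= s by rewrite ler_pdivrMr.
have r2 : s - J%:R / 2 ^+ k <= (2 ^+ k)^-1.
  rewrite lerBlDr -[X in _ <= X + _]mul1r -mulrDl ler_pdivlMr //.
  by rewrite nat1r ltW.
have r0 : 0 <= J%:R / 2 ^+ k :> R by rewrite divr_ge0 // ltW.
set r := J%:R / 2 ^+ k in r0 r1 r2.
have ha : `|avg k w f (x + r *: w) - avg k w f x - r * d| <= s * e.
  rewrite avg_telescope_sum.
  have -> : r * d = \sum_(j < J) d / 2 ^+ k.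
    by rewrite sumr_const card_ord -[RHS]mulr_natl /r; ring.
  rewrite -sumrB; apply: le_trans (ler_norm_sum _ _ _) _.
  apply: (@le_trans _ _ (\sum_(j < J) e / 2 ^+ k)).
    apply: ler_sum => j _; rewrite -mulrBl normrM (ger0_norm (x := _^-1)) ?invr_ge0 ?(ltW p0) //.
    rewrite ler_wpM2r ?invr_ge0 ?(ltW p0) // h // divr_ge0 ?(ltW p0) //=.
    apply: le_trans r1; rewrite /r ler_wpM2r ?invr_ge0 ?(ltW p0) //.
    by rewrite ltW // ltr_nat.
  rewrite sumr_const card_ord -[leLHS]mulr_natl.
  have -> : J%:R * (e / 2 ^+ k) = r * e by rewrite /r; ring.
  by rewrite ler_wpM2r.
have hb : `|avg k w f (x + s *: w) - avg k w f (x + r *: w)| <= L * `|w| / 2 ^+ k.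
  have -> : x + s *: w = x + r *: w + (s - r) *: w.
    by rewrite -addrA -scalerDl [r + _]addrC subrK.
  apply: le_trans (avg_lipb k w hL _ _) _.
  rewrite normrZ (ger0_norm (x := s - r)) ?subr_ge0 //.
  have := le_trans (normr_ge0 _) (hL x w) => Lw.
  by rewrite mulrCA [X in _ <= X]mulrC ler_wpM2r.
have hc : `|(s - r) * d| <= `|d| / 2 ^+ k.
  rewrite normrM (ger0_norm (x := s - r)) ?subr_ge0 // mulrC.
  by rewrite ler_wpM2l.
have h1 := smooth_close k w x hL; have h2 := smooth_close k w (x + s *: w) hL.
have -> : (3 * (L * `|w|) + `|d|) / 2 ^+ k
          = 3 * (L * `|w| / 2 ^+ k) + `|d| / 2 ^+ k by ring.
move: ha hb hc h1 h2; rewrite !ler_norml mulrBl.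
move=> /andP[? ?] /andP[? ?] /andP[? ?] /andP[? ?] /andP[? ?].
by apply/andP; split; lra.
Qed.

Lemma smooth_slope_signed w f L x s d e : lipb L f ->
  (forall t, `|t| <= `|s| -> `|f (x + t *: w + w) - f (x + t *: w) - d| <= e) ->
  `|smooth_along w f (x + s *: w) - smooth_along w f x - s * d| <= `|s| * e.
Proof.
move=> hL h; case: (leP 0 s) => s0.
  rewrite (ger0_norm s0); apply: smooth_slope hL s0 _ => t /andP[t0 ts].
  by apply: h; rewrite !ger0_norm // (le_trans t0).
have := @smooth_slope w f L (x + s *: w) (- s) d e hL.
rewrite -(addrA x (s *: w) (- s *: w)) -scalerDl subrr scale0r addr0 (ltr0_norm s0).
set a := smooth_along _ _ _; set b := smooth_along _ _ _ => H.
have -> : b - a - s * d = - (a - b - - s * d) by ring.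
rewrite normrN; apply: H; first by rewrite oppr_ge0 ltW.
move=> t /andP[t0 ts]; rewrite -(addrA x) -scalerDl; apply: h.
rewrite ler_norml (ltr0_norm s0); apply/andP; split; lra.
Qed.

Context (delta : R) (delta_gt0 : 0 < delta).

Definition unit_vec i : 'rV[R]_n := delta_mx 0 i.

Definition diff_quot i f x := delta^-1 * (f (x + delta *: unit_vec i) - f x).

Definition smooth_coord i := smooth_along (delta *: unit_vec i).

Lemma norm_unit_vec s i : `|s *: unit_vec i| <= `|s|.
Proof. by rewrite normrZ ler_piMr ?norm_delta. Qed.

Lemma lipb_ge0 L f (i : 'I_n) : lipb L f -> 0 <= L.
Proof.
move=> /(_ 0 (unit_vec i)) h; have := le_trans (normr_ge0 _) h.
rewrite pmulr_lge0 // normr_gt0; apply/eqP => /matrixP /(_ 0 i).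
by rewrite !mxE !eqxx; apply/eqP; rewrite oner_eq0.
Qed.

Lemma lipb_unit L f s i x : lipb L f -> `|f (x + s *: unit_vec i) - f x| <= L * `|s|.
Proof.
move=> h; apply: le_trans (h _ _) _.
by rewrite ler_wpM2l ?norm_unit_vec // (lipb_ge0 i h).
Qed.

Lemma diff_quot_bound i f L x : lipb L f -> `|diff_quot i f x| <= L.
Proof.
move=> h; rewrite normrM normfV (gtr0_norm delta_gt0) mulrC ler_pdivrMr //.
by have := lipb_unit delta i x h; rewrite (gtr0_norm delta_gt0).
Qed.

Lemma diff_quot_bound2 i f B x : (forall z, `|f z| <= B) ->
  `|diff_quot i f x| <= 2 * B / delta.
Proof.
move=> h; rewrite normrM normfV (gtr0_norm delta_gt0) mulrC.
rewrite ler_wpM2r ?invr_ge0 1?(ltW delta_gt0) //; apply: le_trans (ler_normB _ _) _.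
by have := h (x + delta *: unit_vec i); have := h x; lra.
Qed.

Lemma diff_quot_lipb i f L : lipb L f -> lipb (2 * L / delta) (diff_quot i f).
Proof.
move=> h x y; rewrite /diff_quot -mulrBr normrM normfV (gtr0_norm delta_gt0).
have -> : 2 * L / delta * `|y| = delta^-1 * (2 * L * `|y|) by ring.
rewrite ler_wpM2l ?invr_ge0 1?(ltW delta_gt0) // -mulrA.
have := h x y; have := h (x + delta *: unit_vec i) y; rewrite addrAC !ler_norml.
by move=> /andP[? ?] /andP[? ?]; apply/andP; split; lra.
Qed.

Lemma smooth_coord_lipb i f L : lipb L f -> lipb L (smooth_coord i f).
Proof. exact: smooth_lipb. Qed.

Lemma smooth_coord_diff_quot i j f L : lipb L f ->
  smooth_coord i (diff_quot j f) = diff_quot j (smooth_coord i f).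
Proof. exact: smooth_diff_quotient. Qed.

Lemma scale_unit_vec s i : s *: unit_vec i = (s / delta) *: (delta *: unit_vec i).
Proof. by rewrite scalerA divfK // gt_eqF. Qed.

(** The slope of the average along [e_i] is exactly [diff_quot i f], which changes by at most
    [2 L |s| / delta] over a displacement [s]. *)
Lemma smooth_coord_derivative i f L x s : lipb L f ->
  `|smooth_coord i f (x + s *: unit_vec i) - smooth_coord i f x
    - s * diff_quot i f x| <= 2 * L / delta * s ^+ 2.
Proof.
move=> h; rewrite [s *: _]scale_unit_vec.
have := @smooth_slope_signed (delta *: unit_vec i) f L x (s / delta)
  (delta * diff_quot i f x) (2 * L * `|s|) h.
have -> : s / delta * (delta * diff_quot i f x) = s * diff_quot i f x.
  by field; rewrite gt_eqF.
have -> : `|s / delta| * (2 * L * `|s|) = 2 * L / delta * s ^+ 2.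
  rewrite normrM normfV (gtr0_norm delta_gt0) -(real_normK (num_real s)); ring.
apply=> t; rewrite normrM normfV (gtr0_norm delta_gt0) => ts.
rewrite /diff_quot mulrA divff ?gt_eqF // mul1r scalerA.
have tds : `|t * delta| <= `|s|.
  by rewrite normrM (gtr0_norm delta_gt0) -ler_pdivlMr.
have h1 := lipb_unit (t * delta) i (x + delta *: unit_vec i) h.
have h2 := lipb_unit (t * delta) i x h.
have h3 : L * `|t * delta| <= L * `|s| by rewrite ler_wpM2l ?(lipb_ge0 i h).
rewrite addrAC in h1; move: h1 h2; rewrite !ler_norml -mulrA.
by move=> /andP[? ?] /andP[? ?]; apply/andP; split; lra.
Qed.

Lemma smooth_coord_slope i f L B x s : lipb L f ->
  (forall z, `|diff_quot i f z| <= B) ->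
  `|smooth_coord i f (x + s *: unit_vec i) - smooth_coord i f x| <= B * `|s|.
Proof.
move=> h hB; rewrite [s *: _]scale_unit_vec.
have := @smooth_slope_signed (delta *: unit_vec i) f L x (s / delta)
  0 (delta * B) h.
rewrite mulr0 subr0 normrM normfV (gtr0_norm delta_gt0).
have -> : `|s| / delta * (delta * B) = B * `|s| by field; rewrite gt_eqF.
apply=> t _; rewrite subr0; have := hB (x + t *: (delta *: unit_vec i)).
by rewrite normrM normfV (gtr0_norm delta_gt0) mulrC ler_pdivrMr // mulrC.
Qed.

End CoordinateSmoothing.

Section CoordinatePath.
Context (R : realType) (n : nat).
Implicit Types (f : 'rV[R]_n -> R) (x y : 'rV[R]_n) (M : R).

(** The points [x + head_part y k] form a path from [x] to [x + y] that changes one coordinate at a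
    time. *)
Definition head_part y k : 'rV[R]_n := \row_j (if (j < k)%N then y 0 j else 0).

Lemma head_part0 y : head_part y 0 = 0.
Proof. by apply/rowP => j; rewrite !mxE. Qed.

Lemma head_part_all y : head_part y n = y.
Proof. by apply/rowP => j; rewrite !mxE ltn_ord. Qed.

Lemma head_partS y (k : 'I_n) :
  head_part y k.+1 = head_part y k + y 0 k *: unit_vec R k.
Proof.
apply/rowP => j; rewrite !mxE eqxx /= ltnS leq_eqVlt.
case: (eqVneq j k) => [->|jk]; first by rewrite eqxx ltnn add0r mulr1.
have -> : (nat_of_ord j == k) = false by apply/negbTE.
by rewrite /= mulr0 addr0.
Qed.

Lemma norm_head_part y k : `|head_part y k| <= `|y|.
Proof.
apply: norm_le_coord => // j; rewrite mxE.
by case: ifP => _; rewrite ?normr0 ?norm_coord.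
Qed.

Lemma head_part_telescope f x y :
  f (x + y) - f x =
  \sum_(k < n) (f (x + head_part y k + y 0 k *: unit_vec R k) - f (x + head_part y k)).
Proof.
rewrite -[in LHS](head_part_all y) -[X in _ - f X]addr0 -[X in _ - f (_ + X)](head_part0 y).
rewrite -(@telescope_sumr _ 0 n (fun k => f (x + head_part y k))) // big_mkord.
by apply: eq_bigr => k _; rewrite head_partS addrA.
Qed.

Lemma lipb_of_coords f M :
  (forall x k (s : R), `|f (x + s *: unit_vec R k) - f x| <= M * `|s|) ->
  lipb (n%:R * M) f.
Proof.
move=> h x y; rewrite head_part_telescope -mulrA; apply: norm_sum_le => k.
apply: le_trans (h _ _ _) _; rewrite ler_wpM2l ?norm_coord //.
by have := le_trans (normr_ge0 _) (h x k 1); rewrite normr1 mulr1.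
Qed.

(* Quantitative C^{1,1}: the [Df k] are the partial derivatives of [f]. *)
Definition c11 M f (Df : 'I_n -> 'rV[R]_n -> R) :=
  (forall x y, `|f (x + y) - f x - \sum_k y 0 k * Df k x| <= M * `|y| ^+ 2)
  /\ forall k, lipb M (Df k).

(** Along the coordinate path, each step is expanded at an intermediate point. Moving its partial
    derivative back to [x] costs another [M' |y|^2], hence the factor 2. *)
Lemma c11_of_coords f Df M M' : 0 < n%:R :> R -> M <= M' ->
  (forall x k (s : R), `|f (x + s *: unit_vec R k) - f x - s * Df k x| <= M * s ^+ 2) ->
  (forall k, lipb M' (Df k)) -> c11 (2 * n%:R * M') f Df.
Proof.
move=> n0 MM h hD; split=> [x y|k x y]; last first.
  apply: le_trans (hD _ _ _) _; rewrite ler_wpM2r //.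
  rewrite ler_peMl ?(lipb_ge0 k (hD k)) //.
  have : (1 <= n)%N by move: n0; rewrite ltr0n.
  by rewrite -(ler_nat R); lra.
rewrite head_part_telescope -sumrB.
have -> : 2 * n%:R * M' * `|y| ^+ 2 = n%:R * (2 * M' * `|y| ^+ 2) by ring.
apply: norm_sum_le => k.
have h1 := h (x + head_part y k) k (y 0 k).
have M0 := lipb_ge0 k (hD k).
have h2 : `|y 0 k * (Df k (x + head_part y k) - Df k x)| <= M' * `|y| ^+ 2.
  rewrite normrM expr2 mulrCA ler_pM ?norm_coord //.
  by apply: le_trans (hD _ _ _) _; rewrite ler_wpM2l ?norm_head_part.
have h3 : M * y 0 k ^+ 2 <= M' * `|y| ^+ 2.
  apply: (@le_trans _ _ (M' * y 0 k ^+ 2)); first by rewrite ler_wpM2r ?sqr_ge0.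
  rewrite ler_wpM2l // -(real_normK (num_real (y 0 k))).
  by rewrite ler_sqr ?nnegrE ?norm_coord.
move: h1 h2; rewrite !ler_norml mulrBr -mulrA => /andP[? ?] /andP[? ?].
by apply/andP; split; lra.
Qed.

End CoordinatePath.

Section Mollify.
Context (R : realType) (n : nat) (delta : R).
Hypothesis delta_gt0 : 0 < delta.
Implicit Types (f : 'rV[R]_n -> R) (s : seq 'I_n) (x y : 'rV[R]_n) (L c : R).
Local Notation sm := (@smooth_coord R n delta).
Local Notation dq := (@diff_quot R n delta).

Definition smooth_coords s f := foldr sm f s.

Lemma smooth_coords_lipb s f L : lipb L f -> lipb L (smooth_coords s f).
Proof. by move=> h; elim: s => //= i s ih; apply: smooth_coord_lipb. Qed.

(** Smoothings commute, so the one in a chosen direction can be made outermost, where its derivative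
    is a difference quotient. *)
Lemma smooth_coords_rem i s f L : lipb L f -> i \in s ->
  smooth_coords s f = sm i (smooth_coords (rem i s) f).
Proof.
move=> h; elim: s => //= j s ih; rewrite inE eq_sym.
case: (eqVneq j i) => [->|ji] //= /ih ->.
exact: (smooth_comm _ _ (smooth_coords_lipb (rem i s) h)).
Qed.

Lemma smooth_coords_near s f L x : lipb L f ->
  `|smooth_coords s f x - f x| <= (size s)%:R * (L * delta).
Proof.
move=> h; elim: s => /= [|i s ih]; first by rewrite subrr normr0 mul0r.
have h1 := smooth_near (delta *: unit_vec R i) x (smooth_coords_lipb s h).
have h2 : L * `|delta *: unit_vec R i| <= L * delta.
  rewrite ler_wpM2l ?(lipb_ge0 i h) //.
  by apply: le_trans (norm_unit_vec _ _) _; rewrite gtr0_norm.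
rewrite -natr1 mulrDl mul1r [leRHS]addrC.
rewrite -(subrK (smooth_coords s f x) (sm i _ x)) -[X in `|X|]addrA.
apply: le_trans (ler_normD _ _) (lerD _ ih).
exact: le_trans h1 h2.
Qed.

Lemma smooth_coords_shift_ge s f L y c x : lipb L f ->
  (forall z, c <= f (z + y) - f z) ->
  c <= smooth_coords s f (x + y) - smooth_coords s f x.
Proof.
move=> h hc; elim: s x => //= i s ih x.
exact: smooth_shift_ge _ _ (smooth_coords_lipb s h) ih.
Qed.

(** Differentiating along [e_i] consumes one smoothing in that direction and replaces it by a
    difference quotient, at the price of a factor of order 1 / delta in the next bound. So [p i] and
    [X i j] are difference quotients of [f] with one and two smoothings removed. *)
Lemma mollification f L : (0 < n)%N -> lipb L f ->
  exists G p X, [/\ forall x, `|G x - f x| <= 3 * n%:R * (L * delta),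
    forall y c, (forall z, c <= f (z + y) - f z) -> forall z, c <= G (z + y) - G z,
    c11 (8 * n%:R * L / delta) G p &
    forall i, c11 (16 * n%:R ^+ 2 * L / delta ^+ 2) (p i) (X i)].
Proof.
move=> n0 h.
have n0R : 0 < n%:R :> R by rewrite ltr0n.
have n1R : 1 <= n%:R :> R by rewrite ler1n.
(* Three smoothings per coordinate: after two derivatives, even both along the same coordinate, one
   is still available in every direction. *)
pose s0 : seq 'I_n := flatten (nseq 3 (enum 'I_n)).
have cnt0 i : count_mem i s0 = 3%N.
  by rewrite /s0 /= !count_cat /= !count_uniq_mem ?enum_uniq // mem_enum.
have cnt1 i k : (2 <= count_mem k (rem i s0))%N.
  by rewrite count_rem cnt0; case: (_ && _).
have cnt2 i j k : (1 <= count_mem k (rem j (rem i s0)))%N.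
  by rewrite count_rem; have := cnt1 i k; case: (_ && _) => //=; case: count => [|[]].
have mem0 i : i \in s0 by rewrite -has_pred1 has_count cnt0.
have mem1 i j : j \in rem i s0.
  by rewrite -has_pred1 has_count; apply: leq_trans (cnt1 i j).
have mem2 i j k : k \in rem j (rem i s0).
  by rewrite -has_pred1 has_count.
have hl s : lipb L (smooth_coords s f) by apply: smooth_coords_lipb.
have L0 : 0 <= L := lipb_ge0 (Ordinal n0) h.
exists (smooth_coords s0 f), (fun i => dq i (smooth_coords (rem i s0) f)),
  (fun i j => dq j (dq i (smooth_coords (rem j (rem i s0)) f))); split.
- move=> x; apply: le_trans (smooth_coords_near _ _ h) _.
  by rewrite size_flatten /shape /= !size_enum_ord addn0 !natrD; lra.
- by move=> y c hc z; apply: smooth_coords_shift_ge h hc.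
- have -> : 8 * n%:R * L / delta = 2 * n%:R * (4 * L / delta) by field; rewrite gt_eqF.
  apply: (@c11_of_coords _ _ _ _ (2 * L / delta)) => //.
  + by rewrite ler_wpM2r ?invr_ge0 1?(ltW delta_gt0) //; lra.
  + move=> x k s; rewrite (smooth_coords_rem h (mem0 k)).
    exact: (smooth_coord_derivative delta_gt0 k x s (hl (rem k s0))).
  + move=> k x y; apply: le_trans (diff_quot_lipb delta_gt0 k (hl _) x y) _.
    by rewrite !ler_wpM2r ?invr_ge0 1?(ltW delta_gt0) //; lra.
- move=> i.
  have -> : 16 * n%:R ^+ 2 * L / delta ^+ 2
            = 2 * n%:R * (n%:R * (8 * L / delta ^+ 2)) by field; rewrite gt_eqF.
  have M0 : 0 <= L / delta ^+ 2 by rewrite divr_ge0 // exprn_ge0 // ltW.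
  apply: (@c11_of_coords _ _ _ _ (4 * L / delta ^+ 2)) => //.
  + rewrite -!mulrA; apply: (@le_trans _ _ (8 * (L / delta ^+ 2))); first by lra.
    by rewrite ler_peMl // mulr_ge0.
  + move=> x k s; rewrite (smooth_coords_rem h (mem1 i k)).
    rewrite -(smooth_coord_diff_quot delta k i (hl _)).
    have -> : 4 * L / delta ^+ 2 = 2 * (2 * L / delta) / delta.
      by field; rewrite gt_eqF.
    exact: smooth_coord_derivative (diff_quot_lipb delta_gt0 i (hl _)).
  (* The remaining smoothing in direction [l] turns a bound on third difference quotients into a
     Lipschitz bound for the second derivatives. *)
  + move=> k; have : lipb (n%:R * (4 * L / delta ^+ 2))
        (dq k (dq i (smooth_coords (rem k (rem i s0)) f))).
      apply: lipb_of_coords => x l s.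
      rewrite (smooth_coords_rem h (mem2 i k l)).
      rewrite -(smooth_coord_diff_quot delta l i (hl _)).
      rewrite -(smooth_coord_diff_quot delta l k (diff_quot_lipb delta_gt0 i (hl _))).
      apply: smooth_coord_slope (diff_quot_lipb delta_gt0 k (diff_quot_lipb delta_gt0 i (hl _))) _ => //.
      move=> z.
      have -> : 4 * L / delta ^+ 2 = 2 * (2 * L / delta) / delta.
        by field; rewrite gt_eqF.
      do 2 apply: diff_quot_bound2 => // ?.
      exact: diff_quot_bound.
    move=> H x y; apply: le_trans (H x y) _.
    rewrite ler_wpM2r // ler_wpM2l ?(ltW n0R) // -!mulrA; lra.
Qed.

End Mollify.

(** * The walk of the unconstrained game *)

Section SecondOrder.
Context (R : realType) (n : nat).
Implicit Types (f : 'rV[R]_n -> R) (x y : 'rV[R]_n) (M K c s r : R).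

(** Each halving of the interval keeps the linear term and halves the total quadratic one, which
    vanishes in the limit. This takes the place of the mean value theorem. *)
Lemma increment_le_of_halving (h : R -> R) c K :
  (forall s r, 0 <= s -> 0 <= r -> s + r <= 1 ->
     `|h (s + r) - h s| <= c * r + K * r ^+ 2) -> `|h 1 - h 0| <= c.
Proof.
move=> H.
have H' k : forall s r, 0 <= s -> 0 <= r -> s + r <= 1 ->
    `|h (s + r) - h s| <= c * r + K * r ^+ 2 / 2 ^+ k.
  elim: k => [|k ih] s r s0 r0 sr; first by rewrite expr0 divr1; apply: H.
  have := ih s (r / 2) s0; have := ih (s + r / 2) (r / 2).
  have -> : s + r / 2 + r / 2 = s + r by field.
  have -> : K * r ^+ 2 / 2 ^+ k.+1 = 2 * (K * (r / 2) ^+ 2 / 2 ^+ k).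
    by rewrite [2 ^+ k.+1]exprS; field; rewrite expf_neq0.
  have a1 : 0 <= s + r / 2 by lra.
  have a2 : 0 <= r / 2 by lra.
  have a3 : s + r / 2 <= 1 by lra.
  move=> /(_ a1 a2 sr); move=> h1 /(_ a2 a3); move: h1.
  rewrite !ler_norml => /andP[? ?] /andP[? ?]; apply/andP; split; lra.
apply: (@le_of_geometric_error _ _ _ K) => k.
have := H' k 0 1; rewrite add0r mulr1 expr1n mulr1; apply => //; lra.
Qed.

Definition quad (Y : 'I_n -> 'I_n -> R) y : R :=
  \sum_i \sum_j y 0 i * y 0 j * Y i j.

Lemma quadZ (Y : 'I_n -> 'I_n -> R) s y : quad Y (s *: y) = s ^+ 2 * quad Y y.
Proof.
rewrite /quad mulr_sumr; apply: eq_bigr => i _.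
by rewrite mulr_sumr; apply: eq_bigr => j _; rewrite !mxE; ring.
Qed.

Lemma quad_lin (Y Z : 'I_n -> 'I_n -> R) a b y :
  quad (fun i j => a * Y i j + b * Z i j) y = a * quad Y y + b * quad Z y.
Proof.
rewrite /quad !mulr_sumr -big_split /=; apply: eq_bigr => i _.
rewrite !mulr_sumr -big_split /=; apply: eq_bigr => j _; ring.
Qed.

Lemma quad_bound (Y : 'I_n -> 'I_n -> R) c y : (forall i j, `|Y i j| <= c) ->
  `|quad Y y| <= n%:R ^+ 2 * (`|y| ^+ 2 * c).
Proof.
move=> h; rewrite expr2 -mulrA; apply: norm_sum_le => i; apply: norm_sum_le => j.
by rewrite !normrM ler_pM ?mulr_ge0 // expr2 ler_pM ?norm_coord.
Qed.

Definition taylor2 T f (p : 'I_n -> 'rV[R]_n -> R)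
    (X : 'I_n -> 'I_n -> 'rV[R]_n -> R) :=
  forall x y, `|f (x + y) - f x - \sum_i y 0 i * p i x
                - quad (fun i j => X i j x) y / 2| <= T * `|y| ^+ 3.

(** Along the segment, [f] minus its second-order polynomial has derivative at most [n M |y|^3], by
    the expansion of [p]. The constant [K] enters only the quadratic term that halving removes. *)
Lemma taylor2_of_c11 K M f p X : c11 K f p -> (forall i, c11 M (p i) (X i)) ->
  taylor2 (n%:R * M) f p X.
Proof.
move=> [hf _] hp x y.
set P := \sum_i _; set Q := quad _ _.
pose h s := f (x + s *: y) - s * P - s ^+ 2 * (Q / 2).
have -> : f (x + y) - f x - P - Q / 2 = h 1 - h 0.
  rewrite /h scale1r scale0r addr0; ring.
apply: (@increment_le_of_halving h _ (K * `|y| ^+ 2 + `|Q|)) => s r s0 r0 sr.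
have h1 := hf (x + s *: y) (r *: y).
have h2 : `|\sum_i y 0 i * p i (x + s *: y) - P - s * Q| <= n%:R * M * `|y| ^+ 3.
  have -> : \sum_i y 0 i * p i (x + s *: y) - P - s * Q
     = \sum_i y 0 i * (p i (x + s *: y) - p i x - \sum_j (s *: y) 0 j * X i j x).
    rewrite /P /Q /quad mulr_sumr -sumrB -sumrB; apply: eq_bigr => i _.
    rewrite !mulrBr; congr (_ - _).
    rewrite !mulr_sumr; apply: eq_bigr => j _; rewrite mxE; ring.
  rewrite -mulrA; apply: norm_sum_le => i; rewrite normrM.
  have -> : M * `|y| ^+ 3 = `|y| * (M * `|y| ^+ 2) by ring.
  rewrite ler_pM ?norm_coord //; apply: le_trans ((hp i).1 _ _) _.
  have M0 := lipb_ge0 i ((hp i).2 i).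
  rewrite ler_wpM2l // normrZ ger0_norm // exprMn ler_piMl ?sqr_ge0 //.
  by rewrite expr_le1 //; lra.
have e1 : \sum_i (r *: y) 0 i * p i (x + s *: y) = r * \sum_i y 0 i * p i (x + s *: y).
  by rewrite mulr_sumr; apply: eq_bigr => i _; rewrite mxE mulrA.
rewrite e1 normrZ (ger0_norm r0) -[x + _ + _]addrA -scalerDl in h1.
set A := \sum_i y 0 i * p i (x + s *: y) in h1 h2.
have h3 : `|r * (A - P - s * Q)| <= r * (n%:R * M * `|y| ^+ 3).
  by rewrite normrM ger0_norm // ler_wpM2l.
have h4 : `|r ^+ 2 * (Q / 2)| <= r ^+ 2 * `|Q|.
  rewrite normrM ger0_norm ?sqr_ge0 // ler_wpM2l ?sqr_ge0 //.
  by rewrite normrM (ger0_norm (x := 2^-1)) ?invr_ge0 //; have := normr_ge0 Q; lra.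
have -> : h (s + r) - h s = (f (x + (s + r) *: y) - f (x + s *: y) - r * A)
   + r * (A - P - s * Q) - r ^+ 2 * (Q / 2) by rewrite /h /=; field.
rewrite [(r * `|y|) ^+ 2]exprMn in h1.
move: h1 h3 h4; rewrite !ler_norml => /andP[? ?] /andP[? ?] /andP[? ?].
apply/andP; split; lra.
Qed.

(** Expansions determine their coefficients at small scales, so an exact translation rule for [f]
    passes to them: order [t] gives the gradient and order [t ^ 2] the form. With [v = ones], the
    Hessian form cannot distinguish [xi] from [q]. *)
Lemma taylor2_invariance T f p X x v c :
  taylor2 T f p X -> (forall z s, f (z + s *: v) = f z + s * c) ->
  \sum_i v 0 i * p i x = c /\
  forall y s, quad (fun i j => X i j x) (y + s *: v) = quad (fun i j => X i j x) y.
Proof.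
move=> hT hf; set Y := fun i j => X i j x.
have lin s y : \sum_i (s *: y) 0 i * p i x = s * \sum_i y 0 i * p i x.
  by rewrite mulr_sumr; apply: eq_bigr => i _; rewrite mxE mulrA.
have linD y z : \sum_i (y + z) 0 i * p i x
    = \sum_i y 0 i * p i x + \sum_i z 0 i * p i x.
  by rewrite -big_split; apply: eq_bigr => i _; rewrite mxE mulrDl.
have hT' s y : 0 < s ->
    `|f (x + s *: y) - f x - s * (\sum_i y 0 i * p i x) - s ^+ 2 * (quad Y y / 2)|
    <= s ^+ 2 * (s * (T * `|y| ^+ 3)).
  move=> s0; have := hT x (s *: y); rewrite lin quadZ normrZ (gtr0_norm s0).
  have -> : T * (s * `|y|) ^+ 3 = s ^+ 2 * (s * (T * `|y| ^+ 3)) by ring.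
  by rewrite -[s ^+ 2 * _ / 2]mulrA.
have e0 k : 0 < (2 ^+ k)^-1 :> R by rewrite invr_gt0 exprn_gt0.
set P := \sum_i v 0 i * p i x.
have hP : P = c.
  apply: (@eq_of_geometric_error _ _ _ (`|quad Y v / 2| + `|T * `|v| ^+ 3|)) => k.
  have e1 : (2 ^+ k)^-1 <= 1 :> R.
    by rewrite invf_le1 ?exprn_gt0 // exprn_ege1 // ler1n.
  have := hT' _ v (e0 k); rewrite hf -/P; set s := (2 ^+ k)^-1 in e1 *.
  have s0 : 0 < s := e0 k.
  have -> : f x + s * c - f x - s * P - s ^+ 2 * (quad Y v / 2)
    = s * (c - P - s * (quad Y v / 2)) by ring.
  rewrite normrM (gtr0_norm s0) expr2 -mulrA (ler_pM2l s0).
  have h1 : s * (s * (T * `|v| ^+ 3)) <= s * `|T * `|v| ^+ 3|.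
    rewrite ler_wpM2l ?(ltW s0) //; apply: le_trans (ler_norm _) _.
    by rewrite normrM (gtr0_norm s0) ler_piMl.
  have h2 : `|s * (quad Y v / 2)| <= s * `|quad Y v / 2|.
    by rewrite normrM (gtr0_norm s0).
  move: h1 h2; rewrite [(_ + _) * s]mulrC mulrDr.
  set a := s * _; set b := _ * `|_|; set b' := s * `|_|.
  rewrite !ler_norml => ? /andP[? ?] /andP[? ?]; apply/andP; split; lra.
split=> // y s.
apply: (@eq_of_geometric_error _ _ _ (2 * (T * `|y + s *: v| ^+ 3 + T * `|y| ^+ 3))) => k.
have h1 := hT' _ (y + s *: v) (e0 k); have h2 := hT' _ y (e0 k).
move: h1 h2; set t := (2 ^+ k)^-1; have t0 : 0 < t := e0 k.
have -> : x + t *: (y + s *: v) = x + t *: y + (t * s) *: v.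
  by rewrite scalerDr scalerA addrA.
rewrite hf linD lin -/P hP; set A := \sum_i y 0 i * p i x.
set Q1 := quad Y (y + _); set Q2 := quad Y y; set B1 := T * _; set B2 := T * _.
have -> : f (x + t *: y) + t * s * c - f x - t * (A + s * c) - t ^+ 2 * (Q1 / 2)
  = (f (x + t *: y) - f x - t * A) - t ^+ 2 * (Q1 / 2) by ring.
set D := f _ - f x - _ => h1 h2.
have : t ^+ 2 * `|Q1 - Q2| <= t ^+ 2 * (2 * (B1 + B2) * t).
  rewrite -(ger0_norm (sqr_ge0 t)) -normrM (ger0_norm (sqr_ge0 t)) mulrBr.
  move: h1 h2; rewrite !ler_norml => /andP[? ?] /andP[? ?]; apply/andP; split; lra.
by rewrite ler_pM2l // exprn_gt0.
Qed.

End SecondOrder.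

Section Walk.
Context (R : realType) (n d : nat) (q : history d -> 'rV[R]_n) (eps : R).
Hypotheses (n_gt0 : (0 < n)%N) (d_gt0 : (0 < d)%N) (eps_ge0 : 0 <= eps).
Hypothesis q_le1 : forall m, `|q m| <= 1.
Implicit Types (f h : 'rV[R]_n -> R) (x y : 'rV[R]_n) (m : history d) (M c T : R).

Definition walk_step m (b : bool) : 'rV[R]_n := (pm1 R b * eps) *: q m.

(* The value of the game without the constraint [|f| <= 1]. *)
Fixpoint walk f (j : nat) x m : R :=
  if j is j'.+1 then
    (walk f j' (x + walk_step m true) (append m true)
     + walk f j' (x + walk_step m false) (append m false)) / 2
  else f x.

Lemma walk_cst c j x m : walk (fun=> c) j x m = c.
Proof. by elim: j x m => //= j ih x m; rewrite !ih; field. Qed.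

Lemma walkD f h j x m :
  walk (fun z => f z + h z) j x m = walk f j x m + walk h j x m.
Proof. by elim: j x m => //= j ih x m; rewrite !ih; field. Qed.

Lemma walkZ f (a : R) j x m : walk (fun z => a * f z) j x m = a * walk f j x m.
Proof. by elim: j x m => //= j ih x m; rewrite !ih; field. Qed.

Lemma walkN f j x m : walk (fun z => - f z) j x m = - walk f j x m.
Proof. by elim: j x m => //= j ih x m; rewrite !ih; field. Qed.

Lemma walk_sum (I : finType) (F : I -> 'rV[R]_n -> R) j x m :
  walk (fun z => \sum_i F i z) j x m = \sum_i walk (F i) j x m.
Proof.
elim: j x m => //= j ih x m; rewrite !ih -big_split /= mulr_suml.
by apply: eq_bigr.
Qed.

Lemma walk_shift f y j x m : walk (fun z => f (z + y)) j x m = walk f j (x + y) m.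
Proof.
elim: j x m => //= j ih x m.
by rewrite !ih [x + walk_step m true + y]addrAC [x + walk_step m false + y]addrAC.
Qed.

Lemma walk_ge f c j x m : (forall z, c <= f z) -> c <= walk f j x m.
Proof.
move=> H; elim: j x m => //= j ih x m.
have := ih (x + walk_step m true) (append m true).
by have := ih (x + walk_step m false) (append m false); lra.
Qed.

Lemma walk_bound f c j x m : (forall z, `|f z| <= c) -> `|walk f j x m| <= c.
Proof.
move=> H; rewrite ler_norml -[X in _ && X]lerN2 -walkN.
by apply/andP; split; apply: walk_ge => z; have := H z; rewrite ler_norml ?lerN2 => /andP[].
Qed.

Lemma walk_shift_ge f y c j x m : (forall z, c <= f (z + y) - f z) ->
  c <= walk f j (x + y) m - walk f j x m.
Proof. by move=> H; rewrite -walk_shift -walkN -walkD; apply: walk_ge. Qed.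

Lemma walk_lipb f M j m : lipb M f -> lipb M (walk f j ^~ m).
Proof.
move=> H x y; rewrite -walk_shift -walkN -walkD; apply: walk_bound => z.
exact: H.
Qed.

Lemma norm_walk_step m b : `|walk_step m b| <= eps.
Proof.
rewrite normrZ normrM (ger0_norm eps_ge0).
have -> : `|pm1 R b| = 1 by case: b; rewrite /pm1 ?normrN1 ?normr1.
by rewrite mul1r ler_piMr.
Qed.

Lemma norm_walk_stepB m m' b : `|walk_step m b - walk_step m' b| <= 2 * eps.
Proof.
apply: le_trans (ler_normB _ _) _.
by have := norm_walk_step m b; have := norm_walk_step m' b; lra.
Qed.

(** Each common sign shifts the window by one and so pushes out one possible disagreement. *)
Lemma drop_append k m m' b : (k < d)%N -> drop k.+1 m = drop k.+1 m' ->
  drop k (append m b) = drop k (append m' b).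
Proof.
move=> kd H; rewrite /append /= -!drop1 !drop_drop !addn1 !drop_rcons ?size_tuple //.
by rewrite H.
Qed.

Lemma drop0_eq m m' : drop 0 m = drop 0 m' -> m = m'.
Proof. by rewrite !drop0 => /val_inj. Qed.

(* Two walks driven by the same signs share their history after [d] rounds. *)
Lemma walk_lip_history f M j k x x' m m' : lipb M f -> (k <= d)%N ->
  drop k m = drop k m' ->
  `|walk f j x m - walk f j x' m'| <= M * (`|x - x'| + 2 * eps * k%:R).
Proof.
move=> H; have M0 : 0 <= M := lipb_ge0 (Ordinal n_gt0) H.
have H0 j' y y' m0 : `|walk f j' y m0 - walk f j' y' m0| <= M * `|y - y'|.
  by have := walk_lipb j' m0 H y' (y - y'); rewrite [y' + _]addrC subrK.
elim: j k x x' m m' => [|j ih] [|k] x x' m m' kd E.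
- by rewrite mulr0 addr0; exact: (H0 0%N x x' m).
- apply: le_trans (H0 0%N x x' m) _; rewrite ler_wpM2l // lerDl.
  by rewrite !mulr_ge0.
- by rewrite (drop0_eq E) mulr0 addr0; exact: (H0 j.+1).
rewrite /=.
have Hb b : `|walk f j (x + walk_step m b) (append m b)
    - walk f j (x' + walk_step m' b) (append m' b)|
    <= M * (`|x - x'| + 2 * eps * k.+1%:R).
  apply: le_trans (ih k _ _ _ _ (ltnW kd) (drop_append b kd E)) _.
  rewrite ler_wpM2l // -(natr1 k) mulrDr mulr1 [_ + 2 * eps]addrC addrA lerD2r.
  have -> : x + walk_step m b - (x' + walk_step m' b)
            = (x - x') + (walk_step m b - walk_step m' b).
    by rewrite opprD addrACA.
  by apply: le_trans (ler_normD _ _) _; rewrite lerD2l norm_walk_stepB.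
have := Hb true; have := Hb false; rewrite !ler_norml.
by move=> /andP[? ?] /andP[? ?]; apply/andP; split; lra.
Qed.

Lemma walk_history_lip f M j x x' m m' : lipb M f ->
  `|walk f j x m - walk f j x' m'| <= M * (`|x - x'| + 2 * eps * d%:R).
Proof.
move=> H; apply: walk_lip_history => //.
(* Nothing lies past position [d], so any two histories agree there. *)
by rewrite !drop_oversize ?size_tuple.
Qed.

Lemma walk_c11_same f Df M j x y m : c11 M f Df ->
  `|walk f j (x + y) m - walk f j x m - \sum_i y 0 i * walk (Df i) j x m|
  <= M * `|y| ^+ 2.
Proof.
move=> [H _]; rewrite -walk_shift.
have -> : \sum_i y 0 i * walk (Df i) j x m = walk (fun z => \sum_i y 0 i * Df i z) j x m.
  by rewrite walk_sum; apply: eq_bigr => i _; rewrite walkZ.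
by rewrite -!walkN -!walkD; apply: walk_bound => z; exact: H.
Qed.

Lemma walk_taylor2 f p X T j x y m : taylor2 T f p X ->
  `|walk f j (x + y) m - walk f j x m - \sum_i y 0 i * walk (p i) j x m
    - quad (fun i i' => walk (X i i') j x m) y / 2| <= T * `|y| ^+ 3.
Proof.
move=> H; rewrite -walk_shift.
have -> : \sum_i y 0 i * walk (p i) j x m = walk (fun z => \sum_i y 0 i * p i z) j x m.
  by rewrite walk_sum; apply: eq_bigr => i _; rewrite walkZ.
have -> : quad (fun i i' => walk (X i i') j x m) y / 2
    = walk (fun z => 2^-1 * quad (fun i i' => X i i' z) y) j x m.
  rewrite walkZ mulrC /quad walk_sum; congr (_ * _); apply: eq_bigr => i _.
  by rewrite walk_sum; apply: eq_bigr => i' _; rewrite walkZ.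
rewrite -!walkN -!walkD; apply: walk_bound => z.
by rewrite [2^-1 * _]mulrC; exact: H.
Qed.

(* The first-order terms nearly cancel because each round is a fair coin flip
   given the past. *)
Lemma walk_c11_history f Df M j k x y m m' : c11 M f Df -> (k <= d)%N ->
  drop k m = drop k m' ->
  `|walk f j (x + y) m' - walk f j x m - \sum_i y 0 i * walk (Df i) j x m|
  <= M * (`|y| + 2 * eps * k%:R) ^+ 2 + k%:R * (4 * n%:R * M * eps ^+ 2 * d%:R).
Proof.
move=> H; have M0 : 0 <= M := lipb_ge0 (Ordinal n_gt0) (H.2 (Ordinal n_gt0)).
have n0 : 0 <= n%:R :> R by [].
have d1 : 1 <= d%:R :> R by rewrite ler1n.
elim: j k x y m m' => [|j ih] [|k] x y m m' kd E.
- by rewrite mulr0 addr0 mul0r addr0; exact: H.1.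
- apply: le_trans (H.1 x y) _; rewrite -[X in X <= _]addr0 lerD //.
    rewrite ler_wpM2l // ler_sqr ?nnegrE ?addr_ge0 ?mulr_ge0 //.
    by rewrite lerDl !mulr_ge0.
  by rewrite !mulr_ge0 // sqr_ge0.
- rewrite -(drop0_eq E) mulr0 addr0 mul0r addr0; exact: walk_c11_same.
(* The additional separation of the two walks after one common sign [b]. *)
pose dy b : 'rV[R]_n := walk_step m' b - walk_step m b.
pose W b := walk f j (x + walk_step m b + (y + dy b)) (append m' b)
  - walk f j (x + walk_step m b) (append m b)
  - \sum_i (y + dy b) 0 i * walk (Df i) j (x + walk_step m b) (append m b).
have hW b : `|W b| <= M * (`|y| + 2 * eps * k.+1%:R) ^+ 2
    + k%:R * (4 * n%:R * M * eps ^+ 2 * d%:R).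
  apply: le_trans (ih k _ _ _ _ (ltnW kd) (drop_append b kd E)) _.
  rewrite lerD2r ler_wpM2l // ler_sqr ?nnegrE ?addr_ge0 ?mulr_ge0 //.
  rewrite -(natr1 k) mulrDr mulr1 [_ + 2 * eps]addrC [leRHS]addrA lerD2r.
  by apply: le_trans (ler_normD _ _) _; rewrite lerD2l norm_walk_stepB.
pose D i b := walk (Df i) j (x + walk_step m b) (append m b).
have hD i : `|D i true - D i false| <= 4 * M * eps * d%:R.
  apply: le_trans (walk_history_lip _ _ _ _ _ (H.2 i)) _.
  have : `|x + walk_step m true - (x + walk_step m false)| <= 2 * eps * d%:R.
    rewrite opprD addrACA subrr add0r; apply: (@le_trans _ _ (2 * eps)).
      apply: le_trans (ler_normB _ _) _.
      by have := norm_walk_step m true; have := norm_walk_step m false; lra.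
    by rewrite ler_peMr // mulr_ge0.
  move=> h1; have -> : 4 * M * eps * d%:R = M * (2 * eps * d%:R + 2 * eps * d%:R) by ring.
  by rewrite ler_wpM2l // lerD2r.
have hS : `|\sum_i (q m' - q m) 0 i * (eps / 2 * (D i true - D i false))|
    <= 4 * n%:R * M * eps ^+ 2 * d%:R.
  have -> : 4 * n%:R * M * eps ^+ 2 * d%:R
     = n%:R * (2 * (eps / 2 * (4 * M * eps * d%:R))) by field.
  apply: norm_sum_le => i; rewrite normrM ler_pM //.
    apply: le_trans (norm_coord _ _) _; apply: le_trans (ler_normB _ _) _.
    by have := q_le1 m; have := q_le1 m'; lra.
  by rewrite normrM ger0_norm ?divr_ge0 // ler_wpM2l // divr_ge0.
(* [dy true] and [dy false] are opposite, so the first-order terms leave only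
   [D i true - D i false], which is O(M eps d) by [walk_history_lip]. With the factor [eps] in
   front, each round costs O(n M eps^2 d). *)
have -> : walk f j.+1 (x + y) m' - walk f j.+1 x m
     - \sum_i y 0 i * walk (Df i) j.+1 x m
   = (W true + W false) / 2
     + \sum_i (q m' - q m) 0 i * (eps / 2 * (D i true - D i false)).
  have xy b : x + y + walk_step m' b = x + walk_step m b + (y + dy b).
    by rewrite /dy addrACA [_ + (_ - _)]addrC subrK.
  have -> : walk f j.+1 (x + y) m' =
      (walk f j (x + walk_step m true + (y + dy true)) (append m' true)
       + walk f j (x + walk_step m false + (y + dy false)) (append m' false)) / 2.
    by rewrite /= !xy.
  have -> : \sum_i y 0 i * walk (Df i) j.+1 x m
     = (\sum_i (y + dy true) 0 i * D i true + \sum_i (y + dy false) 0 i * D i false) / 2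
       - \sum_i (q m' - q m) 0 i * (eps / 2 * (D i true - D i false)).
    rewrite -big_split mulr_suml -sumrB; apply: eq_bigr => i _ /=.
    by rewrite /dy /walk_step !mxE -!/(D i _) /pm1; field.
  by rewrite /W /=; field.
have := hW true; have := hW false; move: hS.
rewrite -(natr1 k) [(k%:R + 1) * _]mulrDl mul1r !ler_norml.
by move=> /andP[? ?] /andP[? ?] /andP[? ?]; apply/andP; split; lra.
Qed.

(** Without initial displacement the linear term vanishes, and [d] coupled rounds cost O((eps d)^2)
    instead of the O(eps d) of [walk_history_lip]. Both the admissibility of moves and the
    consistency estimate rest on this gain. *)
Lemma walk_history_c11 f Df M j x m m' : c11 M f Df ->
  `|walk f j x m' - walk f j x m| <= 8 * n%:R * M * eps ^+ 2 * d%:R ^+ 2.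
Proof.
move=> H; have M0 : 0 <= M := lipb_ge0 (Ordinal n_gt0) (H.2 (Ordinal n_gt0)).
have E : drop d m = drop d m' by rewrite !drop_oversize ?size_tuple.
have := walk_c11_history j x 0 H (leqnn d) E.
rewrite addr0 normr0 add0r big1 ?subr0 => [|i _]; last by rewrite mxE mul0r.
move=> /le_trans; apply.
have n1 : 1 <= n%:R :> R by rewrite ler1n.
have : 0 <= M * eps ^+ 2 * d%:R ^+ 2 by rewrite !mulr_ge0 ?sqr_ge0.
set z := M * eps ^+ 2 * d%:R ^+ 2 => z0.
have -> : M * (2 * eps * d%:R) ^+ 2 + d%:R * (4 * n%:R * M * eps ^+ 2 * d%:R)
  = 4 * z + 4 * n%:R * z by rewrite /z; ring.
have -> : 8 * n%:R * M * eps ^+ 2 * d%:R ^+ 2 = 8 * n%:R * z by rewrite /z; ring.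
by have : z <= n%:R * z; [rewrite ler_peMl|lra].
Qed.

End Walk.

(** * The walk averaged over starting histories *)

Section WalkAverage.
Context (R : realType) (n d : nat) (q : history d -> 'rV[R]_n) (eps : R).
Hypotheses (n_gt0 : (0 < n)%N) (d_gt0 : (0 < d)%N) (eps_ge0 : 0 <= eps).
Hypothesis q_le1 : forall m, `|q m| <= 1.
Implicit Types (f h : 'rV[R]_n -> R) (x y : 'rV[R]_n) (m : history d) (M c T : R).
Local Notation walk := (walk q eps).
Local Notation walk_step := (walk_step q eps).

(* Together with the entry that it drops, [append m b] determines [(m, b)]. *)
Lemma sum_append (phi : history d -> R) :
  \sum_m (phi (append m true) + phi (append m false)) = 2 * \sum_m phi m.
Proof.
pose rot (p : history d * bool) := (append p.1 p.2, head false p.1).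
have rot_inj : injective rot.
  move=> [m b] [m' b'] [] /=.
  have [sm sm'] := (size_tuple m, size_tuple m').
  move=> E1 E2; suff [E ->] : tval m = tval m' /\ b = b' by rewrite (val_inj E).
  move: sm sm' E1 E2; case: (tval m) => [|a s].
    by move=> d0; move: d_gt0; rewrite -[X in (0 < X)%N]d0.
  case: (tval m') => [|a' s'].
    by move=> _ d0; move: d_gt0; rewrite -[X in (0 < X)%N]d0.
  by move=> _ _ /= /rcons_inj [-> ->] ->.
transitivity (\sum_m \sum_(b : bool) phi (append m b)).
  by apply: eq_bigr => m _; rewrite big_bool.
transitivity (\sum_(p : history d * bool) phi p.1).
  by rewrite pair_big /= [RHS](reindex_inj rot_inj).
rewrite -(pair_big xpredT xpredT (fun m (b : bool) => phi m)) /= mulr_sumr.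
by apply: eq_bigr => m _; rewrite big_bool mulr_natl.
Qed.

Definition mean_hist (phi : history d -> R) : R := (2 ^+ d)^-1 * \sum_m phi m.

Lemma mean_hist_cst c : mean_hist (fun=> c) = c.
Proof.
rewrite /mean_hist sumr_const card_tuple card_bool -[_ *+ (2 ^ d)]mulr_natr natrX mulrC.
by rewrite mulrK // unitfE expf_neq0.
Qed.

Lemma mean_hist_lin (phi psi : history d -> R) (a b : R) :
  mean_hist (fun m => a * phi m + b * psi m) = a * mean_hist phi + b * mean_hist psi.
Proof. by rewrite /mean_hist big_split /= -!mulr_sumr; ring. Qed.

Lemma mean_histB (phi psi : history d -> R) :
  mean_hist (fun m => phi m - psi m) = mean_hist phi - mean_hist psi.
Proof. by rewrite /mean_hist sumrB mulrBr. Qed.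

Lemma mean_hist_ge (phi : history d -> R) c :
  (forall m, c <= phi m) -> c <= mean_hist phi.
Proof.
move=> H; rewrite -(mean_hist_cst c) /mean_hist ler_wpM2l ?invr_ge0 ?exprn_ge0 //.
exact: ler_sum.
Qed.

Lemma mean_hist_bound (phi : history d -> R) c :
  (forall m, `|phi m| <= c) -> `|mean_hist phi| <= c.
Proof.
move=> H; rewrite ler_norml; apply/andP; split.
  by apply: mean_hist_ge => m; have := H m; rewrite ler_norml => /andP[].
rewrite -lerN2; have -> : - mean_hist phi = mean_hist (fun m => - phi m).
  by rewrite /mean_hist sumrN mulrN.
by apply: mean_hist_ge => m; have := H m; rewrite ler_norml lerN2 => /andP[].
Qed.

Lemma mean_hist_near (phi : history d -> R) c m :
  (forall m', `|phi m - phi m'| <= c) -> `|phi m - mean_hist phi| <= c.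
Proof.
by move=> H; rewrite -(mean_hist_cst (phi m)) -mean_histB; apply: mean_hist_bound.
Qed.

Lemma mean_hist_sum (I : finType) (F : I -> history d -> R) :
  mean_hist (fun m => \sum_i F i m) = \sum_i mean_hist (F i).
Proof. by rewrite /mean_hist exchange_big mulr_sumr. Qed.

Definition mean_walk f j x := mean_hist (walk f j x).

Lemma mean_walk_shift_ge f y c j x : (forall z, c <= f (z + y) - f z) ->
  c <= mean_walk f j (x + y) - mean_walk f j x.
Proof. by move=> H; rewrite -mean_histB; apply: mean_hist_ge => m; apply: walk_shift_ge. Qed.

Lemma mean_walk_lipb f M j : lipb M f -> lipb M (mean_walk f j).
Proof.
move=> H x y; rewrite -mean_histB; apply: mean_hist_bound => m.
exact: walk_lipb.
Qed.

Lemma mean_walk_taylor2 f p X T j : taylor2 T f p X ->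
  taylor2 T (mean_walk f j) (fun i => mean_walk (p i) j)
    (fun i i' => mean_walk (X i i') j).
Proof.
move=> H x y.
have -> : \sum_i y 0 i * mean_walk (p i) j x
    = mean_hist (fun m => \sum_i y 0 i * walk (p i) j x m).
  rewrite mean_hist_sum; apply: eq_bigr => i _.
  by rewrite /mean_hist -mulr_sumr mulrCA.
have -> : quad (fun i i' => mean_walk (X i i') j x) y / 2
    = mean_hist (fun m => quad (fun i i' => walk (X i i') j x m) y / 2).
  rewrite /mean_hist -mulr_suml mulrA; congr (_ / 2).
  rewrite -/(mean_hist _) mean_hist_sum; apply: eq_bigr => i _.
  rewrite mean_hist_sum; apply: eq_bigr => i' _.
  by rewrite /mean_walk /mean_hist -mulr_sumr mulrCA.
by rewrite -!mean_histB; apply: mean_hist_bound => m; apply: walk_taylor2.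
Qed.

(** A fair bit appended to a uniform history gives a uniform history. The earlier average can thus
    be written over the histories reached after one round, and only the change of position
    remains. *)
Lemma mean_walkS f j x :
  mean_walk f j.+1 x - mean_walk f j x =
  mean_hist (fun m =>
    ((walk f j (x + walk_step m true) (append m true) - walk f j x (append m true))
   + (walk f j (x + walk_step m false) (append m false) - walk f j x (append m false)))
    / 2).
Proof.
have -> : mean_walk f j x = mean_hist (fun m =>
    (walk f j x (append m true) + walk f j x (append m false)) / 2).
  by rewrite /mean_hist -mulr_suml sum_append /mean_walk /mean_hist; field; rewrite expf_neq0.
by rewrite -mean_histB; congr mean_hist; apply/funext => m /=; field.
Qed.

Lemma mean_walk_step f M j x : lipb M f ->
  `|mean_walk f j.+1 x - mean_walk f j x| <= M * eps.
Proof.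
move=> H; rewrite mean_walkS; apply: mean_hist_bound => m.
have M0 : 0 <= M := lipb_ge0 (Ordinal n_gt0) H.
have h b : `|walk f j (x + walk_step m b) (append m b) - walk f j x (append m b)|
    <= M * eps.
  apply: le_trans (walk_lipb q eps j (append m b) H x _) _.
  by rewrite ler_wpM2l ?norm_walk_step.
have := h true; have := h false; rewrite !ler_norml.
by move=> /andP[? ?] /andP[? ?]; apply/andP; split; lra.
Qed.

(* [F] is linear on the matrices that annihilate [ones]. *)
Definition diffusion (Y : 'I_n -> 'I_n -> R) : R :=
  (2 ^+ d.+1)^-1 * \sum_m quad Y (q m).

Lemma diffusionE (Y : 'I_n -> 'I_n -> R) :
  diffusion Y = mean_hist (fun m => quad Y (q m)) / 2.
Proof. by rewrite /diffusion /mean_hist exprS; field; rewrite expf_neq0. Qed.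

Lemma diffusion_lin (Y Z : 'I_n -> 'I_n -> R) (a b : R) :
  diffusion (fun i j => a * Y i j + b * Z i j) = a * diffusion Y + b * diffusion Z.
Proof.
rewrite !diffusionE mulrA [b * _]mulrA -mulrDl -mean_hist_lin.
by congr (_ / 2); congr mean_hist; apply/funext => m; rewrite quad_lin.
Qed.

Lemma diffusion_bound (Y : 'I_n -> 'I_n -> R) c :
  (forall i j, `|Y i j| <= c) -> `|diffusion Y| <= n%:R ^+ 2 * c / 2.
Proof.
move=> H; have c0 : 0 <= c by apply: le_trans (H (Ordinal n_gt0) (Ordinal n_gt0)).
rewrite diffusionE normrM (ger0_norm (x := 2^-1)) ?invr_ge0 // ler_wpM2r ?invr_ge0 //.
apply: mean_hist_bound => m; apply: le_trans (quad_bound _ H) _.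
by rewrite ler_wpM2l ?sqr_ge0 // ler_piMl // expr_le1.
Qed.

Lemma diffusionB (Y Z : 'I_n -> 'I_n -> R) :
  diffusion (fun i j => Y i j - Z i j) = diffusion Y - diffusion Z.
Proof.
rewrite -[diffusion Y]mul1r -mulN1r -diffusion_lin.
by congr diffusion; apply/funext => i; apply/funext => j; rewrite mul1r mulN1r.
Qed.

Lemma diffusion_step (X : 'I_n -> 'I_n -> 'rV[R]_n -> R) M j x :
  (forall i i', lipb M (X i i')) ->
  `|diffusion (fun i i' => mean_walk (X i i') j.+1 x)
    - diffusion (fun i i' => mean_walk (X i i') j x)| <= n%:R ^+ 2 * (M * eps) / 2.
Proof.
by move=> H; rewrite -diffusionB; apply: diffusion_bound => i i'; apply: mean_walk_step.
Qed.

(** The first round is expanded to second order at [x]. The terms [eps * p] have opposite signs and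
    leave a difference between histories, O(M d^2 eps^2) by [walk_history_c11]. The Hessian of each
    history is within O(M eps d) of the mean one. After multiplication by [eps] and [eps ^ 2]
    respectively, every error is of order [eps ^ 3]. *)
Lemma mean_walk_consistency f p X K M j x :
  c11 K f p -> (forall i, c11 M (p i) (X i)) ->
  `|mean_walk f j.+1 x - mean_walk f j x
    - eps ^+ 2 * diffusion (fun i i' => mean_walk (X i i') j x)|
  <= 6 * n%:R ^+ 2 * d%:R ^+ 2 * M * eps ^+ 3.
Proof.
move=> hf hp; have M0 : 0 <= M := lipb_ge0 (Ordinal n_gt0) ((hp (Ordinal n_gt0)).2 (Ordinal n_gt0)).
have hT := taylor2_of_c11 hf hp.
have n1 : 1 <= n%:R :> R by rewrite ler1n.
have d1 : 1 <= d%:R :> R by rewrite ler1n.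
have e2 : 0 <= eps ^+ 2 := sqr_ge0 _.
rewrite mean_walkS diffusionE.
set Y := fun i i' => mean_walk (X i i') j x.
have -> : eps ^+ 2 * (mean_hist (fun m => quad Y (q m)) / 2)
    = mean_hist (fun m => eps ^+ 2 / 2 * quad Y (q m)).
  by rewrite /mean_hist -mulr_sumr; field; rewrite expf_neq0.
rewrite -mean_histB; apply: mean_hist_bound => m.
pose P i b := walk (p i) j x (append m b).
pose Z b i i' := walk (X i i') j x (append m b).
pose W b := walk f j (x + walk_step m b) (append m b) - walk f j x (append m b).
pose s b : R := pm1 R b * eps.
have s2 b : s b ^+ 2 = eps ^+ 2 by rewrite /s exprMn /pm1; case: b; rewrite ?sqrrN expr1n mul1r.
have h1 b : `|W b - s b * (\sum_i q m 0 i * P i b) - eps ^+ 2 * quad (Z b) (q m) / 2|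
    <= n%:R * M * eps ^+ 3.
  have := walk_taylor2 q eps j x (walk_step m b) (append m b) hT.
  rewrite quadZ -/(s b) s2.
  have -> : \sum_i walk_step m b 0 i * walk (p i) j x (append m b)
      = s b * \sum_i q m 0 i * P i b.
    by rewrite mulr_sumr; apply: eq_bigr => i _; rewrite mxE mulrA.
  move=> /le_trans; apply; rewrite ler_wpM2l ?mulr_ge0 //.
  by rewrite lerXn2r ?nnegrE ?norm_walk_step.
have h2 : `|\sum_i q m 0 i * (P i true - P i false)|
    <= n%:R * (8 * n%:R * M * eps ^+ 2 * d%:R ^+ 2).
  apply: norm_sum_le => i; rewrite normrM -[X in _ <= X]mul1r ler_pM //.
    exact: le_trans (norm_coord _ _) (q_le1 m).
  exact: walk_history_c11.
have h3 b : `|quad (Z b) (q m) - quad Y (q m)| <= n%:R ^+ 2 * (2 * M * eps * d%:R).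
  have -> : quad (Z b) (q m) - quad Y (q m) = quad (fun i i' => Z b i i' - Y i i') (q m).
    rewrite -[quad (Z b) _]mul1r -mulN1r -quad_lin.
    by congr quad; apply/funext => i; apply/funext => i'; rewrite mul1r mulN1r.
  have H i i' : `|Z b i i' - Y i i'| <= 2 * M * eps * d%:R.
    apply: mean_hist_near => m'.
    have := walk_history_lip n_gt0 eps_ge0 q_le1 j x x (append m b) m' ((hp i).2 i').
    by rewrite subrr normr0 add0r mulrA [M * _]mulrA [M * 2]mulrC.
  apply: le_trans (quad_bound _ H) _; rewrite ler_wpM2l ?sqr_ge0 //.
  rewrite ler_piMl ?expr_le1 // !mulr_ge0 //.
set E := (X in `|X|).
(* The constant 6 is 1 + 4 + 1: Taylor remainder, first-order difference, and replacement of the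
   Hessian by its mean. *)
have -> : E = ((W true - s true * (\sum_i q m 0 i * P i true) - eps ^+ 2 * quad (Z true) (q m) / 2)
   + (W false - s false * (\sum_i q m 0 i * P i false) - eps ^+ 2 * quad (Z false) (q m) / 2)) / 2
   + eps / 2 * (\sum_i q m 0 i * (P i true - P i false))
   + eps ^+ 2 / 4 * ((quad (Z true) (q m) - quad Y (q m)) + (quad (Z false) (q m) - quad Y (q m))).
  have -> : \sum_i q m 0 i * (P i true - P i false)
      = \sum_i q m 0 i * P i true - \sum_i q m 0 i * P i false.
    by rewrite -sumrB; apply: eq_bigr => i _; rewrite mulrBr.
  by rewrite /E -/(W true) -/(W false) /s /pm1; field.
have g2 : `|eps / 2 * (\sum_i q m 0 i * (P i true - P i false))|
    <= eps / 2 * (n%:R * (8 * n%:R * M * eps ^+ 2 * d%:R ^+ 2)).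
  by rewrite normrM ger0_norm ?divr_ge0 // ler_wpM2l ?divr_ge0.
have g3 : `|eps ^+ 2 / 4 * ((quad (Z true) (q m) - quad Y (q m))
     + (quad (Z false) (q m) - quad Y (q m)))|
    <= eps ^+ 2 / 4 * (2 * (n%:R ^+ 2 * (2 * M * eps * d%:R))).
  rewrite normrM ger0_norm ?divr_ge0 // ler_wpM2l ?divr_ge0 //.
  apply: le_trans (ler_normD _ _) _.
  by have := h3 true; have := h3 false; lra.
have g1 := lerD (h1 true) (h1 false).
set w := M * eps ^+ 3.
have w0 : 0 <= w by rewrite mulr_ge0 ?exprn_ge0.
have b1 : n%:R * w <= n%:R ^+ 2 * (d%:R ^+ 2 * w).
  rewrite expr2 -mulrA ler_wpM2l //; apply: (@le_trans _ _ (n%:R * w)).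
    by rewrite ler_peMl.
  by rewrite ler_wpM2l // ler_peMl // exprn_ege1.
have b2 : n%:R ^+ 2 * (d%:R * w) <= n%:R ^+ 2 * (d%:R ^+ 2 * w).
  by rewrite ler_wpM2l ?sqr_ge0 // expr2 -mulrA ler_peMl // mulr_ge0.
have -> : 6 * n%:R ^+ 2 * d%:R ^+ 2 * M * eps ^+ 3 = 6 * (n%:R ^+ 2 * (d%:R ^+ 2 * w)).
  by rewrite /w; ring.
have e3 : eps / 2 * (n%:R * (8 * n%:R * M * eps ^+ 2 * d%:R ^+ 2))
  = 4 * (n%:R ^+ 2 * (d%:R ^+ 2 * w)) by rewrite /w; field.
have e4 : eps ^+ 2 / 4 * (2 * (n%:R ^+ 2 * (2 * M * eps * d%:R)))
  = n%:R ^+ 2 * (d%:R * w) by rewrite /w; field.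
rewrite e3 in g2; rewrite e4 in g3.
have ht := h1 true; have hf' := h1 false.
have e5 : n%:R * M * eps ^+ 3 = n%:R * w by rewrite /w mulrA.
rewrite e5 in ht hf'.
apply: le_trans (ler_normD _ _) _; apply: le_trans (lerD (ler_normD _ _) g3) _.
set A := (X in `|X / 2|).
have g4 : `|A / 2| <= n%:R * w.
  rewrite normrM (ger0_norm (x := 2^-1)) ?invr_ge0 //.
  rewrite ler_pdivrMr //; apply: le_trans (ler_normD _ _) _; lra.
by have := normr_ge0 (A / 2); lra.
Qed.

End WalkAverage.

(** * Viscosity inequalities with quadratic test functions *)

Section QuadraticTestFunctions.
Context (R : realType) (n : nat).
Local Notation E := ('rV[R]_n * R)%type.
Implicit Types (p v : E) (Y : 'I_n -> 'I_n -> R) (beta gamma : 'rV[R]_n) (f : E -> R).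

Lemma nbhs_near_norm (T : normedModType R) (x : T) (P : set T) :
  nbhs x P -> exists2 e : R, 0 < e & forall z, `|z| < e -> P (x + z).
Proof.
move=> /nbhs_normP[e /= e0 H]; exists e => // z ze; apply: H => /=.
by rewrite /ball_ /= opprD addrA subrr add0r normrN.
Qed.

Lemma near_norm_nbhs (T : normedModType R) (x : T) (P : set T) (e : R) :
  0 < e -> (forall z, `|z| < e -> P (x + z)) -> nbhs x P.
Proof.
move=> e0 H; apply/nbhs_normP; exists e => // y /=; rewrite /ball_ /= => ye.
by have := H (y - x); rewrite [x + _]addrC subrK; apply; rewrite distrC.
Qed.

Lemma continuous_sum (T : topologicalType) (I : Type) (r : seq I) (F : I -> T -> R) :
  (forall i, continuous (F i)) -> continuous (fun x => \sum_(i <- r) F i x).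
Proof.
move=> H; elim: r => [|i r ih].
  have -> : (fun x => \sum_(i <- [::]) F i x) = (fun=> 0).
    by apply/funext => x; rewrite big_nil.
  by move=> x; exact: cvg_cst.
have -> : (fun x => \sum_(j <- i :: r) F j x) = (fun x => F i x + \sum_(j <- r) F j x).
  by apply/funext => x; rewrite big_cons.
by move=> x; apply: continuousD; [exact: H|exact: ih].
Qed.

Lemma continuous_coord i : continuous (fun p => p.1 0 i).
Proof.
move=> p; apply: (@continuous_comp E 'rV[R]_n R fst (fun x : 'rV[R]_n => x 0 i) p).
  exact: cvg_fst.
exact: coord_continuous.
Qed.

Lemma continuous_time : continuous (fun p => p.2).
Proof. by move=> p; exact: cvg_snd. Qed.

(** A family closed under directional derivatives, so smoothness is an induction. The terms in
    [gamma] and [k] accommodate the time dependence of the penalized competitor. *)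
Definition qpoly (o : E) (c alpha : R) beta Y gamma (k : R) p : R :=
  let y := p.1 - o.1 in let s := p.2 - o.2 in
  c + alpha * s + \sum_i beta 0 i * y 0 i + quad Y y / 2
  + s * (\sum_i gamma 0 i * y 0 i) + k * s ^+ 2.

Lemma qpoly_continuous o c alpha beta Y gamma k :
  continuous (qpoly o c alpha beta Y gamma k).
Proof.
have cy i : continuous (fun p => (p.1 - o.1) 0 i).
  have -> : (fun p => (p.1 - o.1) 0 i) = (fun p => p.1 0 i - o.1 0 i).
    by apply/funext => p; rewrite !mxE.
  by move=> p; apply: continuousB; [exact: continuous_coord|exact: cvg_cst].
have cs : continuous (fun p => p.2 - o.2).
  by move=> p; apply: continuousB; [exact: continuous_time|exact: cvg_cst].
have clin (b : 'rV[R]_n) : continuous (fun p => \sum_i b 0 i * (p.1 - o.1) 0 i).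
  by apply: continuous_sum => i p; apply: continuousM; [exact: cvg_cst|exact: cy].
have cq : continuous (fun p => quad Y (p.1 - o.1)).
  have cyy i j : continuous (fun p => (p.1 - o.1) 0 i * (p.1 - o.1) 0 j * Y i j).
    move=> p; apply: (@continuousM R E (fun p => (p.1 - o.1) 0 i * (p.1 - o.1) 0 j)).
      by apply: continuousM; exact: cy.
    exact: cvg_cst.
  by apply: continuous_sum => i; apply: continuous_sum => j; exact: cyy.
have cD (f g : E -> R) : continuous f -> continuous g -> continuous (fun p => f p + g p).
  by move=> hf hg p; apply: continuousD; [exact: hf|exact: hg].
have cM (f g : E -> R) : continuous f -> continuous g -> continuous (fun p => f p * g p).
  by move=> hf hg p; apply: continuousM; [exact: hf|exact: hg].
have cC (a : R) : continuous (fun _ : E => a) by move=> p; exact: cvg_cst.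
rewrite /qpoly; cbv zeta; apply: (cD); last by apply: (cM) => //; exact: (cM).
apply: (cD); last exact: (cM).
apply: (cD); last exact: (cM).
apply: (cD) => //; apply: (cD) => //; exact: (cM).
Qed.

(** The array [Y] need not be symmetric; only its symmetric part enters the derivative of
    [quad Y / 2] along [w]. *)
Definition sym_action Y (w : 'rV[R]_n) : 'rV[R]_n :=
  \row_i (\sum_j (Y i j + Y j i) * w 0 j / 2).

Lemma quad_increment Y y w (h : R) :
  quad Y (y + h *: w) = quad Y y
   + h * (2 * \sum_i sym_action Y w 0 i * y 0 i) + h ^+ 2 * quad Y w.
Proof.
have -> : 2 * \sum_i sym_action Y w 0 i * y 0 i
    = \sum_i \sum_j (y 0 i * w 0 j + w 0 i * y 0 j) * Y i j.
  transitivity (\sum_i \sum_j y 0 i * w 0 j * Y i j + \sum_i \sum_j y 0 j * w 0 i * Y i j).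
    rewrite [X in _ = _ + X]exchange_big -big_split mulr_sumr; apply: eq_bigr => i _ /=.
    rewrite -big_split mxE mulr_suml mulr_sumr.
    by apply: eq_bigr => j _ /=; field.
  rewrite -big_split; apply: eq_bigr => i _; rewrite -big_split.
  by apply: eq_bigr => j _ /=; ring.
rewrite /quad !mulr_sumr -!big_split; apply: eq_bigr => i _.
rewrite !mulr_sumr -!big_split; apply: eq_bigr => j _ /=.
by rewrite !mxE; ring.
Qed.

Lemma derive_of_increment f p v a b :
  (forall h : R, f (h *: v + p) - f p = h * a + h ^+ 2 * b) ->
  derivable f p v /\ 'D_v f p = a.
Proof.
move=> H.
have c : h^-1 *: ((f \o shift p) (h *: v) - f p) @[h --> 0^'] --> a.
  have cab : a + h * b @[h --> 0^'] --> a.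
    have -> : a = a + 0 * b by rewrite mul0r addr0.
    rewrite [X in X + _ * _ @[_ --> _]](_ : _ = a); last by rewrite mul0r addr0.
    apply: cvgD; first exact: cvg_cst.
    apply: cvgM; last exact: cvg_cst.
    exact: (@nbhs_dnbhs _ (0 : R)).
  apply: cvg_trans cab; apply: near_eq_cvg.
  near=> h; have h0 : h != 0 by near: h; exact: nbhs_dnbhs_neq.
  rewrite /= H /GRing.scale /= mulrDr mulrA mulVf // mul1r; congr (_ + _).
  by rewrite expr2 mulrA mulrA mulVf // mul1r.
split; first by apply/cvg_ex; exists a.
exact: cvg_lim c.
Unshelve. all: by end_near. Qed.

Lemma qpoly_derive o c alpha beta Y gamma k p v :
  let f := qpoly o c alpha beta Y gamma k in
  derivable f p v /\ 'D_v f p =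
    qpoly o (alpha * v.2 + \sum_i beta 0 i * v.1 0 i)
      (\sum_i gamma 0 i * v.1 0 i + 2 * k * v.2)
      (sym_action Y v.1 + v.2 *: gamma) (fun _ _ => 0) 0 0 p.
Proof.
move=> f.
apply: (@derive_of_increment f p v _
  (quad Y v.1 / 2 + v.2 * (\sum_i gamma 0 i * v.1 0 i) + k * v.2 ^+ 2)) => h.
rewrite /f /qpoly /=.
have -> : h *: v.1 + p.1 - o.1 = (p.1 - o.1) + h *: v.1.
  by rewrite [h *: _ + _]addrC addrAC.
set y := p.1 - o.1.
have lin (b : 'rV[R]_n) : \sum_i b 0 i * (y + h *: v.1) 0 i
    = \sum_i b 0 i * y 0 i + h * \sum_i b 0 i * v.1 0 i.
  by rewrite mulr_sumr -big_split; apply: eq_bigr => i _ /=; rewrite !mxE; ring.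
rewrite quad_increment !lin.
have -> : quad (fun _ _ => 0) y = 0.
  by rewrite /quad big1 // => i _; rewrite big1 // => j _; rewrite mulr0.
have -> : \sum_i (0 : 'rV[R]_n) 0 i * y 0 i = 0.
  by rewrite big1 // => i _; rewrite mxE mul0r.
have -> : \sum_i (sym_action Y v.1 + v.2 *: gamma) 0 i * y 0 i
   = \sum_i sym_action Y v.1 0 i * y 0 i + v.2 * \sum_i gamma 0 i * y 0 i.
  by rewrite mulr_sumr -big_split; apply: eq_bigr => i _ /=; rewrite !mxE; ring.
by rewrite /GRing.scale /=; field.
Qed.

Lemma qpoly_smooth o c alpha beta Y gamma k : smooth (qpoly o c alpha beta Y gamma k).
Proof.
move=> vs; cbv zeta.
have [c' [a' [b' [Y' [g' [k' ->]]]]]] : exists c' a' b' Y' g' k',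
    foldr (fun v f => 'D_v f) (qpoly o c alpha beta Y gamma k) vs
    = qpoly o c' a' b' Y' g' k'.
  elim: vs => [|v vs [c' [a' [b' [Y' [g' [k' /= ->]]]]]]]; first by do 6 eexists.
  do 6 eexists; apply/funext => p.
  exact: (qpoly_derive o c' a' b' Y' g' k' p v).2.
split; first exact: qpoly_continuous.
by move=> p v; exact: (qpoly_derive o c' a' b' Y' g' k' p v).1.
Qed.

Lemma qpoly_at_center o c alpha beta Y gamma k :
  qpoly o c alpha beta Y gamma k o = c.
Proof.
rewrite /qpoly !subrr mulr0 mul0r expr0n mulr0 !addr0.
rewrite [quad _ _]big1 ?mul0r ?addr0 => [|i _]; last first.
  by rewrite big1 // => j _; rewrite mxE !mul0r.
by rewrite big1 ?addr0 // => i _; rewrite mxE mulr0.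
Qed.

Lemma dt_qpoly o c alpha beta Y gamma k : dt (qpoly o c alpha beta Y gamma k) o = alpha.
Proof.
rewrite /dt (qpoly_derive o c alpha beta Y gamma k o (dir_t R n)).2 qpoly_at_center /=.
by rewrite mulr1 big1 ?addr0 // => i _; rewrite mxE mulr0.
Qed.

Lemma sum_delta (b : 'rV[R]_n) i : \sum_j b 0 j * (delta_mx 0 i : 'rV[R]_n) 0 j = b 0 i.
Proof.
rewrite (bigD1 i) //= big1 ?addr0 => [|j ji]; first by rewrite mxE !eqxx mulr1.
by rewrite mxE (negbTE ji) mulr0.
Qed.

Lemma grad_qpoly o c alpha beta Y gamma k : grad (qpoly o c alpha beta Y gamma k) o = beta.
Proof.
apply/rowP => i; rewrite mxE (qpoly_derive o c alpha beta Y gamma k o (dir R i)).2.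
by rewrite qpoly_at_center /= mulr0 add0r sum_delta.
Qed.

Lemma hessian_qpoly o c alpha beta Y gamma k :
  hessian (qpoly o c alpha beta Y gamma k) o = \matrix_(i, j) ((Y i j + Y j i) / 2).
Proof.
apply/matrixP => i j; rewrite !mxE.
have -> : 'D_(dir R j) (qpoly o c alpha beta Y gamma k) =
   qpoly o (alpha * 0 + \sum_l beta 0 l * (delta_mx 0 j : 'rV[R]_n) 0 l)
      (\sum_l gamma 0 l * (delta_mx 0 j : 'rV[R]_n) 0 l + 2 * k * 0)
      (sym_action Y (delta_mx 0 j) + 0 *: gamma) (fun _ _ => 0) 0 0.
  by apply/funext => p; rewrite (qpoly_derive o c alpha beta Y gamma k p (dir R j)).2.
rewrite (qpoly_derive _ _ _ _ _ _ _ o (dir R i)).2 qpoly_at_center /= mulr0 add0r.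
rewrite sum_delta scale0r addr0 mxE.
rewrite (bigD1 j) //= big1 ?addr0 => [|l lj]; first by rewrite mxE !eqxx mulr1.
by rewrite mxE (negbTE lj) mulr0 mul0r.
Qed.

Lemma quad_sym_matrix Y (v : 'rV[R]_n) :
  dot (v *m (\matrix_(i, j) ((Y i j + Y j i) / 2))^T) v = quad Y v.
Proof.
transitivity (\sum_i \sum_j (v 0 i * v 0 j * Y i j + v 0 j * v 0 i * Y j i) / 2).
  rewrite /dot; apply: eq_bigr => i _; rewrite mxE mulr_suml; apply: eq_bigr => j _.
  by rewrite !mxE; field.
rewrite (eq_bigr (fun i => \sum_j v 0 i * v 0 j * Y i j / 2
    + \sum_j v 0 j * v 0 i * Y j i / 2)); last first.
  by move=> i _; rewrite -big_split; apply: eq_bigr => j _ /=; rewrite mulrDl.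
rewrite big_split /= [X in _ + X]exchange_big -big_split; apply: eq_bigr => i _.
by rewrite -big_split; apply: eq_bigr => j _ /=; field.
Qed.

End QuadraticTestFunctions.

Section Touching.
Context (R : realType) (n d : nat) (q : history d -> 'rV[R]_n).
Local Notation E := ('rV[R]_n * R)%type.
Implicit Types (p o : E) (Y : 'I_n -> 'I_n -> R) (beta gamma : 'rV[R]_n) (u w : E -> R).

Definition Fquad Y beta : R :=
  if dot beta (ones R n) == 0 then 0
  else (2 ^+ d.+1)^-1 * \sum_(m : history d) quad Y (xi q beta m).

Lemma F_sym_matrix Y beta :
  F q (\matrix_(i, j) ((Y i j + Y j i) / 2)) beta = Fquad Y beta.
Proof.
rewrite /F /Fquad; case: eqP => // _; congr (_ * _).
by apply: eq_bigr => m _; rewrite quad_sym_matrix.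
Qed.

(** The one-sided property shared by [u] and by its reflected negative, so that a single comparison
    argument serves for both bounds. *)
Definition quadratic_subsolution w := forall o alpha beta Y gamma k,
  0 < o.2 < 1 ->
  (\forall p \near o, w p <= w o + qpoly o 0 alpha beta Y gamma k p) ->
  0 <= alpha + Fquad Y beta.

Lemma subsolution_quadratic u : subsolution q u -> quadratic_subsolution u.
Proof.
move=> [_ H] o alpha beta Y gamma k o01 touch.
have := H _ (qpoly_smooth o 0 alpha beta Y gamma k) o o01.
rewrite dt_qpoly hessian_qpoly grad_qpoly F_sym_matrix; apply.
apply: filterS touch => p; rewrite qpoly_at_center; lra.
Qed.

(** Negating [u] alone would reverse its monotonicity along [ones]. Reflecting space as well
    preserves the gradient and negates only the Hessian and the time derivative. *)
Definition reflect_space p : E := (- p.1, p.2).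

Lemma near_reflect_space (P : E -> Prop) o :
  (\forall p \near o, P p) -> \forall p \near reflect_space o, P (reflect_space p).
Proof.
move=> /nbhs_near_norm[e e0 H]; apply: (near_norm_nbhs e0) => z ze.
have -> : reflect_space (reflect_space o + z) = o + reflect_space z.
  by apply/eqP; rewrite xpair_eqE /= opprD opprK !eqxx.
apply: H; move: ze; rewrite !prod_normE /=.
by rewrite normrN.
Qed.

Lemma supersolution_quadratic u : supersolution q u ->
  quadratic_subsolution (fun p => - u (reflect_space p)).
Proof.
move=> [_ H] o alpha beta Y gamma k o01 touch.
have := H _ (qpoly_smooth (reflect_space o) 0 (- alpha) beta (fun i j => - Y i j) gamma (- k))
  (reflect_space o) o01.
rewrite dt_qpoly hessian_qpoly grad_qpoly F_sym_matrix.
have -> : Fquad (fun i j => - Y i j) beta = - Fquad Y beta.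
  rewrite /Fquad; case: eqP => _; first by rewrite oppr0.
  rewrite -mulrN -sumrN; congr (_ * _); apply: eq_bigr => m _.
  rewrite /quad -sumrN; apply: eq_bigr => i _; rewrite -sumrN.
  by apply: eq_bigr => j _; rewrite mulrN.
rewrite -opprD oppr_le0; apply.
apply: filterS (near_reflect_space touch) => p.
rewrite qpoly_at_center.
have -> : qpoly o 0 alpha beta Y gamma k (reflect_space p)
  = - qpoly (reflect_space o) 0 (- alpha) beta (fun i j => - Y i j) gamma (- k) p.
  rewrite /qpoly /=.
  have -> : - p.1 - o.1 = - (p.1 + o.1) by rewrite opprD.
  have -> : p.1 - - o.1 = p.1 + o.1 by rewrite opprK.
  set y := p.1 + o.1.
  have lin (b : 'rV[R]_n) : \sum_i b 0 i * (- y) 0 i = - \sum_i b 0 i * y 0 i.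
    by rewrite -sumrN; apply: eq_bigr => i _; rewrite mxE mulrN.
  have -> : quad (fun i j => - Y i j) y = - quad Y y.
    rewrite /quad -sumrN; apply: eq_bigr => i _; rewrite -sumrN.
    by apply: eq_bigr => j _; rewrite mulrN.
  rewrite !lin -(scaleN1r y) quadZ; ring.
have -> : reflect_space (reflect_space p) = p.
  by case: p => x t; rewrite /reflect_space /= opprK.
lra.
Qed.

End Touching.

(** * Comparison on a time strip *)

Section StripComparison.
Context (R : realType) (n d : nat) (q : history d -> 'rV[R]_n).
Hypotheses (n_gt0 : (0 < n)%N) (q_le1 : forall m, `|q m| <= 1).
Local Notation E := ('rV[R]_n * R)%type.
Implicit Types (p o : E) (x y : 'rV[R]_n) (Y Z : 'I_n -> 'I_n -> R) (s t : R).

Lemma continuous_of_lip (U : normedModType R) (f : U -> R) (L : R) :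
  (forall x y : U, `|f (x + y) - f x| <= L * `|y|) -> continuous f.
Proof.
move=> h x; apply/cvgrPdist_lt => e e0.
have L0 : 0 < `|L| + 1 by rewrite ltr_wpDl.
have r0 : 0 < e / (`|L| + 1) by rewrite divr_gt0.
apply: (near_norm_nbhs r0) => z ze; rewrite distrC; apply: le_lt_trans (h x z) _.
apply: (@le_lt_trans _ _ ((`|L| + 1) * `|z|)).
  by rewrite ler_wpM2r //; have := ler_norm L; lra.
by rewrite mulrC -ltr_pdivlMr.
Qed.

Lemma lipb_continuous (f : 'rV[R]_n -> R) L : lipb L f -> continuous f.
Proof. exact: continuous_of_lip. Qed.

Lemma c11_coef_bound M (f : 'rV[R]_n -> R) (Df : 'I_n -> 'rV[R]_n -> R) L i x :
  lipb L f -> c11 M f Df -> `|Df i x| <= L.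
Proof.
move=> hL [h _]; apply: (@le_of_geometric_error _ _ _ `|M|) => k.
set s := (2 ^+ k)^-1.
have s0 : 0 < s by rewrite invr_gt0 exprn_gt0.
have := h x (s *: unit_vec R i).
have -> : \sum_k0 (s *: unit_vec R i) 0 k0 * Df k0 x = s * Df i x.
  rewrite (bigD1 i) //= big1 ?addr0 => [|j ji]; first by rewrite !mxE !eqxx mulr1.
  by rewrite !mxE (negbTE ji) mulr0 mul0r.
move=> h1; have h2 := lipb_unit s i x hL; rewrite (gtr0_norm s0) in h2.
have h3 : M * `|s *: unit_vec R i| ^+ 2 <= `|M| * s ^+ 2.
  apply: (@le_trans _ _ (`|M| * `|s *: unit_vec R i| ^+ 2)).
    by rewrite ler_wpM2r ?sqr_ge0 // ler_norm.
  rewrite ler_wpM2l // ler_sqr ?nnegrE ?(ltW s0) //.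
  by have := norm_unit_vec s i; rewrite (gtr0_norm s0).
have : s * `|Df i x| <= s * (L + `|M| * s).
  rewrite -(gtr0_norm s0) -normrM (gtr0_norm s0).
  have -> : s * (L + `|M| * s) = L * s + `|M| * s ^+ 2 by ring.
  move: h1 h2; rewrite !ler_norml => /andP[? ?] /andP[? ?].
  by apply/andP; split; lra.
by rewrite ler_pM2l.
Qed.

(* Monotonicity along [ones] keeps the gradient of a touching polynomial away
   from the singular set of [F]. *)
Lemma touching_gradient (w : E -> R) (theta : R) o alpha beta Y gamma k :
  increasing_along_ones theta w -> 0 < o.2 < 1 ->
  (\forall p \near o, w p <= w o + qpoly o 0 alpha beta Y gamma k p) ->
  theta <= dot beta (ones R n).
Proof.
move=> inc /andP[t_gt0 t_lt1] /nbhs_near_norm[e e0 H].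
apply: (@le_of_geometric_error _ _ _ (e / 2 * (quad Y (ones R n) / 2))) => i.
set s := e / 2 / 2 ^+ i.
have s0 : 0 < s by rewrite !divr_gt0 ?exprn_gt0.
have se : s < e.
  apply: (@le_lt_trans _ _ (e / 2)); last by lra.
  by rewrite ler_pdivrMr ?exprn_gt0 // ler_peMr ?exprn_ege1 ?ler1n //; lra.
have ns : `|s *: ones R n| <= s.
  by rewrite normrZ (gtr0_norm s0) ler_piMr ?(ltW s0) // norm_ones.
have h2 : w (o + (s *: ones R n, 0))
    <= w o + qpoly o 0 alpha beta Y gamma k (o + (s *: ones R n, 0)).
  by apply: H; rewrite prod_normE /= normr0 gt_max e0 andbT (le_lt_trans ns).
have h1 := inc o.1 o.2 s (introT andP (conj (ltW t_gt0) (ltW t_lt1))) (ltW s0).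
rewrite -surjective_pairing in h1.
have e1 : (o.1 + s *: ones R n, o.2) = o + (s *: ones R n, 0).
  by apply/eqP; rewrite xpair_eqE /= addr0 !eqxx.
rewrite e1 in h1; have := le_trans h1 h2.
rewrite /qpoly /= addr0 subrr mul0r expr0n mulr0 !addr0 !mulr0 !addr0 add0r.
have -> : o.1 + s *: ones R n - o.1 = s *: ones R n by rewrite addrAC subrr add0r.
rewrite quadZ -/(dot _ _) dotC dotZ dotC lerD2l => h3.
have : s * theta <= s * (dot beta (ones R n) + s * (quad Y (ones R n) / 2)) by lra.
rewrite ler_pM2l // => /le_trans; apply; rewrite lerD2l /s.
by rewrite [leRHS]mulrAC.
Qed.

(** As [Z] annihilates [ones], [xi] may be replaced by [q] in its part. In the isotropic part, the
    lower bound on the component of [beta] along [ones] gives [|xi| <= 1 + n K / theta]. *)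
Lemma Fquad_le_diffusion Y Z beta (c theta K : R) : 0 < theta -> 0 <= c ->
  theta <= dot beta (ones R n) -> `|beta| <= K ->
  (forall y s, quad Z (y + s *: ones R n) = quad Z y) ->
  (forall y, quad Y y = quad Z y + 2 * c * dot y y) ->
  Fquad q Y beta <= diffusion q Z + c * (n%:R * (1 + n%:R * K / theta) ^+ 2).
Proof.
move=> th0 c0 hb hK hZ hY.
have b0 : 0 < dot beta (ones R n) := lt_le_trans th0 hb.
rewrite /Fquad gt_eqF //.
set B := n%:R * _ ^+ 2.
have K0 : 0 <= K by apply: le_trans hK.
have hm m : quad Y (xi q beta m) <= quad Z (q m) + 2 * c * B.
  rewrite hY /xi -scaleNr hZ lerD2l ler_wpM2l ?mulr_ge0 //.
  set v := _ + _; apply: le_trans (ler_norm _) (le_trans (dot_le v v) _).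
  rewrite -expr2 ler_wpM2l // ler_sqr ?nnegrE //; last first.
    by rewrite addr_ge0 // divr_ge0 ?mulr_ge0 // ltW.
  apply: le_trans (ler_normD _ _) _; apply: lerD; first exact: q_le1.
  rewrite normrZ normrN normrM normfV (gtr0_norm b0).
  apply: (@le_trans _ _ (`|dot beta (q m)| / dot beta (ones R n))).
    by rewrite ler_piMr ?norm_ones // divr_ge0 // ltW.
  rewrite ler_pM ?invr_ge0 // ?(ltW b0) //; last by rewrite lef_pV2 ?posrE.
  apply: le_trans (dot_le _ _) _; rewrite ler_wpM2l //.
  by rewrite -[K]mulr1 ler_pM.
have -> : diffusion q Z + c * B
    = (2 ^+ d.+1)^-1 * \sum_m (quad Z (q m) + 2 * c * B).
  have := diffusionE q Z; have := mean_hist_cst d (2 * c * B).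
  rewrite /mean_hist big_split /= mulrDr -/(diffusion q Z) exprS => h1 _.
  by rewrite invfM -[X in _ = _ + X]mulrA h1; field.
by rewrite ler_wpM2l ?invr_ge0 ?exprn_ge0 // ler_sum.
Qed.

Lemma le_shift_penalty (w1 w2 P1 P2 Q : R) :
  w1 - P1 <= w2 - P2 -> P1 <= P2 + Q -> w1 <= w2 + Q.
Proof. by move=> ? ?; lra. Qed.

(** The arithmetic of [penalized_touching]: the polynomial has [2 * kappa * dyy] where the penalty
    has [kappa * dyy], and this surplus pays for the two Taylor remainders [T3] and the mixed one
    [r1]. *)
Lemma penalized_increment_le (c s dA dB A0 B0 PA PB QA QB T3 r1 y2 dxy dyy kappa kt2 kt inv : R) :
  dA - A0 - PA - QA / 2 <= T3 -> c * (dB - B0 - PB - QB / 2) <= T3 ->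
  - (s * (dB - B0 - PB)) <= r1 -> inv <= - kt2 * s + kt * s ^+ 2 ->
  2 * T3 + r1 <= kappa * y2 -> kappa * y2 <= kappa * dyy ->
  dA + (c - s) * dB + kappa * (2 * dxy + dyy) + inv
  <= A0 + c * B0 + ((- B0 - kt2) * s + (PA + c * PB + 2 * kappa * dxy)
     + (QA + c * QB + 2 * (2 * kappa) * dyy) / 2 + s * - PB + kt * s ^+ 2).
Proof. by move=> h1 h2 h3 h4 h5 h6; lra. Qed.

(** The exact quadratic coefficient is [kappa / (tau ^ 2 (tau + s))], and [tau + s > tau / 2]
    accounts for the factor 2. *)
Lemma inverse_increment_le (kappa tau s : R) : 0 <= kappa -> 0 < tau ->
  - (tau / 2) < s ->
  kappa / (tau + s) - kappa / tau
  <= - (kappa / tau ^+ 2) * s + 2 * kappa / tau ^+ 3 * s ^+ 2.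
Proof.
move=> k0 tau0 ts; have ts0 : 0 < tau + s by lra.
have -> : kappa / (tau + s) - kappa / tau
   = - (kappa / tau ^+ 2) * s + kappa / (tau ^+ 2 * (tau + s)) * s ^+ 2.
  by field; rewrite !gt_eqF.
rewrite lerD2l ler_wpM2r ?sqr_ge0 //.
have -> : 2 * kappa / tau ^+ 3 = kappa / (tau ^+ 2 * (tau / 2)).
  by field; rewrite gt_eqF.
rewrite ler_wpM2l // lef_pV2 ?posrE ?mulr_gt0 ?exprn_gt0 ?divr_gt0 //.
by rewrite ler_wpM2l ?exprn_ge0 ?(ltW tau0) //; lra.
Qed.

Lemma quadD_diag Y Z (c : R) y :
  (forall i j, Y i j = Z i j + c * (i == j)%:R) -> quad Y y = quad Z y + c * dot y y.
Proof.
move=> hY; rewrite /quad /dot mulr_sumr -big_split; apply: eq_bigr => i _ /=.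
have -> : c * (y 0 i * y 0 i) = \sum_j y 0 i * y 0 j * (c * (i == j)%:R).
  rewrite (bigD1 i) //= big1 ?addr0 => [|j ji]; first by rewrite eqxx mulr1 mulrC.
  by rewrite eq_sym (negbTE ji) !mulr0.
by rewrite -big_split; apply: eq_bigr => j _ /=; rewrite hY mulrDr.
Qed.

(** The penalized competitor is not itself an admissible test function, so it is bounded above by a
    quadratic polynomial with the same first-order data. Doubling the Hessian of the penalty absorbs
    all remainders near the point. *)
Lemma penalized_touching (A B : 'rV[R]_n -> R) (pA pB : 'I_n -> 'rV[R]_n -> R)
    (XA XB : 'I_n -> 'I_n -> 'rV[R]_n -> R) (T kappa a b t0 : R) (x0 : 'rV[R]_n) :
  0 <= T -> taylor2 T A pA XA -> taylor2 T B pB XB -> 0 < kappa ->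
  a < t0 -> 0 <= b - t0 <= 1 ->
  let tau := t0 - a in
  let beta : 'rV[R]_n := \row_i (pA i x0 + (b - t0) * pB i x0 + 2 * kappa * x0 0 i) in
  let Y i j := 1 * XA i j x0 + (b - t0) * XB i j x0 + 2 * (2 * kappa) * (i == j)%:R in
  let pen x t := A x + (b - t) * B x + kappa * dot x x + kappa / (t - a) in
  exists2 r : R, 0 < r & forall y s, `|y| < r -> `|s| < r ->
    pen (x0 + y) (t0 + s) <= pen x0 t0
      + qpoly (x0, t0) 0 (- B x0 - kappa / tau ^+ 2) beta Y (\row_i (- pB i x0))
          (2 * kappa / tau ^+ 3) (x0 + y, t0 + s).
Proof.
move=> T0 A_taylor B_taylor k0 at0 /andP[c0 c1] tau beta Y pen.
have tau0 : 0 < tau by rewrite subr_gt0.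
pose cB := \sum_i \sum_j `|XB i j x0|.
have cB_le i j : `|XB i j x0| <= cB.
  rewrite /cB (bigD1 i) //= (bigD1 j) //= -addrA lerDl addr_ge0 ?sumr_ge0 // => k _.
  by rewrite sumr_ge0.
have cB0 : 0 <= n%:R ^+ 2 * cB.
  by rewrite mulr_ge0 ?sqr_ge0 // sumr_ge0 // => i _; rewrite sumr_ge0.
(* Chosen so that [|y|, |s| < kappa / D] forces [2 T |y| + (n^2 cB + T) |s| <= kappa]. *)
pose D : R := 3 * T + n%:R ^+ 2 * cB + 1.
have D0 : 0 < D by rewrite ltr_wpDl // addr_ge0 // mulr_ge0.
have kD : 0 < kappa / D by rewrite divr_gt0.
have t20 : 0 < tau / 2 by rewrite divr_gt0.
exists (Num.min (tau / 2) (Num.min 1 (kappa / D))).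
  by rewrite !lt_min t20 ltr01.
move=> y s; rewrite !lt_min => /andP[_ /andP[y2 y3]] /andP[u3 /andP[_ u4]].
have /andP[v5 _] : - (tau / 2) < s < tau / 2 by rewrite -ltr_norml.
have hinv := inverse_increment_le (ltW k0) tau0 v5.
have dotE : dot (x0 + y) (x0 + y) = dot x0 x0 + (2 * dot x0 y + dot y y).
  by rewrite dotD dotC dotD [dot y (x0 + y)]dotC dotD [dot y x0]dotC; ring.
have hA := A_taylor x0 y; have hB := B_taylor x0 y.
rewrite /pen /qpoly /= -/(dot _ _) dotE.
have -> : t0 + s - a = tau + s by rewrite /tau; ring.
have -> : x0 + y - x0 = y by rewrite addrAC subrr add0r.
have -> : t0 + s - t0 = s by ring.
have -> : b - (t0 + s) = (b - t0) - s by ring.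
have -> : t0 - a = tau by [].
have -> : \sum_i (\row_i (- pB i x0) : 'rV[R]_n) 0 i * y 0 i = - \sum_i y 0 i * pB i x0.
  by rewrite -sumrN; apply: eq_bigr => i _; rewrite mxE mulNr mulrC.
have -> : dot beta y = \sum_i y 0 i * pA i x0
    + (b - t0) * (\sum_i y 0 i * pB i x0) + 2 * kappa * dot x0 y.
  rewrite /dot !mulr_sumr -!big_split; apply: eq_bigr => i _ /=.
  by rewrite mxE; ring.
have -> : quad Y y = quad (fun i j => XA i j x0) y
    + (b - t0) * quad (fun i j => XB i j x0) y + 2 * (2 * kappa) * dot y y.
  rewrite (@quadD_diag Y (fun i j => 1 * XA i j x0 + (b - t0) * XB i j x0)
    (2 * (2 * kappa))) //.
  by rewrite quad_lin mul1r.
move: hA hB hinv.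
set PA := \sum_i y 0 i * pA i x0; set PB := \sum_i y 0 i * pB i x0.
set QA := quad (fun i j => XA i j x0) y; set QB := quad (fun i j => XB i j x0) y.
set dA := A (x0 + y); set dB := B (x0 + y) => hA hB hinv.
have y0 := normr_ge0 y.
have DE : D * `|y| <= kappa by rewrite mulrC -ler_pdivlMr // ltW.
have DE' : D * `|s| <= kappa by rewrite mulrC -ler_pdivlMr // ltW.
have ey2 : 0 <= `|y| ^+ 2 := sqr_ge0 _.
have cub : T * `|y| ^+ 3 = T * `|y| * `|y| ^+ 2 by ring.
have cub' : T * `|y| ^+ 3 <= T * `|y| ^+ 2.
  by rewrite cub -mulrA ler_wpM2l // ler_piMl // ltW.
have hQB : `|QB / 2| <= n%:R ^+ 2 * cB * `|y| ^+ 2.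
  apply: (@le_trans _ _ `|QB|).
    rewrite normrM (ger0_norm (x := 2^-1)) ?invr_ge0 //.
    by rewrite ler_piMr // invf_le1 // ler1n.
  apply: le_trans (quad_bound _ cB_le) _.
  by rewrite mulrA mulrAC.
have hdB : `|dB - B x0 - PB| <= (n%:R ^+ 2 * cB + T) * `|y| ^+ 2.
  have h7 := ler_normD (dB - B x0 - PB - QB / 2) (QB / 2); rewrite subrK in h7.
  apply: le_trans h7 _; rewrite mulrDl addrC lerD //.
  exact: le_trans hB cub'.
have hs : - (s * (dB - B x0 - PB)) <= `|s| * (n%:R ^+ 2 * cB + T) * `|y| ^+ 2.
  apply: le_trans (ler_norm _) _; rewrite normrN normrM -mulrA.
  by rewrite ler_wpM2l.
have hbt : (b - t0) * (dB - B x0 - PB - QB / 2) <= T * `|y| ^+ 3.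
  apply: le_trans (ler_norm _) _; apply: le_trans hB; rewrite normrM ler_piMl //.
  by rewrite ger0_norm.
have hrem : 2 * (T * `|y| ^+ 3) + `|s| * (n%:R ^+ 2 * cB + T) * `|y| ^+ 2
    <= kappa * `|y| ^+ 2.
  have -> : 2 * (T * `|y| ^+ 3) + `|s| * (n%:R ^+ 2 * cB + T) * `|y| ^+ 2
     = (2 * T * `|y| + (n%:R ^+ 2 * cB + T) * `|s|) * `|y| ^+ 2 by ring.
  rewrite ler_wpM2r //.
  have i1 : 2 * T * `|y| * D <= 2 * T * kappa.
    by rewrite -mulrA [`|y| * D]mulrC ler_wpM2l // mulr_ge0.
  have i2 : (n%:R ^+ 2 * cB + T) * `|s| * D <= (n%:R ^+ 2 * cB + T) * kappa.
    by rewrite -mulrA [`|s| * D]mulrC ler_wpM2l // addr_ge0.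
  rewrite -(ler_pM2r D0) mulrDl.
  apply: le_trans (lerD i1 i2) _; rewrite -mulrDl mulrC ler_wpM2l ?(ltW k0) //.
  by rewrite /D; lra.
have hkd : kappa * `|y| ^+ 2 <= kappa * dot y y.
  by rewrite ler_wpM2l ?(ltW k0) // norm_sqr_le_dot.
have hA' := le_trans (ler_norm _) hA.
have := penalized_increment_le (dot x0 y) hA' hbt hs hinv hrem hkd.
set u1 := kappa / (tau + s); set u2 := kappa / tau; set u3' := kappa / tau ^+ 2.
set u4' := 2 * kappa / tau ^+ 3; clear => H.
rewrite add0r [kappa * (_ + (_ + _))]mulrDr.
lra.
Qed.

Context (w : E -> R) (theta C : R).
Hypotheses (theta_gt0 : 0 < theta) (C_ge0 : 0 <= C).
Hypotheses (w_sub : quadratic_subsolution q w)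
  (w_cont : {within @slab R n, continuous w})
  (w_growth : forall x t, 0 <= t <= 1 -> w (x, t) <= C * (1 + `|x|))
  (w_inc : increasing_along_ones theta w).

Context (A B : 'rV[R]_n -> R) (pA pB : 'I_n -> 'rV[R]_n -> R)
  (XA XB : 'I_n -> 'I_n -> 'rV[R]_n -> R) (T L P : R).
Hypotheses (T_ge0 : 0 <= T) (A_taylor : taylor2 T A pA XA) (B_taylor : taylor2 T B pB XB)
  (A_lip : lipb L A) (B_lip : lipb L B)
  (pA_le : forall i x, `|pA i x| <= P) (pB_le : forall i x, `|pB i x| <= P)
  (A_ones : forall x s, A (x + s *: ones R n) = A x + s)
  (B_ones : forall x s, B (x + s *: ones R n) = B x).

Context (a b e : R).
Hypotheses (a_ge0 : 0 <= a) (a_lt_b : a < b) (b_le1 : b <= 1) (e_gt0 : 0 < e).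
Hypothesis strict_super : forall x t, a <= t <= b ->
  - B x + diffusion q (fun i j => XA i j x) + (b - t) * diffusion q (fun i j => XB i j x)
  <= - e.
Hypothesis w_final : forall x, w (x, b) <= A x.

Let phi p : R := A p.1 + (b - p.2) * B p.1.
Let C0 : R := C + `|A 0| + `|B 0| + 2 * L.

Lemma gap_growth x t : a <= t <= b -> w (x, t) - phi (x, t) <= C0 * (1 + `|x|).
Proof.
move: (a_ge0) (a_lt_b) (b_le1) (e_gt0) => ha0 hab hb1 he0.
move=> /andP[at0 tb].
have t01 : 0 <= t <= 1 by apply/andP; split; lra.
have := w_growth x t01; rewrite /phi /=.
have h1 := A_lip 0 x; have h2 := B_lip 0 x; rewrite !add0r in h1 h2.
have h3 : `|(b - t) * B x| <= `|B x|.
  rewrite normrM ler_piMl // ger0_norm; lra.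
have h4 : `|B x| <= `|B 0| + L * `|x|.
  by have := ler_normD (B x - B 0) (B 0); rewrite subrK; lra.
have L0 : 0 <= L := lipb_ge0 (Ordinal n_gt0) A_lip.
have x0 := normr_ge0 x; have c0 := normr_ge0 (A 0); have c1 := normr_ge0 (B 0).
have l1 : 0 <= L * `|x| by rewrite mulr_ge0.
have l2 : 0 <= `|A 0| * `|x| by rewrite mulr_ge0.
have l3 : 0 <= `|B 0| * `|x| by rewrite mulr_ge0.
have a1 : - A 0 <= `|A 0| by rewrite -normrN ler_norm.
move: h1 h3; rewrite !ler_norml /C0 => /andP[? ?] /andP[? ?] ?.
have -> : (C + `|A 0| + `|B 0| + 2 * L) * (1 + `|x|)
  = C * (1 + `|x|) + `|A 0| + `|B 0| + 2 * L + `|A 0| * `|x| + `|B 0| * `|x|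
    + 2 * (L * `|x|) by ring.
lra.
Qed.

Lemma C0_ge0 : 0 <= C0.
Proof.
have L0 : 0 <= L := lipb_ge0 (Ordinal n_gt0) A_lip.
by rewrite /C0 !addr_ge0 // mulr_ge0.
Qed.

(** The quadratic penalty forces a maximum to be attained, and [kappa / (t - a)] keeps it away from
    the early end of the strip. *)
Let Psi (kappa : R) p : R :=
  w p - (phi p + kappa * dot p.1 p.1 + kappa / (p.2 - a)).

(** Where [Psi] is positive, the linear growth of the gap bounds both penalties; at [t = b] the
    final inequality makes [Psi] negative. *)
Lemma Psi_gt0 (kappa : R) x t : 0 < kappa -> a < t <= b -> 0 < Psi kappa (x, t) ->
  [/\ kappa * `|x| ^+ 2 < C0 * (1 + `|x|),
      kappa / (t - a) < C0 + C0 ^+ 2 / (4 * kappa) & t < b].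
Proof.
move: (a_ge0) (a_lt_b) (b_le1) (e_gt0) => ha0 hab hb1 he0.
move=> k0 /andP[at0 tb]; rewrite /Psi /= => H.
have ta : 0 < t - a by lra.
have kt : 0 < kappa / (t - a) by rewrite divr_gt0.
have hd : kappa * `|x| ^+ 2 <= kappa * dot x x.
  by rewrite ler_wpM2l ?(ltW k0) // norm_sqr_le_dot.
have hd0 : 0 <= kappa * `|x| ^+ 2 by rewrite mulr_ge0 ?sqr_ge0 // ltW.
have h1 := @gap_growth x t; rewrite (ltW at0) tb in h1; have {}h1 := h1 isT.
split.
- lra.
(* The maximum of the quadratic function of [|x|], by completing the square. *)
- have : C0 * `|x| - kappa * `|x| ^+ 2 <= C0 ^+ 2 / (4 * kappa).
    rewrite ler_pdivlMr ?mulr_gt0 // -subr_ge0.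
    have -> : C0 ^+ 2 - (C0 * `|x| - kappa * `|x| ^+ 2) * (4 * kappa)
       = (C0 - 2 * kappa * `|x|) ^+ 2 by ring.
    exact: sqr_ge0.
  lra.
- rewrite lt_neqAle tb andbT; apply/eqP => tb'; subst t.
  have := w_final x; rewrite /phi /= subrr mul0r addr0 in H *; lra.
Qed.

Lemma Psi_continuous (kappa eta rho : R) : 0 < eta ->
  {within [set p : E | `|p.1| <= rho /\ a + eta <= p.2 <= b], continuous (Psi kappa)}.
Proof.
move: (a_ge0) (a_lt_b) (b_le1) (e_gt0) => ha0 hab hb1 he0.
move=> eta0; apply/subspace_continuousP => p [pr /andP[pa pb]].
apply: cvgB.
  have sub : [set p : E | `|p.1| <= rho /\ a + eta <= p.2 <= b] `<=` @slab R n.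
    move=> p' [_ /andP[h1 h2]]; rewrite /slab /=; apply/andP; split; lra.
  have := continuous_subspaceW sub w_cont => /subspace_continuousP; apply.
  by split => //; apply/andP.
have cA (f : 'rV[R]_n -> R) : lipb L f -> f p'.1 @[p' --> nbhs p] --> f p.1.
  move=> /lipb_continuous hf; apply: (@continuous_comp E 'rV[R]_n R fst f p).
    exact: cvg_fst.
  exact: hf.
have ct : p'.2 @[p' --> nbhs p] --> p.2 by exact: cvg_snd.
have cd : dot p'.1 p'.1 @[p' --> nbhs p] --> dot p.1 p.1.
  have := @continuous_sum R E _ (index_enum 'I_n) (fun i (p' : E) => p'.1 0 i * p'.1 0 i).
  apply=> i p'; apply: continuousM; exact: continuous_coord.
have cc (c : R) : c @[p' --> nbhs p] --> c by exact: cvg_cst.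
have H : phi p' + kappa * dot p'.1 p'.1 + kappa / (p'.2 - a) @[p' --> nbhs p]
    --> phi p + kappa * dot p.1 p.1 + kappa / (p.2 - a).
  apply: cvgD.
    apply: cvgD.
      apply: cvgD; first exact: cA.
      by apply: cvgM; [apply: cvgB|exact: cA].
    exact: cvgM.
  apply: cvgM => //; apply: cvgV; last by apply: cvgB.
  by rewrite subr_eq0; apply/eqP => pe; lra.
apply: cvg_trans H; apply: cvg_app; exact: cvg_within.
Qed.

(** The constant of [Fquad_le_diffusion] for the gradient at a maximum. It is independent of
    [kappa], since [kappa * |x0|] stays bounded there; hence the penalty's contribution tends to 0
    with [kappa]. *)
Let Xi : R := n%:R * (1 + n%:R * (2 * P + 2 * (2 * C0 + 1)) / theta) ^+ 2.

(** At such a maximum the polynomial of [penalized_touching] touches [w] from above. The viscosity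
    inequality and the strictness of the competitor then give [e <= 2 * kappa * Xi]. *)
Lemma no_interior_max (kappa t0 : R) (x0 : 'rV[R]_n) : 0 < kappa -> a < t0 < b ->
  kappa * `|x0| <= 2 * C0 + 1 -> 2 * kappa * Xi < e ->
  ~ (\forall p \near (x0, t0), Psi kappa p <= Psi kappa (x0, t0)).
Proof.
move=> k0 /andP[at0 t0b] hx0 hXi hmax.
have c0 : 0 <= b - t0 by rewrite subr_ge0 ltW.
have c1 : b - t0 <= 1 by rewrite lerBlDr (le_trans b_le1) // lerDl (le_trans a_ge0) // ltW.
have o01 : 0 < (x0, t0).2 < 1.
  by rewrite /= (le_lt_trans a_ge0 at0) (lt_le_trans t0b b_le1).
pose beta : 'rV[R]_n := \row_i (pA i x0 + (b - t0) * pB i x0 + 2 * kappa * x0 0 i).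
pose Z i j := 1 * XA i j x0 + (b - t0) * XB i j x0.
pose Y i j := Z i j + 2 * (2 * kappa) * (i == j)%:R.
have quadY y : quad Y y = quad Z y + 2 * (2 * kappa) * dot y y by apply: quadD_diag.
have quadZE y : quad Z y = quad (fun i j => XA i j x0) y
    + (b - t0) * quad (fun i j => XB i j x0) y by rewrite quad_lin mul1r.
have touch : \forall p \near (x0, t0), w p <= w (x0, t0)
    + qpoly (x0, t0) 0 (- B x0 - kappa / (t0 - a) ^+ 2) beta Y (\row_i (- pB i x0))
        (2 * kappa / (t0 - a) ^+ 3) p.
  have c01 : 0 <= b - t0 <= 1 by rewrite c0 c1.
  have [r r0 Hr] := penalized_touching x0 T_ge0 A_taylor B_taylor k0 at0 c01.
  pose pen (p : E) := phi p + kappa * dot p.1 p.1 + kappa / (p.2 - a).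
  have Hn : \forall p \near (x0, t0), pen p <= pen (x0, t0)
      + qpoly (x0, t0) 0 (- B x0 - kappa / (t0 - a) ^+ 2) beta Y (\row_i (- pB i x0))
        (2 * kappa / (t0 - a) ^+ 3) p.
    apply: (near_norm_nbhs r0) => -[y s]; rewrite prod_normE /= gt_max => /andP[yr sr].
    exact: Hr.
  by apply: filterS2 hmax Hn => p; exact: le_shift_penalty.
have thb := touching_gradient w_inc o01 touch.
have invA := (taylor2_invariance (v := ones R n) (c := 1) x0 A_taylor _).
have invB := (taylor2_invariance (v := ones R n) (c := 0) x0 B_taylor _).
have {invA} [|_ invA] := invA; first by move=> z s; rewrite A_ones mulr1.
have {invB} [|_ invB] := invB; first by move=> z s; rewrite B_ones mulr0 addr0.
have hZ y s : quad Z (y + s *: ones R n) = quad Z y by rewrite !quadZE invA invB.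
have P0 : 0 <= P := le_trans (normr_ge0 _) (pA_le (Ordinal n_gt0) 0).
have hbeta : `|beta| <= 2 * P + 2 * (2 * C0 + 1).
  apply: norm_le_coord => [|i].
    by have := C0_ge0 => C00; rewrite addr_ge0 ?mulr_ge0 ?addr_ge0 ?mulr_ge0.
  rewrite mxE; apply: le_trans (ler_normD _ _) _; apply: lerD.
    rewrite mulr_natl mulr2n; apply: le_trans (ler_normD _ _) (lerD (pA_le i x0) _).
    by apply: le_trans (pB_le i x0); rewrite normrM ler_piMl // ger0_norm.
  rewrite normrM (ger0_norm (x := 2 * kappa)) ?mulr_ge0 ?(ltW k0) // -mulrA ler_wpM2l //.
  by apply: le_trans hx0; rewrite ler_wpM2l ?(ltW k0) // norm_coord.
have k20 : 0 <= 2 * kappa by rewrite mulr_ge0 // ltW.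
have hF := Fquad_le_diffusion theta_gt0 k20 thb hbeta hZ quadY.
have hsub := w_sub o01 touch.
have hdiff : diffusion q Z = diffusion q (fun i j => XA i j x0)
    + (b - t0) * diffusion q (fun i j => XB i j x0).
  by rewrite diffusion_lin mul1r.
have hs := @strict_super x0 t0; rewrite (ltW at0) (ltW t0b) in hs.
have {}hs := hs isT.
have hk : 0 <= kappa / (t0 - a) ^+ 2 by rewrite divr_ge0 ?sqr_ge0 // ltW.
rewrite hdiff -/Xi in hF.
move: hF hsub hs hk hXi; set FY := Fquad _ _ _; set dA := diffusion _ _.
set dB := (b - t0) * _; set kt := kappa / _; set kX := _ * Xi.
by lra.
Qed.

Lemma strip_comparison_interior x t : a < t <= b -> w (x, t) <= A x + (b - t) * B x.
Proof.
move: (a_ge0) (a_lt_b) (b_le1) (e_gt0) => ha0 hab hb1 he0.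
move=> /andP[at1 tb1]; rewrite leNgt; apply/negP => gap.
have n0 : 0 <= n%:R :> R by [].
set g1 := w (x, t) - (A x + (b - t) * B x).
have g10 : 0 < g1 by rewrite subr_gt0.
pose S1 := dot x x + 1 / (t - a).
have S10 : 0 <= S1 by rewrite addr_ge0 ?dot_ge0 // divr_ge0 // subr_ge0 ltW.
pose Kx := 2 * C0 + 1.
have Xi0 : 0 <= Xi by rewrite mulr_ge0 // sqr_ge0.
(* The second entry keeps [Psi] positive at the point [(x, t)] of the supposed gap, and the third
   contradicts the strictness [e] at a maximum. *)
pose kappa := Num.min 1 (Num.min (g1 / (2 * (S1 + 1))) (e / (4 * (Xi + 1)))).
have S11 : 0 < 2 * (S1 + 1) by rewrite mulr_gt0 // ltr_wpDl.
have Xi1 : 0 < 4 * (Xi + 1) by rewrite mulr_gt0 // ltr_wpDl.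
have k0 : 0 < kappa by rewrite !lt_min ltr01 !divr_gt0.
have k1 : kappa <= 1 by rewrite ge_min lexx.
have k2 : kappa * (2 * (S1 + 1)) <= g1.
  by rewrite -ler_pdivlMr // !ge_min lexx orbT.
have k3 : kappa * (4 * (Xi + 1)) <= e.
  by rewrite -ler_pdivlMr // !ge_min lexx !orbT.
pose S := C0 + C0 ^+ 2 / (4 * kappa).
have hC0 := C0_ge0.
have S0 : 0 <= S by rewrite (addr_ge0 hC0) // divr_ge0 ?sqr_ge0 // mulr_ge0 // ltW.
pose eta : R := kappa / (S + 1).
have eta0 : 0 < eta by rewrite divr_gt0 // ltr_wpDl.
(* From this radius on, the quadratic penalty exceeds the linear growth of the gap. Positive values
   of [Psi] thus lie strictly inside the box given by [rho], [a + eta] and [b]. *)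
pose rho := 1 + 2 * C0 / kappa.
have out x' t' : a < t' <= b -> 0 < Psi kappa (x', t') ->
    [/\ `|x'| < rho, a + eta < t', t' < b & kappa * `|x'| <= Kx].
  move=> tt Hpos; have [h1 h2 h3] := Psi_gt0 k0 tt Hpos.
  have /andP[at' _] := tt.
  have x'0 := normr_ge0 x'; split => //.
  - rewrite ltNge; apply/negP => hr.
    have : kappa * rho <= kappa * `|x'| by rewrite ler_wpM2l // ltW.
    have -> : kappa * rho = kappa + 2 * C0 by rewrite /rho; field; rewrite gt_eqF.
    move=> h4; have r1 : 1 <= `|x'|.
      by apply: le_trans hr; rewrite /rho lerDl divr_ge0 ?mulr_ge0 // ltW.
    have h5 : (kappa + 2 * C0) * `|x'| <= kappa * `|x'| * `|x'| by rewrite ler_wpM2r.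
    have h6 : C0 <= C0 * `|x'| by rewrite ler_peMr.
    have h7 : 0 <= kappa * `|x'| by rewrite mulr_ge0 // ltW.
    by move: h1; rewrite expr2; lra.
  - rewrite ltNge; apply/negP => hr.
    have ta : 0 < t' - a by lra.
    have : (S + 1) <= kappa / (t' - a).
      rewrite ler_pdivlMr // mulrC -ler_pdivlMr ?ltr_wpDl //.
      by rewrite -/eta; lra.
    by move: h2; rewrite -/S; lra.
  - case: (leP `|x'| 1) => hx1.
      apply: (@le_trans _ _ 1); last by rewrite /Kx; have := C0_ge0; lra.
      by rewrite mulr_ile1 // ltW.
    have : kappa * `|x'| * `|x'| <= (2 * C0) * `|x'|.
      have h6 : C0 <= C0 * `|x'| by rewrite ler_peMr // ltW.
      by move: h1; rewrite expr2; lra.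
    rewrite ler_pM2r ?(lt_trans ltr01) // => h8.
    by rewrite /Kx; lra.
have tt : a < t <= b by rewrite at1 tb1.
have pos1 : 0 < Psi kappa (x, t).
  rewrite /Psi /phi /=.
  have -> : kappa / (t - a) = kappa * (1 / (t - a)) by rewrite mul1r.
  have : kappa * S1 <= kappa * (S1 + 1) by rewrite ler_wpM2l ?(ltW k0) // lerDl.
  have : kappa * (2 * (S1 + 1)) = 2 * (kappa * (S1 + 1)) by ring.
  have : 0 <= kappa * S1 by rewrite mulr_ge0 // ltW.
  have -> : kappa * S1 = kappa * dot x x + kappa * (1 / (t - a)) by rewrite /S1 mulrDr.
  by move: k2; rewrite /g1 => ? ? ? ?; lra.
pose Kset := [set p : E | `|p.1| <= rho /\ a + eta <= p.2 <= b].
have Kcompact : compact Kset.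
  have -> : Kset = [set v : 'rV[R]_n | `|v| <= rho] `*` `[a + eta, b].
    by apply/seteqP; split => -[v r] /=; rewrite in_itv.
  apply: compact_setX; last exact: segment_compact.
  apply: bounded_closed_compact.
    by exists rho; split; [exact: num_real|move=> M hM v /= hv; exact: le_trans hv (ltW hM)].
  rewrite (_ : [set v | _] = (fun v : 'rV[R]_n => `|v|) @^-1` [set r | r <= rho]) //.
  by apply: closed_comp; [move=> v _; exact: norm_continuous|exact: closed_le].
have [r1 r2 r3 _] := out _ _ tt pos1.
have K0 : Kset !=set0.
  by exists (x, t); split => /=; [exact: ltW|rewrite tb1 (ltW r2)].
have [[x0 t0]] := compact_EVT_max K0 Kcompact (Psi_continuous (kappa := kappa) (rho := rho) eta0).
rewrite inE => -[/= hx0 /andP[ht0 ht0b]] hmax.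
have pos0 : 0 < Psi kappa (x0, t0).
  apply: lt_le_trans pos1 (hmax _ _); rewrite inE; split => /=; first exact: ltW.
  by rewrite tb1 (ltW r2).
have tt0 : a < t0 <= b by rewrite ht0b andbT; lra.
have [s1 s2 s3 s4] := out _ _ tt0 pos0.
have k4 : 2 * kappa * Xi < e.
  by apply: lt_le_trans k3; have := mulr_ge0 (ltW k0) Xi0; lra.
have a_t0 : a < t0 by case/andP: tt0.
have at0b : a < t0 < b by rewrite a_t0 s3.
apply: (no_interior_max k0 at0b s4 k4).
(* The maximum over the compact box is a local maximum because a whole ball around it lies in the
   box. *)
pose r := Num.min (rho - `|x0|) (Num.min (t0 - (a + eta)) (b - t0)).
have r0 : 0 < r by rewrite !lt_min !subr_gt0 s1 s2 s3.
apply: (near_norm_nbhs r0) => -[y s]; rewrite prod_normE /= gt_max => /andP[].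
rewrite !lt_min => /andP[y1 _] /andP[_ /andP[u1 u2]]; apply: hmax.
rewrite inE; split => /=.
  by apply: le_trans (ler_normD _ _) _; rewrite -lerBrDl ltW.
have hs := ler_norm s; have hs' := ler_norm (- s); rewrite normrN in hs'.
apply/andP; split.
  rewrite -lerBlDl -lerN2 opprB; apply: le_trans hs' (le_trans (ltW u1) _).
  by rewrite lexx.
by rewrite addrC -lerBrDr; exact: le_trans hs (ltW u2).
Qed.

(** The time penalty excludes [t = a]. Continuity of [w] recovers it, and it must be included
    because the next strip takes its final value there. *)
Lemma strip_comparison x t : a <= t <= b -> w (x, t) <= A x + (b - t) * B x.
Proof.
move: (a_ge0) (a_lt_b) (b_le1) (e_gt0) => ha0 hab hb1 he0.
move=> /andP[]; rewrite le_eqVlt => /orP[/eqP <- _|at0 tb]; last first.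
  by apply: strip_comparison_interior; rewrite at0.
rewrite leNgt; apply/negP => gap.
set g := w (x, a) - (A x + (b - a) * B x).
have g0 : 0 < g by rewrite subr_gt0.
have xa : @slab R n (x, a) by rewrite /slab /=; apply/andP; split; lra.
have /subspace_continuousP/(_ _ xa)/cvgrPdist_lt/(_ (g / 2)) := w_cont.
move=> /(_ _); rewrite divr_gt0 // => /(_ isT); rewrite near_withinE.
move=> /nbhs_near_norm[r r0 H].
pose s := Num.min ((b - a) / 2) (Num.min (r / 2) (g / (2 * (`|B x| + 1)))).
have B0 : 0 < `|B x| + 1 by rewrite ltr_wpDl.
have s0 : 0 < s by rewrite !lt_min !divr_gt0 ?mulr_gt0 ?subr_gt0.
have s1 : s <= (b - a) / 2 by rewrite ge_min lexx.
have s2 : s <= r / 2 by rewrite !ge_min lexx orbT.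
have s3 : s * (2 * (`|B x| + 1)) <= g.
  by rewrite -ler_pdivlMr ?mulr_gt0 // !ge_min lexx !orbT.
have := H (0, s); rewrite prod_normE /= normr0 gt_max r0 (gtr0_norm s0) /=.
have sr : s < r by lra.
have -> : (x, a) + (0, s) = (x, a + s).
  by apply/eqP; rewrite xpair_eqE /= addr0 !eqxx.
move=> /(_ sr) => h.
have {}h : `|w (x, a) - w (x, a + s)| < g / 2.
  by apply: h; rewrite /slab /=; apply/andP; split; lra.
have := @strip_comparison_interior x (a + s).
rewrite (_ : a < a + s <= b); last by apply/andP; split; lra.
move=> /(_ isT) h2.
have h3 : `|s * B x| <= s * `|B x| by rewrite normrM (gtr0_norm s0).
move: h h3; rewrite ltr_norml ler_norml /g => /andP[? ?] /andP[? ?].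
by move: s3; rewrite /g => ?; lra.
Qed.

End StripComparison.

(** * Linear combinations and reflections of competitors *)

Section Combinations.
Context (R : realType) (n : nat).
Implicit Types (f h : 'rV[R]_n -> R) (x y : 'rV[R]_n) (T L s c : R).

Lemma taylor2_comb T1 T2 f h pf ph Xf Xh (a b c : R) :
  taylor2 T1 f pf Xf -> taylor2 T2 h ph Xh ->
  taylor2 (`|a| * T1 + `|b| * T2) (fun x => a * f x + b * h x + c)
    (fun i x => a * pf i x + b * ph i x)
    (fun i j x => a * Xf i j x + b * Xh i j x).
Proof.
move=> hf hh x y; rewrite quad_lin.
have -> : \sum_i y 0 i * (a * pf i x + b * ph i x)
    = a * \sum_i y 0 i * pf i x + b * \sum_i y 0 i * ph i x.
  by rewrite !mulr_sumr -big_split; apply: eq_bigr => i _ /=; ring.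
have h1 : `|a * (f (x + y) - f x - \sum_i y 0 i * pf i x
    - quad (fun i j => Xf i j x) y / 2)| <= `|a| * (T1 * `|y| ^+ 3).
  by rewrite normrM ler_wpM2l.
have h2 : `|b * (h (x + y) - h x - \sum_i y 0 i * ph i x
    - quad (fun i j => Xh i j x) y / 2)| <= `|b| * (T2 * `|y| ^+ 3).
  by rewrite normrM ler_wpM2l.
have := le_trans (ler_normD _ _) (lerD h1 h2).
rewrite mulrDl !mulrA; congr (`|_| <= _); ring.
Qed.

Lemma lipb_comb L1 L2 f h (a b c : R) : lipb L1 f -> lipb L2 h ->
  lipb (`|a| * L1 + `|b| * L2) (fun x => a * f x + b * h x + c).
Proof.
move=> hf hh x y.
have h1 : `|a * (f (x + y) - f x)| <= `|a| * (L1 * `|y|) by rewrite normrM ler_wpM2l.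
have h2 : `|b * (h (x + y) - h x)| <= `|b| * (L2 * `|y|) by rewrite normrM ler_wpM2l.
have := le_trans (ler_normD _ _) (lerD h1 h2).
rewrite mulrDl !mulrA; congr (`|_| <= _); ring.
Qed.

Lemma taylor2_le T T' f p X : T <= T' -> taylor2 T f p X -> taylor2 T' f p X.
Proof.
by move=> TT H x y; apply: le_trans (H x y) _; rewrite ler_wpM2r // exprn_ge0.
Qed.

Lemma lipb_le L L' f : L <= L' -> lipb L f -> lipb L' f.
Proof. by move=> LL H x y; apply: le_trans (H x y) _; rewrite ler_wpM2r. Qed.

Lemma quadZl (Y : 'I_n -> 'I_n -> R) (a : R) y :
  quad (fun i j => a * Y i j) y = a * quad Y y.
Proof.
rewrite /quad mulr_sumr; apply: eq_bigr => i _.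
by rewrite mulr_sumr; apply: eq_bigr => j _; ring.
Qed.

(** The case [s = -1] matches [reflect_space]: the gradient keeps its sign and the Hessian changes
    it. *)
Lemma taylor2_sign T f p X s : s = 1 \/ s = -1 -> taylor2 T f p X ->
  taylor2 T (fun x => s * f (s *: x)) (fun i x => p i (s *: x))
    (fun i j x => s * X i j (s *: x)).
Proof.
move=> hs H x y.
have ss : s * s = 1 by case: hs => ->; rewrite ?mulrNN mulr1.
have ns : `|s| = 1 by case: hs => ->; rewrite ?normrN1 ?normr1.
have := H (s *: x) (s *: y); rewrite -scalerDr normrZ ns mul1r => H1.
have {H1} := H1; rewrite -[X in X <= _ -> _]mul1r -[X in X * `|_| <= _ -> _]ns -normrM.
have -> : \sum_i (s *: y) 0 i * p i (s *: x) = s * \sum_i y 0 i * p i (s *: x).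
  by rewrite mulr_sumr; apply: eq_bigr => i _; rewrite mxE mulrA.
have -> : quad (fun i j => s * X i j (s *: x)) y
    = s * quad (fun i j => X i j (s *: x)) y.
  by rewrite quadZl.
rewrite quadZ expr2 ss mul1r; set P := \sum_i _; set Q := quad _ _.
have -> : s * (f (s *: (x + y)) - f (s *: x) - s * P - Q / 2)
    = s * f (s *: (x + y)) - s * f (s *: x) - P - s * Q / 2.
  by rewrite !mulrBr [s * (s * P)]mulrA ss mul1r mulrA.
by [].
Qed.

Lemma lipb_sign L f s : s = 1 \/ s = -1 -> lipb L f -> lipb L (fun x => s * f (s *: x)).
Proof.
move=> hs H x y.
have ns : `|s| = 1 by case: hs => ->; rewrite ?normrN1 ?normr1.
by rewrite -mulrBr normrM ns mul1r scalerDr; have := H (s *: x) (s *: y); rewrite normrZ ns mul1r.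
Qed.

End Combinations.

(** * Comparison with the walk on the time grid *)

Section GridComparison.
Context (R : realType) (n d : nat) (q : history d -> 'rV[R]_n) (N : nat).
Hypotheses (n_gt0 : (0 < n)%N) (d_gt0 : (0 < d)%N) (N_gt0 : (0 < N)%N).
Hypothesis q_le1 : forall m, `|q m| <= 1.
Implicit Types (x y : 'rV[R]_n) (s t : R).

Context (G : 'rV[R]_n -> R) (p : 'I_n -> 'rV[R]_n -> R)
  (X : 'I_n -> 'I_n -> 'rV[R]_n -> R) (K M L : R).
Hypotheses (G_c11 : c11 K G p) (p_c11 : forall i, c11 M (p i) (X i))
  (G_lip : lipb L G) (G_ones : forall x s, G (x + s *: ones R n) = G x + s)
  (M_gt0 : 0 < M).

Definition mesh : R := (Num.sqrt N%:R)^-1.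

Lemma mesh_gt0 : 0 < mesh.
Proof. by rewrite invr_gt0 sqrtr_gt0 ltr0n. Qed.

Lemma mesh_sqr : N%:R * mesh ^+ 2 = 1.
Proof. by rewrite exprVn sqr_sqrtr // divff // pnatr_eq0 -lt0n. Qed.

Local Notation mw := (mean_walk q mesh).

(** The error per unit of time. In units of [n^2 d^2 M mesh], consistency takes 6 and the variation
    of the Hessian within one time step 1/2; the rest makes the competitor strict. *)
Definition scheme_error : R := 8 * n%:R ^+ 2 * d%:R ^+ 2 * M * mesh.

Lemma mean_walk_ones k x s : mw G k (x + s *: ones R n) = mw G k x + s.
Proof.
have h1 : s <= mw G k (x + s *: ones R n) - mw G k x.
  by apply: mean_walk_shift_ge => z; rewrite G_ones addrAC subrr add0r.
have h2 : - s <= mw G k (x + s *: ones R n + - (s *: ones R n)) - mw G k (x + s *: ones R n).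
  by apply: mean_walk_shift_ge => z; rewrite -scaleNr G_ones addrAC subrr add0r.
by rewrite addrK in h2; apply/eqP; rewrite eq_le; apply/andP; split; lra.
Qed.

Context (sg : R) (w : 'rV[R]_n * R -> R) (theta C c : R).
Hypotheses (sg_cases : sg = 1 \/ sg = -1) (theta_gt0 : 0 < theta) (C_ge0 : 0 <= C)
  (w_sub : quadratic_subsolution q w)
  (w_cont : {within @slab R n, continuous w})
  (w_growth : forall x t, 0 <= t <= 1 -> w (x, t) <= C * (1 + `|x|))
  (w_inc : increasing_along_ones theta w)
  (w_final : forall x, w (x, 1) <= sg * G (sg *: x) + c).

(** The competitor interpolates linearly in time between consecutive averaged walks, and
    [scheme_error] is added to its slope. Consistency of the walk makes it a strict supersolution on
    the strip. *)
Lemma grid_strip k x t : (k < N)%N ->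
  (forall y, w (y, 1 - k%:R / N%:R)
     <= sg * mw G k (sg *: y) + c + k%:R / N%:R * scheme_error) ->
  1 - k.+1%:R / N%:R <= t <= 1 - k%:R / N%:R ->
  w (x, t) <= sg * mw G k (sg *: x) + c + k%:R / N%:R * scheme_error
    + (1 - k%:R / N%:R - t)
      * (N%:R * (sg * mw G k.+1 (sg *: x) - sg * mw G k (sg *: x)) + scheme_error).
Proof.
move=> kN hk ht.
have N0 : 0 < N%:R :> R by rewrite ltr0n.
have e0 := mesh_gt0; have eN := mesh_sqr; have hM := M_gt0.
have ss : sg * sg = 1 by case: sg_cases => ->; rewrite ?mulrNN mulr1.
have nsg : `|sg| = 1 by case: sg_cases => ->; rewrite ?normrN1 ?normr1.
pose a : R := 1 - k.+1%:R / N%:R; pose b : R := 1 - k%:R / N%:R.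
rewrite -/a -/b in hk ht *.
have a0 : 0 <= a by rewrite subr_ge0 ler_pdivrMr // mul1r ler_nat.
have hba : (b - a) * N%:R = 1.
  by rewrite /a /b -natr1; field; rewrite gt_eqF.
have ab : a < b.
  by rewrite -subr_gt0 -(pmulr_lgt0 _ N0) hba.
have b1 : b <= 1 by rewrite /b gerBl divr_ge0.
pose Tt := n%:R * M.
have T0 : 0 <= Tt by rewrite mulr_ge0 // ltW.
have L0 : 0 <= L := lipb_ge0 (Ordinal n_gt0) G_lip.
have hT := taylor2_of_c11 G_c11 p_c11.
pose f j x := sg * mw G j (sg *: x).
pose pf j i x := mw (p i) j (sg *: x).
pose Xf j i i' x := sg * mw (X i i') j (sg *: x).
have fT j : taylor2 Tt (f j) (pf j) (Xf j).
  have h := mean_walk_taylor2 q mesh j hT.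
  exact: (taylor2_sign sg_cases h).
have fL j : lipb L (f j).
  have h := mean_walk_lipb q mesh j G_lip.
  exact: (lipb_sign sg_cases h).
have fO j y s : f j (y + s *: ones R n) = f j y + s.
  by rewrite /f scalerDr scalerA mean_walk_ones mulrDr mulrA ss mul1r.
have pfL j i y : `|pf j i y| <= L.
  apply: mean_hist_bound => m; apply: walk_bound => z.
  exact: c11_coef_bound G_lip G_c11.
pose ck := c + k%:R / N%:R * scheme_error.
(* Written as a combination of two terms so that [A] and [B] obtain their expansions from the same
   lemmas. *)
pose A y := 1 * f k y + 0 * f k y + ck.
pose B y := N%:R * f k.+1 y + (- N%:R) * f k y + scheme_error.
have AE y : A y = f k y + ck by rewrite /A mul1r mul0r addr0.
have BE y : B y = N%:R * (f k.+1 y - f k y) + scheme_error.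
  by rewrite /B; ring.
pose D : R := 2 * N%:R + 1.
have D1 (Z : R) : 0 <= Z -> `|1 : R| * Z + `|0 : R| * Z <= D * Z.
  move=> Z0; rewrite normr1 normr0 mul1r mul0r addr0 ler_peMl // /D.
  by rewrite lerDr mulr_ge0 // ltW.
have D2 (Z : R) : 0 <= Z -> `|N%:R| * Z + `|- N%:R| * Z <= D * Z.
  by move=> Z0; rewrite normrN (ger0_norm (ltW N0)) /D; lra.
have AT := taylor2_le (D1 _ T0) (taylor2_comb 1 0 ck (fT k) (fT k)).
have BT := taylor2_le (D2 _ T0) (taylor2_comb N%:R (- N%:R) scheme_error (fT k.+1) (fT k)).
have AL := lipb_le (D1 _ L0) (lipb_comb 1 0 ck (fL k) (fL k)).
have BL := lipb_le (D2 _ L0) (lipb_comb N%:R (- N%:R) scheme_error (fL k.+1) (fL k)).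
have pA i y : `|1 * pf k i y + 0 * pf k i y| <= D * L.
  apply: le_trans (D1 _ L0); apply: le_trans (ler_normD _ _) _.
  by apply: lerD; rewrite normrM; apply: ler_wpM2l => //; exact: pfL.
have pB i y : `|N%:R * pf k.+1 i y + (- N%:R) * pf k i y| <= D * L.
  apply: le_trans (D2 _ L0); apply: le_trans (ler_normD _ _) _.
  by apply: lerD; rewrite normrM; apply: ler_wpM2l => //; exact: pfL.
have AO y s : A (y + s *: ones R n) = A y + s by rewrite !AE fO addrAC.
have BO y s : B (y + s *: ones R n) = B y by rewrite !BE !fO; ring.
pose e := n%:R ^+ 2 * d%:R ^+ 2 * M * mesh.
have e_gt0 : 0 < e by rewrite !mulr_gt0 ?exprn_gt0 ?ltr0n.
have DT0 : 0 <= D * Tt by rewrite mulr_ge0 // /D addr_ge0 // mulr_ge0.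
have strict y t' : a <= t' <= b ->
    - B y + diffusion q (fun i j => 1 * Xf k i j y + 0 * Xf k i j y)
    + (b - t') * diffusion q (fun i j => N%:R * Xf k.+1 i j y + (- N%:R) * Xf k i j y) <= - e.
  move=> /andP[at' tb']; rewrite BE !diffusion_lin mul1r mul0r addr0.
  have dE j : diffusion q (fun i i' => Xf j i i' y)
      = sg * diffusion q (fun i i' => mw (X i i') j (sg *: y)).
    rewrite /diffusion [RHS]mulrCA [sg * _]mulr_sumr; congr (_ * _).
    by apply: eq_bigr => m _; rewrite quadZl.
  rewrite !dE.
  set D0 := diffusion q _; set Dn := diffusion q _.
  have hcons := mean_walk_consistency n_gt0 d_gt0 (ltW e0) q_le1 k (sg *: y) G_c11 p_c11.
  rewrite -/D0 in hcons.
  have hstep := diffusion_step n_gt0 d_gt0 (ltW e0) q_le1 k (sg *: y) (fun i i' => (p_c11 i).2 i').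
  rewrite -/D0 -/Dn in hstep.
  set df := mw G k.+1 _ - mw G k _ in hcons.
  have h1 : `|N%:R * (sg * df) - sg * D0| <= 6 * e.
    have -> : N%:R * (sg * df) - sg * D0 = sg * (N%:R * (df - mesh ^+ 2 * D0)).
      have -> : N%:R * (df - mesh ^+ 2 * D0) = N%:R * df - (N%:R * mesh ^+ 2) * D0.
        by ring.
      by rewrite eN; ring.
    rewrite normrM nsg mul1r normrM (ger0_norm (ltW N0)).
    have -> : 6 * e = N%:R * (6 * n%:R ^+ 2 * d%:R ^+ 2 * M * mesh ^+ 3).
      transitivity (6 * e * (N%:R * mesh ^+ 2)); first by rewrite eN mulr1.
      by rewrite /e; ring.
    by rewrite ler_wpM2l // ltW.
  (* The interpolated Hessian lies between those of walks [k] and [k.+1], and one step changes it by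
     O(M mesh). *)
  have h2 : `|(b - t') * N%:R * (sg * (Dn - D0))| <= e / 2.
    rewrite normrM [`|sg * _|]normrM nsg mul1r.
    apply: (@le_trans _ _ (n%:R ^+ 2 * (M * mesh) / 2)).
      rewrite -[leRHS]mul1r ler_pM // ger0_norm; last first.
        by rewrite mulr_ge0 ?subr_ge0 // ltW.
      by rewrite -[leRHS]hba ler_wpM2r ?(ltW N0) // lerD2l lerN2.
    have d1 : 1 <= d%:R ^+ 2 :> R by rewrite exprn_ege1 // ler1n.
    have z0 : 0 <= n%:R ^+ 2 * (M * mesh) by rewrite mulr_ge0 ?sqr_ge0 // mulr_ge0 // ltW.
    rewrite ler_wpM2r ?invr_ge0 //.
    have -> : e = d%:R ^+ 2 * (n%:R ^+ 2 * (M * mesh)) by rewrite /e; ring.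
    by rewrite ler_peMl.
  have E8 : scheme_error = 8 * e by rewrite /scheme_error /e; ring.
  have -> : f k.+1 y - f k y = sg * df by rewrite /f /df mulrBr.
  have -> : (b - t') * (N%:R * (sg * Dn) + - N%:R * (sg * D0))
     = (b - t') * N%:R * (sg * (Dn - D0)) by ring.
  move: h1 h2; rewrite E8 !ler_norml => /andP[? ?] /andP[? ?].
  lra.
have wf y : w (y, b) <= A y by rewrite AE addrA; exact: hk.
have := strip_comparison n_gt0 q_le1 theta_gt0 C_ge0 w_sub w_cont w_growth w_inc DT0
  AT BT AL BL pA pB AO BO a0 ab b1 e_gt0 strict wf x ht.
by rewrite -/(A x) -/(B x) AE BE /ck addrA.
Qed.

Lemma grid_comparison k x : (k <= N)%N ->
  w (x, 1 - k%:R / N%:R) <= sg * mw G k (sg *: x) + c + k%:R / N%:R * scheme_error.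
Proof.
have N0 : 0 < N%:R :> R by rewrite ltr0n.
elim: k x => [|k ih] x kN.
  rewrite mul0r subr0 mul0r addr0.
  have -> : mw G 0 (sg *: x) = G (sg *: x) by exact: mean_hist_cst.
  exact: w_final.
have ht : 1 - k.+1%:R / N%:R <= (1 - k.+1%:R / N%:R : R) <= 1 - k%:R / N%:R.
  by rewrite lexx lerD2l lerN2 ler_wpM2r ?invr_ge0 ?(ltW N0) // ler_nat.
(* At the early end of the strip the interpolation is the next averaged walk, with one more share of
   the error. *)
apply: le_trans (@grid_strip k x _ kN (fun y => ih y (ltnW kN)) ht) _.
rewrite le_eqVlt; apply/orP; left; apply/eqP.
by rewrite -natr1; field; rewrite gt_eqF.
Qed.

Lemma scheme_error_ge0 : 0 <= scheme_error.
Proof.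
have h1 := ltW M_gt0; have h2 := ltW mesh_gt0.
by rewrite !mulr_ge0 ?sqr_ge0.
Qed.

(** Replacing the interpolation by its value at the later grid point costs at most one step of the
    walk, [L * mesh]. *)
Lemma time_grid_comparison k x t : (k < N)%N ->
  1 - k.+1%:R / N%:R <= t <= 1 - k%:R / N%:R ->
  w (x, t) <= sg * mw G k (sg *: x) + c + scheme_error + L * mesh.
Proof.
move=> kN ht.
have N0 : 0 < N%:R :> R by rewrite ltr0n.
have nsg : `|sg| = 1 by case: sg_cases => ->; rewrite ?normrN1 ?normr1.
have hk y : w (y, 1 - k%:R / N%:R)
    <= sg * mw G k (sg *: y) + c + k%:R / N%:R * scheme_error.
  by apply: grid_comparison; exact: ltnW.
apply: le_trans (grid_strip x kN hk ht) _.
have /andP[t1 t2] := ht.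
have hE := scheme_error_ge0.
set r := 1 - k%:R / N%:R - t.
have r0 : 0 <= r by rewrite subr_ge0.
have r1 : r <= 1 / N%:R.
  have -> : 1 / N%:R = (1 - k%:R / N%:R) - (1 - k.+1%:R / N%:R) :> R.
    by rewrite -natr1; field; rewrite gt_eqF.
  by rewrite /r lerD2l lerN2.
have rN : r * N%:R <= 1 by rewrite -ler_pdivlMr.
set df := sg * _ - sg * _.
have hdf : `|df| <= L * mesh.
  rewrite /df -mulrBr normrM nsg mul1r.
  by apply: mean_walk_step => //; exact: ltW mesh_gt0.
have h1 : r * N%:R * df <= L * mesh.
  apply: le_trans (ler_norm _) _; apply: le_trans hdf.
  by rewrite normrM ler_piMl // ger0_norm // mulr_ge0 // ltW.
have h2 : (k%:R / N%:R + r) * scheme_error <= scheme_error.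
  rewrite ler_piMl //.
  have : k.+1%:R / N%:R <= 1 :> R by rewrite ler_pdivrMr // mul1r ler_nat.
  by rewrite -natr1 mulrDl; lra.
rewrite mulrDr mulrA; rewrite mulrDl in h2; lra.
Qed.

Lemma ceil_time_comparison x t : 0 <= t <= 1 ->
  w (x, t) <= sg * mw G (N - `|Num.ceil (N%:R * t)|) (sg *: x) + c
              + scheme_error + L * mesh.
Proof.
move=> /andP[t0 t1].
have N0 : 0 < N%:R :> R by rewrite ltr0n.
have L0 : 0 <= L * mesh.
  by rewrite mulr_ge0 ?(lipb_ge0 (Ordinal n_gt0) G_lip) // ltW // mesh_gt0.
have /andP[c1 c2] := ceil_itv (N%:R * t).
have cge0 : 0 <= Num.ceil (N%:R * t).
  by rewrite ceil_ge0; apply: lt_le_trans (_ : 0 <= _); rewrite ?ltrN10 // mulr_ge0 // ltW.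
have cleN : Num.ceil (N%:R * t) <= N%:Z.
  by rewrite ceil_le_int -pmulrn ler_piMr // ltW.
move: c1 c2; rewrite rmorphB /= -[Num.ceil _]gez0_abs //.
set l := `|_|%N; rewrite -!pmulrn => c1 c2.
have lN : (l <= N)%N by rewrite -lez_nat /l gez0_abs.
(* The ceiling vanishes only for [t = 0]. This is the grid point [k = N], at which no further strip
   begins. *)
case: (posnP l) => [l0|l_gt0].
  have {}t0 : t = 0.
    rewrite l0 in c2; apply/eqP; rewrite eq_le t0 andbT.
    by rewrite -(ler_pM2l N0) mulr0.
  have := grid_comparison x (leqnn N).
  rewrite divff ?gt_eqF // subrr mul1r l0 subn0 t0 => h.
  by apply: le_trans h _; rewrite lerDl.
have kN : (N - l < N)%N by rewrite ltn_subrL l_gt0.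
apply: time_grid_comparison => //; apply/andP; split.
  have -> : (N - l).+1%:R / N%:R = 1 - (l%:R - 1) / N%:R :> R.
    by rewrite -natr1 natrB //; field; rewrite gt_eqF.
  by rewrite opprB addrC subrK ler_pdivrMr // mulrC ltW.
rewrite natrB // mulrBl divff ?gt_eqF // opprB addrC subrK.
by rewrite ler_pdivlMr // mulrC.
Qed.

End GridComparison.

(** * The constrained game *)

Section GameValue.
Context (R : realType) (n d : nat) (q : history d -> 'rV[R]_n) (eps : R).
Hypothesis eps_gt0 : 0 < eps.
Implicit Types (x y s : 'rV[R]_n) (m : history d).

Context (g G : 'rV[R]_n -> R) (c : R).
Hypotheses (g_scale : forall x, g (eps *: x) = eps * g x)
  (g_ones : forall x (r : R), g (x + r *: ones R n) = g x + r)
  (G_ones : forall x (r : R), G (x + r *: ones R n) = G x + r)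
  (G_near : forall x, `|G x - g x| <= c).

Lemma walk_ones f j x m (r : R) : (forall z (r : R), f (z + r *: ones R n) = f z + r) ->
  walk q eps f j (x + r *: ones R n) m = walk q eps f j x m + r.
Proof.
move=> H; rewrite -walk_shift.
have -> : (fun z => f (z + r *: ones R n)) = (fun z => f z + r).
  by apply/funext => z.
by rewrite walkD walk_cst.
Qed.

(** After scaling, a round is a step of the walk plus a shift along [ones], and only the shift
    depends on the forecaster's [f]. *)
Lemma scaled_move x s m b (f : R) :
  eps *: (x + (s + pm1 R b *: (q m - f *: ones R n)))
  = eps *: (x + s) + walk_step q eps m b + (- (pm1 R b * eps * f)) *: ones R n.
Proof.
rewrite /walk_step [x + (s + _)]addrA scalerDr -[RHS]addrA; congr (_ + _).
rewrite scalerA scalerBr scalerA scaleNr.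
by rewrite [eps * pm1 R b]mulrC.
Qed.

(** The maximum is at least the mean of the two outcomes, in which the shifts by [f] along [ones]
    cancel. *)
Lemma minmax_ge k x s m :
  walk q eps g k (eps *: (x + s)) m <= eps * minmax q g k x s m.
Proof.
elim: k s m => [|k ih] s m; first by rewrite /= g_scale.
rewrite /= -ler_pdivrMl //.
apply: lb_le_inf.
  by eexists; exists 0 => //=; rewrite normr0.
move=> _ [f _ <-]; rewrite ler_pdivrMl //.
have h b := ih (s + pm1 R b *: (q m - f *: ones R n)) (append m b).
have := h true; have := h false; rewrite !scaled_move !walk_ones // /pm1.
set a1 := minmax _ _ _ _ _ _; set a2 := minmax _ _ _ _ _ _.
have e1 : eps * a1 <= eps * Num.max a2 a1 by rewrite ler_pM2l // le_max lexx orbT.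
have e2 : eps * a2 <= eps * Num.max a2 a1 by rewrite ler_pM2l // le_max lexx.
lra.
Qed.

Hypothesis affordable : forall k y m,
  `|walk q eps G k (y + walk_step q eps m true) (append m true)
    - walk q eps G k (y + walk_step q eps m false) (append m false)| <= 2 * eps.

(* The equalizing choice of [f] is admissible, so the game value does not
   exceed the fair average. *)
Lemma minmax_le k x s m :
  eps * minmax q g k x s m <= walk q eps G k (eps *: (x + s)) m + c.
Proof.
elim: k s m => [|k ih] s m.
  by rewrite /= -g_scale; have := G_near (eps *: (x + s)); rewrite ler_norml => /andP[? ?]; lra.
pose W b := walk q eps G k (eps *: (x + s) + walk_step q eps m b) (append m b).
(* Half the gap between the two outcomes, in units of [eps]: the shifts by [f] make them equal, and
   [affordable] says that [|f| <= 1]. *)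
pose f : R := (W true - W false) / (2 * eps).
have f1 : `|f| <= 1.
  rewrite normrM normfV (gtr0_norm (x := 2 * eps)) ?mulr_gt0 //.
  by rewrite ler_pdivrMr ?mulr_gt0 // mul1r; exact: affordable.
have fE : eps * f = (W true - W false) / 2 by rewrite /f; field; rewrite gt_eqF.
rewrite /= -ler_pdivlMl //.
set S := [set _ | _ in _].
(* The infimum is at most each of its elements only when the set is bounded below; the bound is the
   walk of [g], as in [minmax_ge]. *)
have Slb : has_lbound S.
  exists (eps^-1 * walk q eps g k.+1 (eps *: (x + s)) m) => _ [f' _ <-].
  rewrite ler_pdivrMl //=.
  have h b := minmax_ge k x (s + pm1 R b *: (q m - f' *: ones R n)) (append m b).
  have := h true; have := h false; rewrite !scaled_move !walk_ones // /pm1.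
  set a1 := minmax _ _ _ _ _ _; set a2 := minmax _ _ _ _ _ _.
  have e1 : eps * a1 <= eps * Num.max a2 a1 by rewrite ler_pM2l // le_max lexx orbT.
  have e2 : eps * a2 <= eps * Num.max a2 a1 by rewrite ler_pM2l // le_max lexx.
  lra.
apply: (@le_trans _ _ (Num.max
    (minmax q g k x (s + pm1 R true *: (q m - f *: ones R n)) (append m true))
    (minmax q g k x (s + pm1 R false *: (q m - f *: ones R n)) (append m false)))).
  by apply: ge_inf => //; exists f.
rewrite ge_max; apply/andP; split; rewrite ler_pdivlMl //;
  apply: le_trans (ih _ _) _; rewrite scaled_move walk_ones //.
  by rewrite -/(W true) /pm1 mul1r fE /W; lra.
by rewrite -/(W false) /pm1 mulN1r mulNr fE /W; lra.
Qed.

End GameValue.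

(** * Room in the constraint from strict monotonicity *)

Section Slack.
Context (R : realType) (n d : nat) (q : history d -> 'rV[R]_n).
Hypothesis q_range : forall m i, -1 <= q m 0 i <= 1.
Implicit Types (x y v : 'rV[R]_n) (m : history d).

Lemma expert_norm m : `|q m| <= 1.
Proof. by apply: norm_le_coord => // i; rewrite ler_norml q_range. Qed.

Lemma vartheta_le m : vartheta q <= \sum_i (1 - q m 0 i)
  /\ vartheta q <= \sum_i (1 + q m 0 i).
Proof.
have h : vartheta q <= Num.min (\sum_(i < n) (1 - pos_part (q m 0 i)))
                             (\sum_(i < n) (1 - neg_part (q m 0 i))).
  exact: bigmin_le_cond.
have [h1 h2] : vartheta q <= \sum_(i < n) (1 - pos_part (q m 0 i))
    /\ vartheta q <= \sum_(i < n) (1 - neg_part (q m 0 i)).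
  by move: h; rewrite le_min => /andP[].
split; [apply: le_trans h1 _|apply: le_trans h2 _]; apply: ler_sum => i _.
  by rewrite lerD2l lerN2 /pos_part le_max lexx.
by rewrite /neg_part opprK lerD2l ge_min lexx.
Qed.

(** All summands are nonnegative and (E1) makes one of them nonzero in each sum; the minimum is over
    finitely many histories. *)
Lemma vartheta_gt0 : (forall m, q m <> ones R n /\ q m <> - ones R n) ->
  0 < vartheta q.
Proof.
move=> E1.
have pos (F : 'I_n -> R) : (forall i, 0 <= F i) -> (exists i, F i != 0) -> 0 < \sum_i F i.
  move=> F0 [i Fi]; rewrite (bigD1 i) //= ltr_pwDl ?sumr_ge0 //.
  by rewrite lt_neqAle eq_sym Fi F0.
have nz (v : 'rV[R]_n) : v <> 0 -> exists i, v 0 i != 0.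
  move=> v0; apply: contrapT => H; apply: v0; apply/rowP => i; rewrite mxE.
  by apply/eqP; apply: contrapT => vi; apply: H; exists i; apply/negP.
have h m : 0 < Num.min (\sum_(i < n) (1 - pos_part (q m 0 i)))
                       (\sum_(i < n) (1 - neg_part (q m 0 i))).
  rewrite lt_min; apply/andP; split; apply: pos.
  - by move=> i; rewrite subr_ge0 /pos_part ge_max ler01; case/andP: (q_range m i) => _ ->.
  - have [|i] := nz (ones R n - q m).
      by move=> /eqP; rewrite subr_eq0 eq_sym => /eqP; exact: (E1 m).1.
    rewrite !mxE => qi; exists i; apply: contra qi; rewrite !subr_eq0 /pos_part => /eqP h.
    move: h; case: (leP (q m 0 i) 0) => _ h; last by rewrite -h.
    by have := oner_neq0 R; rewrite h eqxx.
  - move=> i; rewrite subr_ge0 /neg_part lerNl le_min lerN10.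
    by case/andP: (q_range m i) => ->.
  - have [|i] := nz (ones R n + q m).
      move=> /eqP; rewrite addrC addr_eq0 => /eqP; exact: (E1 m).2.
    rewrite !mxE => qi; exists i; apply: contra qi; rewrite /neg_part opprK => /eqP h.
    move: h; case: (leP (q m 0 i) 0) => _ h; first by rewrite h.
    by have := oner_neq0 R; rewrite -h addr0 eqxx.
rewrite /vartheta /min_hist; elim/big_rec: _ => [|m v _ v0]; first exact: h.
by rewrite lt_min v0 h.
Qed.

Context (g : 'rV[R]_n -> R) (theta : R).
Hypotheses (theta_gt0 : 0 < theta)
  (g_mono : forall x v, (forall i, 0 <= v 0 i) ->
     g x + theta * dot v (ones R n) <= g (x + v))
  (g_ones : forall x (r : R), g (x + r *: ones R n) = g x + r).

(** The vectors [ones - q m] and [ones + q m] are nonnegative, so (G1) keeps [g (x + r q m)]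
    strictly between the values at [x - r ones] and [x + r ones], which are [g x - r] and [g x + r]
    by (G3). The margin on each side is [theta r] times a coordinate sum that is at least
    [vartheta]. *)
Lemma expert_move_bounds (r : R) m x : 0 <= r ->
  `|g (x + r *: q m) - g x| <= r - r * (theta * vartheta q).
Proof.
move=> r0; have [h1 h2] := vartheta_le m.
have E a : dot (r *: (ones R n + a *: q m)) (ones R n) = r * \sum_i (1 + a * q m 0 i).
  rewrite dotZ /dot; congr (_ * _); apply: eq_bigr => i _.
  by rewrite !mxE mulr1.
have k1 := @g_mono (x + r *: q m) (r *: (ones R n + (-1) *: q m)).
have k2 := @g_mono (x - r *: ones R n) (r *: (ones R n + 1 *: q m)).
rewrite !E in k1 k2.
have e1 : x + r *: q m + r *: (ones R n + (-1) *: q m) = x + r *: ones R n.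
  by rewrite scaleN1r scalerBr addrACA subrr addr0.
have e2 : x - r *: ones R n + r *: (ones R n + 1 *: q m) = x + r *: q m.
  by rewrite scale1r scalerDr addrA subrK.
rewrite e1 g_ones in k1; rewrite e2 -scaleNr g_ones in k2.
have {}k1 : g (x + r *: q m) + theta * (r * \sum_i (1 + -1 * q m 0 i)) <= g x + r.
  apply: k1 => i; rewrite !mxE mulr_ge0 //.
  by case/andP: (q_range m i) => _ ?; lra.
have {}k2 : g x + - r + theta * (r * \sum_i (1 + 1 * q m 0 i)) <= g (x + r *: q m).
  apply: k2 => i; rewrite !mxE mulr_ge0 //.
  by case/andP: (q_range m i) => ? _; lra.
have s1 : \sum_i (1 + -1 * q m 0 i) = \sum_i (1 - q m 0 i).
  by apply: eq_bigr => i _; rewrite mulN1r.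
have s2 : \sum_i (1 + 1 * q m 0 i) = \sum_i (1 + q m 0 i).
  by apply: eq_bigr => i _; rewrite mul1r.
rewrite s1 in k1; rewrite s2 in k2.
have tr : 0 <= theta * r by rewrite mulr_ge0 // ltW.
have j1 := ler_wpM2l tr h1; have j2 := ler_wpM2l tr h2.
rewrite ler_norml; apply/andP; split.
  have -> : r * (theta * vartheta q) = theta * r * vartheta q by ring.
  by rewrite mulrA in k2; lra.
have -> : r * (theta * vartheta q) = theta * r * vartheta q by ring.
by rewrite mulrA in k1; lra.
Qed.

End Slack.

(** * The Lipschitz constant *)

Section Lipschitz.
Context (R : realType) (n : nat).

Lemma Lip_le (g : 'rV[R]_n -> R) x y : is_lipschitz g ->
  `|g x - g y| <= Lip g * enorm (x - y).
Proof.
move=> [L hL]; have [->|xy] := eqVneq x y.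
  by rewrite !subrr normr0 /enorm /dot big1 ?sqrtr0 ?mulr0 // => i _; rewrite mxE mul0r.
have e0 : 0 < enorm (x - y).
  rewrite sqrtr_gt0; apply: lt_le_trans (norm_sqr_le_dot _).
  by rewrite exprn_gt0 // normr_gt0 subr_eq0.
rewrite -ler_pdivrMr //; apply: ub_le_sup; last by exists x, y.
exists L => _ [a [b [ab ->]]].
have ab0 : 0 < enorm (a - b).
  rewrite sqrtr_gt0; apply: lt_le_trans (norm_sqr_le_dot _).
  by rewrite exprn_gt0 // normr_gt0 subr_eq0.
by rewrite ler_pdivrMr.
Qed.

Lemma lipb_Lip (g : 'rV[R]_n -> R) : is_lipschitz g -> 0 <= Lip g ->
  lipb (n%:R * Lip g) g.
Proof.
move=> gL L0 x y; have := Lip_le (x + y) x gL.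
rewrite [x + y - x]addrAC subrr add0r => /le_trans; apply.
have -> : n%:R * Lip g * `|y| = Lip g * (n%:R * `|y|) by ring.
by rewrite ler_wpM2l // enorm_le.
Qed.

(** By (G3), [g] increases by 1 from 0 to [ones]. *)
Lemma Lip_gt0 (g : 'rV[R]_n -> R) : (0 < n)%N -> is_lipschitz g ->
  (forall x (s : R), g (x + s *: ones R n) = g x + s) -> 0 < Lip g.
Proof.
move=> n0 gL g1; have := Lip_le (0 + 1 *: ones R n) 0 gL.
rewrite g1 addrAC subrr add0r normr1 => h.
rewrite ltNge; apply/negP => L0; have : Lip g * enorm (0 + 1 *: ones R n - 0) <= 0.
  by rewrite mulr_le0_ge0 // sqrtr_ge0.
by move=> h'; have := le_trans h h'; rewrite ler10.
Qed.

End Lipschitz.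

(** * The reflected negative of a solution *)

Section Reflection.
Context (R : realType) (n : nat).
Implicit Types (u : 'rV[R]_n * R -> R).

Lemma reflect_continuous u : {within @slab R n, continuous u} ->
  {within @slab R n, continuous (fun p => - u (reflect_space p))}.
Proof.
move=> /subspace_continuousP H; apply/subspace_continuousP => p sp.
apply: (@cvgN R R^o); apply/cvgrPdist_lt => e e0.
have /cvgrPdist_lt/(_ e e0) := H (reflect_space p) sp.
rewrite !near_withinE => /near_reflect_space.
have -> : reflect_space (reflect_space p) = p.
  by case: p {sp} => x t; rewrite /reflect_space /= opprK.
by apply: filterS => p' h sp'; apply: h.
Qed.

Lemma reflect_increasing u theta : increasing_along_ones theta u ->
  increasing_along_ones theta (fun p => - u (reflect_space p)).
Proof.
move=> H x t s t01 s0; have := H (- x - s *: ones R n) t s t01 s0.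
by rewrite subrK /reflect_space /= opprD; lra.
Qed.

Lemma growth_sup_norm u : linear_growth u ->
  exists2 C : R, 0 <= C & forall x t, 0 <= t <= 1 -> `|u (x, t)| <= C * (1 + `|x|).
Proof.
move=> [C hC]; exists (`|C| * (1 + n%:R)); first by rewrite mulr_ge0 // addr_ge0.
move=> x t t01; apply: le_trans (hC x t t01) _.
apply: (@le_trans _ _ (`|C| * (1 + enorm x))).
  by rewrite ler_wpM2r ?ler_norm // addr_ge0 // sqrtr_ge0.
rewrite -mulrA ler_wpM2l //; have := enorm_le x.
by have := normr_ge0 x; have := ler0n R n; lra.
Qed.

End Reflection.

(** * The rate of convergence *)

Section FinalBound.
Context (R : realType).

Lemma max_hist_near (d : nat) (w : history d -> R) (c b : R) :
  (forall m, `|w m - c| <= b) -> `|max_hist w - c| <= b.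
Proof.
move=> H; rewrite /max_hist; elim/big_ind: _ => //= x y hx hy.
by case: (leP x y).
Qed.

Lemma min_hist_near (d : nat) (w : history d -> R) (c b : R) :
  (forall m, `|w m - c| <= b) -> `|min_hist w - c| <= b.
Proof.
move=> H; rewrite /min_hist; elim/big_ind: _ => //= x y hx hy.
by case: (leP x y).
Qed.

Lemma shift_bound_transfer n (f h : 'rV[R]_n -> R) y (b : R) :
  (forall y c, (forall z, c <= f (z + y) - f z) -> forall z, c <= h (z + y) - h z) ->
  (forall z, `|f (z + y) - f z| <= b) -> forall z, `|h (z + y) - h z| <= b.
Proof.
move=> H hb z; rewrite ler_norml; apply/andP; split.
  by apply: H => z'; have := hb z'; rewrite ler_norml => /andP[].
have := @H (- y) (- b) _ (z + y); rewrite addrK.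
have -> : (- b <= h z - h (z + y)) = (h (z + y) - h z <= b) by rewrite -lerN2 opprK opprB.
apply=> z'; have := hb (z' - y); rewrite subrK ler_norml => /andP[_].
by rewrite -[X in X <= _]opprB lerNl.
Qed.

(* [kappa] stands for d^(2/3) N^(-1/6); the data are mollified at the scale
   [(1 + Lip(g)^2 / (theta vartheta)^2) kappa], which makes the unconstrained
   optimal moves admissible. *)
Lemma rate_of_mesh (n d : nat) (q : history d -> 'rV[R]_n) (g : 'rV[R]_n -> R)
    (thetag : R) (u : 'rV[R]_n * R -> R) (N : nat) (kappa : R) :
  (0 < n)%N -> (0 < d)%N -> (0 < N)%N ->
  (forall m i, -1 <= q m 0 i <= 1) ->
  (forall m, q m <> ones R n /\ q m <> - ones R n) ->
  is_lipschitz g -> 0 < thetag ->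
  (forall x v : 'rV[R]_n, (forall i, 0 <= v 0 i) ->
     g x + thetag * dot v (ones R n) <= g (x + v)) ->
  (forall (x : 'rV[R]_n) (s : R), 0 < s -> g (s *: x) = s * g x) ->
  (forall (x : 'rV[R]_n) (s : R), g (x + s *: ones R n) = g x + s) ->
  final_value_solution q g u ->
  0 < kappa -> kappa ^+ 3 = d%:R ^+ 2 * mesh R N ->
  16 * n%:R ^+ 3 * kappa ^+ 2 <= 1 ->
  forall x (t : R) m, 0 <= t <= 1 ->
  `|uN q g N x t m - u (x, t)|
  <= n%:R * (6 * n%:R + 3 + 128 * n%:R ^+ 4) * Lip g
     * (1 + Lip g ^+ 2 / (thetag ^+ 2 * vartheta q ^+ 2)) * kappa.
Proof.
move=> n0 d0 N0 q_range E1 gL th0 g_mono g_scale g_ones [uc [usub usup] u1 ug [th th_gt0 uinc]].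
move=> k0 k3 kn x t m t01.
have Lip0 := Lip_gt0 n0 gL g_ones.
have vt0 : 0 < vartheta q := vartheta_gt0 q_range E1.
have nR : 0 < n%:R :> R by rewrite ltr0n.
have n1 : 1 <= n%:R :> R by rewrite ler1n.
have d1 : 1 <= d%:R :> R by rewrite ler1n.
pose eps := mesh R N.
have e0 : 0 < eps := mesh_gt0 R N0.
have hq := expert_norm q_range.
pose L := n%:R * Lip g.
have L0 : 0 < L by rewrite mulr_gt0.
have gl : lipb L g := lipb_Lip gL (ltW Lip0).
pose a := thetag * vartheta q.
have a0 : 0 < a by rewrite mulr_gt0.
pose Lam := Lip g ^+ 2 / (thetag ^+ 2 * vartheta q ^+ 2).
have LamE : Lam * a ^+ 2 = Lip g ^+ 2.
  by rewrite /Lam /a exprMn divfK // mulf_neq0 // expf_neq0 // gt_eqF.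
have Lam0 : 0 <= Lam by rewrite divr_ge0 ?sqr_ge0 // -exprMn sqr_ge0.
pose delta := (1 + Lam) * kappa.
have dk : kappa <= delta by rewrite /delta ler_peMl ?(ltW k0) // lerDl.
have delta0 : 0 < delta := lt_le_trans k0 dk.
have [G [p [X [Gnear Gshift GK pM]]]] := mollification delta0 n0 gl.
set K := 8 * _ * L / delta in GK; set M := 16 * _ * L / _ in pM.
set c := 3 * n%:R * (L * delta) in Gnear.
have M0 : 0 < M.
  by rewrite /M divr_gt0 ?exprn_gt0 // !mulr_gt0 // exprn_gt0.
have Gones z r : G (z + r *: ones R n) = G z + r.
  have h1 : r <= G (z + r *: ones R n) - G z.
    by apply: Gshift => z'; rewrite g_ones addrAC subrr add0r.
  have h2 : - r <= G (z + r *: ones R n + - (r *: ones R n)) - G (z + r *: ones R n).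
    by apply: Gshift => z'; rewrite -scaleNr g_ones addrAC subrr add0r.
  by rewrite addrK in h2; apply/eqP; rewrite eq_le; apply/andP; split; lra.
have Gl : lipb L G.
  by move=> z y; apply: (shift_bound_transfer Gshift) => z'; exact: gl.
have k3' : d%:R ^+ 2 * eps = kappa ^+ 3 by [].
have k21 : kappa ^+ 2 <= 1.
  apply: le_trans kn; rewrite ler_peMl ?sqr_ge0 //.
  have : 1 <= n%:R ^+ 3 :> R by rewrite exprn_ege1.
  lra.
have k31 : kappa ^+ 3 <= kappa by rewrite exprS ler_piMr // ltW.
have edk : eps * d%:R <= kappa.
  apply: le_trans k31; rewrite -k3' mulrC ler_wpM2r ?(ltW e0) //.
  by rewrite expr2 ler_peMr.
have ek : eps <= kappa by apply: le_trans edk; rewrite ler_peMr // ltW.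
(* The two outcomes differ by a displacement [2 eps q(m')] and by the last sign of the history. The
   displacement accounts for at most [2 eps - 2 eps a] by strict monotonicity, and the history for
   at most [2 eps a] by the choice of [delta]. *)
have affordable k y m' :
    `|walk q eps G k (y + walk_step q eps m' true) (append m' true)
      - walk q eps G k (y + walk_step q eps m' false) (append m' false)| <= 2 * eps.
  set y0 := y + walk_step q eps m' false.
  have -> : y + walk_step q eps m' true = y0 + (2 * eps) *: q m'.
    rewrite /y0 -addrA /walk_step -scalerDl; congr (_ + _ *: _).
    by rewrite /pm1; ring.
  have h1 : `|walk q eps G k (y0 + (2 * eps) *: q m') (append m' true)
      - walk q eps G k y0 (append m' true)| <= 2 * eps - 2 * eps * a.
    rewrite -walk_shift -walkN -walkD; apply: walk_bound => z.
    apply: (shift_bound_transfer Gshift) => z'.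
    by apply: expert_move_bounds => //; rewrite mulr_ge0 // ltW.
  have h2 := walk_history_c11 n0 d0 (ltW e0) hq k y0 (append m' false) (append m' true) GK.
  have h3 : 8 * n%:R * K * eps ^+ 2 * d%:R ^+ 2 <= 2 * eps * a.
    have -> : 8 * n%:R * K * eps ^+ 2 * d%:R ^+ 2
        = eps * (64 * n%:R ^+ 3 * Lip g * kappa ^+ 3 / delta).
      by rewrite -k3' /K /L; field; rewrite gt_eqF.
    have -> : 2 * eps * a = eps * (2 * a) by ring.
    rewrite ler_wpM2l ?(ltW e0) // ler_pdivrMr // /delta.
    (* AM-GM: after multiplication by [a] this is [(a - Lip g) ^ 2 >= 0]. *)
    have h4 : 2 * Lip g <= a * (1 + Lam).
      rewrite -(ler_pM2l a0).
      have -> : a * (a * (1 + Lam)) = a ^+ 2 + Lam * a ^+ 2 by ring.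
      rewrite LamE -subr_ge0.
      have -> : a ^+ 2 + Lip g ^+ 2 - a * (2 * Lip g) = (a - Lip g) ^+ 2 by ring.
      exact: sqr_ge0.
    have h5 : 16 * n%:R ^+ 3 * kappa ^+ 2 * (2 * Lip g) <= 1 * (a * (1 + Lam)).
      by rewrite ler_pM // !mulr_ge0 ?exprn_ge0 // ltW.
    have -> : 64 * n%:R ^+ 3 * Lip g * kappa ^+ 3
        = 2 * kappa * (16 * n%:R ^+ 3 * kappa ^+ 2 * (2 * Lip g)) by ring.
    have -> : 2 * a * ((1 + Lam) * kappa) = 2 * kappa * (1 * (a * (1 + Lam))) by ring.
    by rewrite ler_wpM2l // mulr_ge0 // ltW.
  move: h1 h2; rewrite !ler_norml => /andP[? ?] /andP[? ?].
  by apply/andP; split; lra.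
pose k := (N - `|Num.ceil (N%:R * t)|)%N.
have gs z : g (eps *: z) = eps * g z by exact: g_scale.
have scaledx : eps *: (Num.sqrt N%:R *: x + 0) = x.
  by rewrite addr0 scalerA mulVf ?scale1r // gt_eqF // sqrtr_gt0 ltr0n.
(* The game value lies between the walk of [g] and the walk of [G] plus [c], and these walks differ
   by at most [c]. *)
have game : `|uN q g N x t m - walk q eps G k x m| <= c.
  have hle := minmax_le e0 gs g_ones Gones Gnear affordable k (Num.sqrt N%:R *: x) 0 m.
  have hge := minmax_ge q e0 gs g_ones k (Num.sqrt N%:R *: x) 0 m.
  rewrite !scaledx in hle hge.
  have hgG : `|walk q eps G k x m - walk q eps g k x m| <= c.
    by rewrite -walkN -walkD; apply: walk_bound.
  rewrite /uN /V -/k -/(mesh R N) -/eps.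
  move: hgG; rewrite !ler_norml => /andP[? ?]; apply/andP; split; lra.
have hist : `|walk q eps G k x m - mean_walk q eps G k x| <= L * (2 * eps * d%:R).
  apply: mean_hist_near => m'.
  have := walk_history_lip n0 (ltW e0) hq k x x m m' Gl.
  by rewrite subrr normr0 add0r.
have [C C0 hC] := growth_sup_norm ug.
have growth_u x' t' : 0 <= t' <= 1 -> u (x', t') <= C * (1 + `|x'|).
  by move=> t'01; exact: le_trans (ler_norm _) (hC x' t' t'01).
have final_u x' : u (x', 1) <= 1 * G (1 *: x') + c.
  by rewrite u1 mul1r scale1r; have := Gnear x'; rewrite ler_norml => /andP[? ?]; lra.
have upper := ceil_time_comparison n0 d0 N0 hq GK pM Gl Gones M0 (or_introl erefl)
  th_gt0 C0 (subsolution_quadratic usub) uc growth_u uinc final_u x t01.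
pose v p := - u (reflect_space p).
have growth_v x' t' : 0 <= t' <= 1 -> v (x', t') <= C * (1 + `|x'|).
  move=> t'01; apply: le_trans (ler_norm _) _; rewrite normrN.
  by have := hC (- x') t' t'01; rewrite normrN.
have final_v x' : v (x', 1) <= - 1 * G (- 1 *: x') + c.
  rewrite /v /reflect_space /= u1 mulN1r scaleN1r; have := Gnear (- x').
  by rewrite ler_norml => /andP[? ?]; lra.
have lower := ceil_time_comparison n0 d0 N0 hq GK pM Gl Gones M0 (or_intror erefl)
  th_gt0 C0 (supersolution_quadratic usup) (reflect_continuous uc) growth_v
  (reflect_increasing uinc) final_v (- x) t01.
rewrite mul1r scale1r -/k -/eps in upper.
rewrite /v /reflect_space /= opprK mulN1r scaleN1r opprK -/k -/eps in lower.
(* Here 128 is 8 from [scheme_error] times 16 from the bound [M], and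
   [kappa ^ 3 / delta ^ 2 <= kappa] since [delta >= kappa]. *)
have herr : scheme_error n d N M <= 128 * n%:R ^+ 4 * (L * kappa).
  have -> : scheme_error n d N M = 128 * n%:R ^+ 4 * (L * (kappa ^+ 3 / delta ^+ 2)).
    by rewrite /scheme_error -/eps -k3' /M; field; rewrite gt_eqF.
  rewrite ler_wpM2l ?mulr_ge0 ?exprn_ge0 // ler_wpM2l ?(ltW L0) //.
  rewrite ler_pdivrMr ?exprn_gt0 // exprS ler_wpM2l ?(ltW k0) //.
  by rewrite ler_sqr ?nnegrE // ltW.
have hLk : L * kappa <= L * delta by rewrite ler_wpM2l // ltW.
have hLe : L * eps <= L * kappa by rewrite ler_wpM2l // ltW.
have hLd : L * (2 * eps * d%:R) <= 2 * (L * kappa).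
  have -> : L * (2 * eps * d%:R) = 2 * (L * (eps * d%:R)) by ring.
  by rewrite ler_wpM2l // ler_wpM2l // ltW.
have hn4 : 128 * n%:R ^+ 4 * (L * kappa) <= 128 * n%:R ^+ 4 * (L * delta).
  by rewrite ler_wpM2l // mulr_ge0 // exprn_ge0.
(* One [c] comes from the game and one from the final data. Of the three [L * delta], two pay for
   averaging over histories and one for rounding the time. *)
have -> : n%:R * (6 * n%:R + 3 + 128 * n%:R ^+ 4) * Lip g * (1 + Lam) * kappa
    = 2 * c + 3 * (L * delta) + 128 * n%:R ^+ 4 * (L * delta).
  by rewrite /c /L /delta; ring.
move: game hist; rewrite !ler_norml => /andP[? ?] /andP[? ?].
apply/andP; split; lra.
Qed.

End FinalBound.

Theorem theorem1p3 (R : realType) (n : nat) (hn : (2 <= n)%N) :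
  exists C1 C2 : R, [/\ 0 < C1, 0 < C2 &
    forall (d : nat) (q : history d -> 'rV[R]_n) (lam : R)
           (g : 'rV[R]_n -> R) (thetag : R) (u : 'rV[R]_n * R -> R) (N : nat),
      (1 <= d)%N ->
      (forall (m : history d) (i : 'I_n), -1 <= q m 0 i <= 1) ->
      (forall m : history d, q m <> ones R n /\ q m <> - ones R n) ->
      0 < lam <= 1 ->
      r_nondegenerate q hn lam ->
      is_lipschitz g ->
      0 < thetag ->
      (forall x v : 'rV[R]_n, (forall i, 0 <= v 0 i) ->
         g x + thetag * dot v (ones R n) <= g (x + v)) ->
      (forall (x : 'rV[R]_n) (s : R), 0 < s -> g (s *: x) = s * g x) ->
      (forall (x : 'rV[R]_n) (s : R), g (x + s *: ones R n) = g x + s) ->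
      final_value_solution q g u ->
      C1 * d.+1%:R ^+ 6 / (d%:R ^+ 2 * lam) <= N%:R ->
      let bound :=
        C2 * Lip g *
        (1 + Lip g ^+ 2 / (thetag ^+ 2 * vartheta q ^+ 2)
         + ln (1 + d%:R `^ (- (1 / 3)) * lam `^ (- (1 / 6)) * N%:R `^ (5 / 6)))
        * lam `^ (- (2 / 3)) * d%:R `^ (2 / 3) * N%:R `^ (- (1 / 6)) in
      (Linf (fun p => (uN_plus q g N p - u p)%R) <= bound%:E)%E /\
      (Linf (fun p => (uN_minus q g N p - u p)%R) <= bound%:E)%E].
Proof.
have n0 : (0 < n)%N := ltnW hn.
have nR : 0 < n%:R :> R by rewrite ltr0n.
(* [rate_of_mesh] requires [16 n^3 kappa^2 <= 1]. Cubing it, with [kappa ^ 6 = d ^ 4 / N], gives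
   [N >= (16 n^3)^3 d^4], which the lower bound on [N] implies because [d <= d + 1] and
   [lam <= 1]. *)
exists ((16 * n%:R ^+ 3) ^+ 3), (n%:R * (6 * n%:R + 3 + 128 * n%:R ^+ 4)).
have C1_gt0 : 0 < (16 * n%:R ^+ 3) ^+ 3 :> R by rewrite exprn_gt0 // mulr_gt0 // exprn_gt0.
have C2_gt0 : 0 < n%:R * (6 * n%:R + 3 + 128 * n%:R ^+ 4) :> R.
  by rewrite mulr_gt0 // !addr_gt0 ?mulr_gt0 ?exprn_gt0.
split=> // d q lam g thetag u N d0 q_range E1 /andP[lam0 lam1] _ gL th0 g_mono
  g_scale g_ones usol hN bound.
have dR : 0 < d%:R :> R by rewrite ltr0n.
have N0R : 0 < N%:R :> R.
  by apply: lt_le_trans hN; rewrite divr_gt0 ?mulr_gt0 ?exprn_gt0 ?ltr0n.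
have N0 : (0 < N)%N by rewrite ltr0n in N0R.
pose kappa : R := d%:R `^ (2 / 3) * N%:R `^ (- (1 / 6)).
have k0 : 0 < kappa by rewrite mulr_gt0 ?powR_gt0.
have k3 : kappa ^+ 3 = d%:R ^+ 2 * mesh R N.
  rewrite /kappa exprMn -!powR_mulrn ?powR_ge0 // -!powRrM.
  have -> : 2 / 3 * 3%:R = 2%:R :> R by field.
  have -> : - (1 / 6) * 3%:R = - 2^-1 :> R by field.
  by rewrite powR_mulrn ?ler0n // powRN powR12_sqrt ?ler0n.
have k6 : kappa ^+ 6 * (16 * n%:R ^+ 3) ^+ 3 <= 1.
  have -> : kappa ^+ 6 = d%:R ^+ 4 / N%:R.
    have -> : kappa ^+ 6 = (kappa ^+ 3) ^+ 2 by ring.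
    rewrite k3; have := mesh_sqr R N0 => h.
    have -> : d%:R ^+ 4 / N%:R = d%:R ^+ 4 / N%:R * (N%:R * mesh R N ^+ 2).
      by rewrite h mulr1.
    by field; rewrite gt_eqF.
  rewrite mulrAC ler_pdivrMr // mul1r; apply: le_trans hN.
  rewrite ler_pdivlMr ?mulr_gt0 ?exprn_gt0 //.
  have -> : d%:R ^+ 4 * (16 * n%:R ^+ 3) ^+ 3 * (d%:R ^+ 2 * lam)
    = (16 * n%:R ^+ 3) ^+ 3 * (d%:R ^+ 6 * lam) by ring.
  rewrite ler_wpM2l ?(ltW C1_gt0) //.
  apply: (@le_trans _ _ (d%:R ^+ 6)); first by rewrite ler_piMr ?exprn_ge0.
  by rewrite lerXn2r ?nnegrE ?ler0n // ler_nat.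
have kn : 16 * n%:R ^+ 3 * kappa ^+ 2 <= 1.
  rewrite -(@expr_le1 _ 3) //; last by rewrite !mulr_ge0 ?exprn_ge0 // ltW.
  have -> : (16 * n%:R ^+ 3 * kappa ^+ 2) ^+ 3
     = kappa ^+ 6 * (16 * n%:R ^+ 3) ^+ 3 by ring.
  exact: k6.
have Lip0 := Lip_gt0 n0 gL g_ones.
pose Lam := Lip g ^+ 2 / (thetag ^+ 2 * vartheta q ^+ 2).
have Lam0 : 0 <= Lam by rewrite divr_ge0 ?sqr_ge0 // -exprMn sqr_ge0.
have main x t m : 0 <= t <= 1 -> `|uN q g N x t m - u (x, t)| <= bound.
  move=> t01.
  apply: le_trans (rate_of_mesh n0 d0 N0 q_range E1 gL th0 g_mono g_scale g_ones usol
    k0 k3 kn x m t01) _.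
  (* The remaining factors only enlarge the bound: the logarithm of a number at least 1 is
     nonnegative, and a negative power of [lam <= 1] is at least 1. *)
  rewrite /bound -/Lam -[X in _ <= X]mulrA -/kappa ler_wpM2r ?(ltW k0) //.
  set l := ln _; have l0 : 0 <= l.
    by apply: ln_ge0; rewrite lerDl !mulr_ge0 // powR_ge0.
  have lam23 : 1 <= lam `^ (- (2 / 3)).
    rewrite -[leLHS](powRr0 lam).
    by apply: ger_powR; rewrite ?lam0 //; lra.
  have Z0 : 0 <= n%:R * (6 * n%:R + 3 + 128 * n%:R ^+ 4) * Lip g.
    by rewrite mulr_ge0 // ltW.
  apply: (@le_trans _ _ (n%:R * (6 * n%:R + 3 + 128 * n%:R ^+ 4) * Lip g * (1 + Lam + l))).
    by rewrite ler_wpM2l // lerDl.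
  by rewrite ler_peMr // mulr_ge0 // !addr_ge0.
split; apply: ub_ereal_sup => _ [[x t] /= st <-]; rewrite lee_fin.
  by apply: max_hist_near => m; exact: main.
by apply: min_hist_near => m; exact: main.
Qed.
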